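(* Let $(V,g)$ be a sliced space, where $V = M\times \mathbb{R}$, $M$ is an $n$-dimensional smooth manifold ($n\ge 2$) and $g$ is the $(n+1)$-dimensional Lorentz metric on $V$. Let $T_A$ be the Alexandrov spacetime topology on $V$ and let $T_P$ be the product topology on $V$. Then $(V,g)$ is globally hyperbolic if and only if for every basic-open set $D$ in $T_A$ there exists a basic-open set $B$ in $T_P$ such that $D \subset B$.
   Context: Sliced space: $V = M\times\mathbb{R}$, where $M$ is an $n$-dimensional smooth manifold, equipped with an $(n+1)$-dimensional Lorentz metric $g$ of the form $g = -N^2(\theta^0)^2 + g_{ij}\theta^i\theta^j$, where $\theta^0 = dt$, $\theta^i = dx^i + \beta^i dt$, $N = N(t,x^i)$ is the lapse function, $\beta^i(t,x^j)$ is the shift function, and the spatial slices $M_t = M\times\{t\}$ are spacelike submanifolds equipped with the time-dependent spatial metric $g_t = g_{ij}dx^i dx^j$. No boundedness hypothesis is made on the lapse, shift or spatial metric. The spacetime $(V,g)$ is time-oriented so that $t$ increases along future-directed timelike curves. Chronology: $x \ll y$ iff there is a future-oriented timelike curve joining $x$ to $y$; $I^+(x) = \{z\in V : x\ll z\}$, $I^-(y) = \{z\in V : z\ll y\}$. $J^+(x)$ denotes the topological closure of $I^+(x)$, and $J^-(y)$ denotes the topological closure of $I^-(y)$. Basic-open sets in $T_A$: the Alexandrov topology $T_A$ on $V$ is the topology with base consisting of the sets $\langle x,y\rangle = I^+(x)\cap I^-(y)$, $x,y\in V$ (the ''open diamonds''). A basic-open set in $T_A$ is such a set. Basic-open sets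 in $T_P$: let $T_M$ be the manifold topology of $M$, and let $h$ be an appropriate Riemannian metric on $M$, i.e. one for which the open balls $B^h_\epsilon(x)$ ($x\in M$, $\epsilon>0$) form a base of $T_M$. Let $T_{\mathbb{R}}$ be the usual topology of $\mathbb{R}$, with base the open intervals $(a,b)$. $T_P$ is the product topology on $M\times\mathbb{R}$, and a basic-open set in $T_P$ is a set of the form $B^h_\epsilon(x)\times(a,b)$ (''open cylinder'') with $x\in M$, $\epsilon>0$ and $a<b$ real. Strong causality: a spacetime is strongly causal if it is strongly causal at each of its points, i.e. every neighbourhood of each point $p$ contains a neighbourhood of $p$ which is causally convex in the sense that no timelike curve meets it in a disconnected set. Global hyperbolicity: a spacetime is globally hyperbolic iff it is strongly causal and all the ''causal diamonds'' $J^+(x)\cap J^-(y)$ are compact.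
   Formalization: The Riemannian metric h defining the open cylinders is not an arbitrary one whose balls form a base (the claim then fails, e.g. Minkowski metric over a Euclidean open ball); the theorem asserts that some such h, depending only on M, works for all sliced metrics g. *)

(* Defs.v *)
From HB Require Import structures.
From mathcomp Require Import all_boot all_order all_algebra.
From mathcomp Require Import all_classical all_reals all_analysis.

Set Implicit Arguments.
Unset Strict Implicit.
Unset Printing Implicit Defensive.

Import Order.TTheory GRing.Theory Num.Theory.
Import numFieldNormedType.Exports.

Local Open Scope classical_set_scope.
Local Open Scope ring_scope.

(* Only meaningful for [U] open: then every directional derivative at a point
   of [U] depends on the values of [f] in [U] alone. *)
Fixpoint Ck_on (R : realType) (V W : normedModType R) (k : nat)
    (U : set V) (f : V -> W) : Prop :=
  match k with
  | 0%N => forall x, U x -> {for x, continuous f}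
  | k'.+1 => (forall x, U x -> differentiable f x) /\
             (forall v : V, Ck_on k' U (fun x => 'D_v f x))
  end.

Definition smooth_on (R : realType) (V W : normedModType R)
    (U : set V) (f : V -> W) : Prop := forall k, Ck_on k U f.

(* Charts are total functions; [chart_map] is junk outside [chart_dom], and
   [chart_inv] is junk outside the image of [chart_dom]. *)
Record chart (R : realType) (n : nat) (M : topologicalType) := Chart {
  chart_dom : set M;
  chart_map : M -> 'rV[R]_n;
  chart_inv : 'rV[R]_n -> M;
  chart_dom_open : open chart_dom;
  chart_img_open : open (chart_map @` chart_dom);
  chart_mapK : forall x, chart_dom x -> chart_inv (chart_map x) = x;
  chart_map_continuous :
    forall x, chart_dom x -> {for x, continuous chart_map};
  chart_inv_continuous :
    forall u, (chart_map @` chart_dom) u -> {for u, continuous chart_inv}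
}.

Record smooth_manifold (R : realType) (n : nat) := SmoothManifold {
  points :> topologicalType;
  points_hausdorff : hausdorff_space points;
  points_second_countable : @second_countable points;
  atlas : Type;
  chart_of : atlas -> chart R n points;
  atlas_cover : forall x, exists i, chart_dom (chart_of i) x;
  atlas_smooth : forall i j,
    smooth_on
      (chart_map (chart_of i) @`
         (chart_dom (chart_of i) `&` chart_dom (chart_of j)))
      (chart_map (chart_of j) \o chart_inv (chart_of i))
}.

Section Geometry.
Variables (R : realType) (n : nat) (M : smooth_manifold R n).

Let dom (i : atlas M) := chart_dom (chart_of i).
Let phi (i : atlas M) := chart_map (chart_of i).
Let psi (i : atlas M) := chart_inv (chart_of i).
Let img (i : atlas M) := phi i @` dom i.

(* Components in the chart [j] of the tangent vector at [x] that has the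
   components [u] in the chart [i]. *)
Definition change_chart (i j : atlas M) (x : M) (u : 'rV[R]_n) : 'rV[R]_n :=
  'D_u (phi j \o psi i) (phi i x).

Definition bilin (G : 'M[R]_n) (u v : 'rV[R]_n) : R := (u *m G *m v^T) 0 0.

(* [h i x] is the matrix of components at [x], in the chart [i], of a field of
   inner products on the tangent spaces of [M]. *)
Definition inner_product_field (h : atlas M -> M -> 'M[R]_n) : Prop :=
  [/\ forall i x, dom i x -> (h i x)^T = h i x,
      forall i x u, dom i x -> u != 0 -> 0 < bilin (h i x) u u
    & forall i j x u v, dom i x -> dom j x ->
        bilin (h j x) (change_chart i j x u) (change_chart i j x v) =
        bilin (h i x) u v].

Record riemannian_metric := RiemannianMetric {
  riem :> atlas M -> M -> 'M[R]_n;
  riem_inner : inner_product_field riem;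
  riem_smooth : forall i, smooth_on (img i) (fun u => riem i (psi i u))
}.

(* A C^1 curve segment on [a, b] is, as usual, the restriction of a map which
   is C^1 on a neighbourhood of [a, b]. *)
Definition C1_at (W : normedModType R) (f : R -> W) (s : R) : Prop :=
  \forall r \near s, derivable f r 1 /\ {for r, continuous (derive1 f)}.

Definition C1_curve_at (c : R -> M) (s : R) : Prop :=
  {for s, continuous c} /\ forall i, dom i (c s) -> C1_at (phi i \o c) s.

Definition is_speed (h : riemannian_metric) (c : R -> M) (s l : R) : Prop :=
  forall i, dom i (c s) ->
    let v := derive1 (phi i \o c) s in l = Num.sqrt (bilin (h i (c s)) v v).

(* [curve_length h x y l]: some piecewise C^1 curve from [x] to [y] has
   [h]-length [l]. *)
Inductive curve_length (h : riemannian_metric) : M -> M -> R -> Prop :=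
| curve_length_segment (c : R -> M) (v : R -> R) (a b : R) :
    a < b ->
    (forall s, a <= s <= b -> C1_curve_at c s) ->
    (forall s, a <= s <= b -> is_speed h c s (v s)) ->
    curve_length h (c a) (c b) (Rintegral lebesgue_measure `[a, b] v)
| curve_length_join x y z l l' :
    curve_length h x y l -> curve_length h y z l' ->
    curve_length h x z (l + l').

(* [+oo] between different connected components. *)
Definition riem_dist (h : riemannian_metric) (x y : M) : \bar R :=
  ereal_inf [set l%:E | l in [set l | curve_length h x y l]].

Definition riem_ball (h : riemannian_metric) (x : M) (e : R) : set M :=
  [set y | (riem_dist h x y < e%:E)%E].

(* The base of the topology of [M] consists of the balls of one metric on [M].
   It has to be a suitable one: when [M] is a Euclidean open ball with the
   restricted Euclidean metric, every open diamond of Minkowski's metric on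
   M x R lies in an open cylinder, but M x R is not globally hyperbolic. *)
Definition appropriate (h : riemannian_metric) : Prop :=
  basis [set B | exists x e, 0 < e /\ B = riem_ball h x e].

Definition spacetime : topologicalType := (M * R)%type.

Definition st_coord (i : atlas M) (p : spacetime) : 'rV[R]_n * R :=
  (phi i p.1, p.2).

(* The components of the shift and of the spatial metric are taken in the charts
   of [M]; the lapse, the shift and the spatial metric may all depend on time. *)
Record sliced_metric := SlicedMetric {
  lapse : spacetime -> R;
  shift : atlas M -> spacetime -> 'rV[R]_n;
  spatial : R -> atlas M -> M -> 'M[R]_n;
  lapse_gt0 : forall p, 0 < lapse p;
  shift_compat : forall i j p, dom i p.1 -> dom j p.1 ->
    shift j p = change_chart i j p.1 (shift i p);
  spatial_inner : forall t, inner_product_field (spatial t);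
  lapse_smooth : forall i,
    smooth_on (img i `*` setT)
      (fun q : 'rV[R]_n * R => lapse (psi i q.1, q.2));
  shift_smooth : forall i,
    smooth_on (img i `*` setT)
      (fun q : 'rV[R]_n * R => shift i (psi i q.1, q.2));
  spatial_smooth : forall i,
    smooth_on (img i `*` setT)
      (fun q : 'rV[R]_n * R => spatial q.2 i (psi i q.1))
}.

Variable g : sliced_metric.

(* A tangent vector [X] has the components [X.1 = dx X] and [X.2 = dt X], so
   that theta^0 X = X.2 and theta X = X.1 + X.2 *: beta. *)
Definition lorentz (i : atlas M) (p : spacetime) (X Y : 'rV[R]_n * R) : R :=
  - lapse g p ^+ 2 * (X.2 * Y.2) +
  bilin (spatial g p.2 i p.1)
    (X.1 + X.2 *: shift g i p) (Y.1 + Y.2 *: shift g i p).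

Definition future_timelike_at (c : R -> spacetime) (s : R) : Prop :=
  {for s, continuous c} /\
  forall i, dom i (c s).1 ->
    let X := derive1 (st_coord i \o c) s in
    [/\ C1_at (st_coord i \o c) s, lorentz i (c s) X X < 0 & 0 < X.2].

(* [timelike_curve x y C]: [C] is the image of a piecewise C^1 future-directed
   timelike curve from [x] to [y].  Past-directed curves have the same images. *)
Inductive timelike_curve : spacetime -> spacetime -> set spacetime -> Prop :=
| timelike_segment (c : R -> spacetime) (a b : R) :
    a < b ->
    (forall s, a <= s <= b -> future_timelike_at c s) ->
    timelike_curve (c a) (c b) (c @` `[a, b])
| timelike_join x y z C C' :
    timelike_curve x y C -> timelike_curve y z C' ->
    timelike_curve x z (C `|` C').

Definition chronological (x y : spacetime) : Prop :=
  exists C, timelike_curve x y C.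

Definition Iplus (x : spacetime) : set spacetime :=
  [set z | chronological x z].
Definition Iminus (y : spacetime) : set spacetime :=
  [set z | chronological z y].
Definition Jplus (x : spacetime) : set spacetime := closure (Iplus x).
Definition Jminus (y : spacetime) : set spacetime := closure (Iminus y).

Definition causally_convex (W : set spacetime) : Prop :=
  forall x y C, timelike_curve x y C -> connected (C `&` W).

Definition strongly_causal_at (p : spacetime) : Prop :=
  forall U, nbhs p U ->
    exists W, [/\ nbhs p W, W `<=` U & causally_convex W].

Definition strongly_causal : Prop := forall p, strongly_causal_at p.

Definition globally_hyperbolic : Prop :=
  strongly_causal /\ forall x y, compact (Jplus x `&` Jminus y).

Definition basic_open_A (D : set spacetime) : Prop :=
  exists x y, D = Iplus x `&` Iminus y.

Definition basic_open_P (h : riemannian_metric) (B : set spacetime) : Prop :=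
  exists x e a b,
    [/\ 0 < e, a < b & B = riem_ball h x e `*` [set t : R | a < t < b]].

End Geometry.

(* Main.v *)
Require Import Defs.
From HB Require Import structures.
From mathcomp Require Import all_boot all_order all_algebra.
From mathcomp Require Import all_classical all_reals all_analysis.
From mathcomp Require Import ring lra.

Set Implicit Arguments.
Unset Strict Implicit.
Unset Printing Implicit Defensive.

Import Order.TTheory GRing.Theory Num.Theory.
Import numFieldNormedType.Exports.

Local Open Scope classical_set_scope.
Local Open Scope ring_scope.

(** Two constructions carry the proof.

    The metric [h]. Take a locally finite family of smooth functions [F k c] on
    [M], built from bumps and from coordinates cut off by bumps, whose
    differentials are jointly injective and whose values separate each point
    from the complement of each of its neighbourhoods; let one of them be a
    proper function ([good_family_exists]). The metric [h] is the sum of the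
    squares of their differentials ([metric_of_family]). Each [F k c] then has
    [h]-gradient at most 1, so a curve from [x] to [y] is at least as long as
    [`|F k c y - F k c x|] ([dist_lower]). Hence small balls are small and the
    balls form a base, and the proper function bounds each ball inside a compact
    set ([proper_metric_exists]).

    If the space is globally hyperbolic, a diamond projects into a compact subset
    of [M] and consists of events that piecewise C^1 curves join to its vertex.
    The open balls about the vertex, together with the open set of unreachable
    points, cover the compact set, so one ball contains the projection
    ([reachable_in_ball]); the time coordinate increases along timelike curves.

    Conversely, every sliced space is strongly causal: a compactly supported
    bump function varies at bounded speed along timelike curves, so that it cuts
    out, together with the time, arbitrarily small neighbourhoods that no
    timelike curve leaves and re-enters ([convex_nbhs]). If all diamonds lie in
    cylinders, they are relatively compact. The closed set J+(x) /\ J-(y) is then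
    compact because it lies in the closure of one diamond: for any [x'] << [x],
    each event [z] in the closure of I+(x) satisfies [x'] << [z] ([push_up]). To
    see this, take timelike curves from [x] to events tending to [z]; they stay
    in a compact set and have a pointwise limit along an ultrafilter. Successive
    points [q], [r] of the limit curve are limits of causally related pairs, and
    locally [x'] << [q] implies [x'] << [r] ([local_push]): slide the
    approximating curves to the past along a timelike direction, by an amount
    that decreases linearly in time. The metric is Lipschitz, so the change of
    the light cones is dominated by the timelike velocity gained
    ([push_cone]). *)

(** * Smooth functions on normed spaces *)

Section CkGeneral.
Variables (R : realType) (V W : normedModType R).
Implicit Types (U Q : set V) (f g : V -> W).

Lemma near_eq_differentiable f g (x : V) :
  (\near x, f x = g x) -> differentiable f x -> differentiable g x.
Proof.
move=> fg /diff_locallyP[dfc dfE].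
have gE : g \o shift x = cst (g x) + 'd f x +o_ 0 id.
  apply/eqaddoP => e e0.
  have /eqaddoP/(_ e e0) := dfE.
  have : \forall h \near (0 : V), f (h + x) = g (h + x).
    by move: fg; rewrite (near_shift 0 x); apply: filterS => h; rewrite /= subr0.
  move=> H1 H2; near=> h.
  rewrite /= !fctE /= -(near H1 h)// -(nbhs_singleton fg).
  by near: h; exact: H2.
have E := diff_unique dfc gE.
apply/diff_locallyP; rewrite E; split => //.
Unshelve. all: by end_near. Qed.

Lemma Ck_on_sub k U Q f : Q `<=` U -> Ck_on k U f -> Ck_on k Q f.
Proof.
move=> QU; elim: k f => [|k IH] f /=; first by move=> h x /QU; exact: h.
by case=> h1 h2; split=> [x /QU|v]; [exact: h1|exact/IH/h2].
Qed.

Lemma Ck_on_local k U f :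
  (forall x, U x -> exists2 Q, Q x & Ck_on k Q f) -> Ck_on k U f.
Proof.
elim: k f => [|k IH] f /= h.
  by move=> x /h[Q Qx]; exact.
split=> [x /h[Q Qx [+ _]]|v]; first exact.
by apply: IH => x /h[Q Qx [_ hv]]; exists Q.
Qed.

Lemma open_near_eq U f g x :
  open U -> (forall y, U y -> f y = g y) -> U x -> \near x, f x = g x.
Proof.
by move=> oU fg Ux; apply: filterS (open_nbhs_nbhs (conj oU Ux)) => y; exact: fg.
Qed.

Lemma Ck_on_ext k U f g :
  open U -> (forall x, U x -> f x = g x) -> Ck_on k U f -> Ck_on k U g.
Proof.
move=> oU; elim: k f g => [|k IH] f g fg /=.
  move=> cf x Ux; rewrite /prop_for /continuous_at -(fg x)//.
  exact: cvg_trans (near_eq_cvg (open_near_eq oU fg Ux)) (cf _ Ux).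
move=> [df Df]; split=> [x Ux|v].
  exact: near_eq_differentiable (open_near_eq oU fg Ux) (df x Ux).
apply: IH (Df v) => x Ux; apply: near_eq_derive; exact: (open_near_eq oU fg).
Qed.

Lemma Ck_on_predn k U f : Ck_on k.+1 U f -> Ck_on k U f.
Proof.
elim: k f => [|k IH] f [df Df].
  by move=> x Ux; apply: differentiable_continuous; exact: df.
by split=> // v; exact/IH/Df.
Qed.

Lemma smooth_on_sub U Q f : Q `<=` U -> smooth_on U f -> smooth_on Q f.
Proof. by move=> QU h k; exact: Ck_on_sub (h k). Qed.

Lemma smooth_on_local U f :
  (forall x, U x -> exists2 Q, Q x & smooth_on Q f) -> smooth_on U f.
Proof. by move=> h k; apply: Ck_on_local => x /h[Q Qx /(_ k)]; exists Q. Qed.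

Lemma smooth_on_ext U f g :
  open U -> (forall x, U x -> f x = g x) -> smooth_on U f -> smooth_on U g.
Proof. by move=> oU fg h k; exact: Ck_on_ext (h k). Qed.

Lemma smooth_on_derive U f v : smooth_on U f -> smooth_on U (fun x => 'D_v f x).
Proof. by move=> h k; have [_] := h k.+1; exact. Qed.

Lemma smooth_on_diff U f x : smooth_on U f -> U x -> differentiable f x.
Proof. by move=> /(_ 1%N)[h _]; exact: h. Qed.

Lemma smooth_on_continuous U f x : smooth_on U f -> U x -> {for x, continuous f}.
Proof. by move=> /(_ 0%N); exact. Qed.

Lemma Ck_on_cst k U (c : W) : Ck_on k U (fun=> c).
Proof.
elim: k c => [|k IH] c /=; first by move=> x _; exact: cvg_cst.
split=> [x _|v]; first exact: differentiable_cst.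
rewrite (_ : (fun x => 'D_v (fun=> c) x) = (fun=> 0)); first exact: IH.
by apply/funext => x; exact: derive_cst.
Qed.

Lemma Ck_on_add k U f g :
  open U -> Ck_on k U f -> Ck_on k U g -> Ck_on k U (fun x => f x + g x).
Proof.
move=> oU; elim: k f g => [|k IH] f g /=.
  by move=> cf cg x Ux; apply: cvgD; [exact: cf|exact: cg].
move=> [df Df] [dg Dg]; split=> [x Ux|v].
  by apply: differentiableD; [exact: df|exact: dg].
apply: (Ck_on_ext oU) (IH _ _ (Df v) (Dg v)) => x Ux.
by rewrite -deriveD //; apply: diff_derivable; [exact: df|exact: dg].
Qed.

Lemma derive_add f x (u v : V) : differentiable f x ->
  'D_(u + v) f x = 'D_u f x + 'D_v f x.
Proof. by move=> df; rewrite !deriveE// linearD. Qed.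

Lemma derive_scale f x (a : R) (v : V) : differentiable f x ->
  'D_(a *: v) f x = a *: 'D_v f x.
Proof. by move=> df; rewrite !deriveE// linearZ. Qed.

Lemma derive_sum_dir f x (I : Type) (s : seq I) (v : I -> V) : differentiable f x ->
  'D_(\sum_(i <- s) v i) f x = \sum_(i <- s) 'D_(v i) f x.
Proof.
by move=> df; rewrite deriveE// linear_sum; apply: eq_bigr => i _; rewrite deriveE.
Qed.

End CkGeneral.

Lemma derive_comp (R : realType) (U V W : normedModType R) (f : U -> V) (g : V -> W)
    x u : differentiable f x -> differentiable g (f x) ->
  'D_u (g \o f) x = 'D_('D_u f x) g (f x).
Proof.
move=> df dg; rewrite deriveE; last exact: differentiable_comp.
by rewrite diff_comp//= !deriveE.
Qed.

Section CkScalar.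
Variables (R : realType) (V : normedModType R).
Implicit Types (U : set V) (f g : V -> R).

Lemma Ck_on_mul k U f g :
  open U -> Ck_on k U f -> Ck_on k U g -> Ck_on k U (fun x => f x * g x).
Proof.
move=> oU; elim: k f g => [|k IH] f g.
  by move=> /= cf cg x Ux; apply: cvgM; [exact: cf|exact: cg].
move=> Cf Cg; have Cf' := Ck_on_predn Cf; have Cg' := Ck_on_predn Cg.
case: Cf Cg => [df Df] [dg Dg]; split=> [x Ux|v].
  by apply: differentiableM; [exact: df|exact: dg].
apply: (Ck_on_ext oU); last exact: Ck_on_add oU (IH _ _ Cf' (Dg v)) (IH _ _ Cg' (Df v)).
move=> x Ux.
by rewrite (@deriveM R V f g)//; apply: diff_derivable; [exact: df|exact: dg].
Qed.

Lemma smooth_on_cst (W : normedModType R) U (c : W) : smooth_on U (fun=> c).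
Proof. by move=> k; exact: Ck_on_cst. Qed.

Lemma smooth_on_mul U f g :
  open U -> smooth_on U f -> smooth_on U g -> smooth_on U (fun x => f x * g x).
Proof. by move=> oU hf hg k; exact: Ck_on_mul (hf k) (hg k). Qed.

Lemma smooth_on_add (W : normedModType R) U (f g : V -> W) :
  open U -> smooth_on U f -> smooth_on U g -> smooth_on U (fun x => f x + g x).
Proof. by move=> oU hf hg k; exact: Ck_on_add (hf k) (hg k). Qed.

Lemma smooth_on_sum U (I : Type) (s : seq I) (f : I -> V -> R) :
  open U -> (forall i, smooth_on U (f i)) ->
  smooth_on U (fun x => \sum_(i <- s) f i x).
Proof.
move=> oU hf; elim: s => [|i s IH].
  by under eq_fun do rewrite big_nil; exact: smooth_on_cst.
under eq_fun do rewrite big_cons.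
exact: smooth_on_add.
Qed.

Lemma smooth_on_prod U (I : Type) (s : seq I) (f : I -> V -> R) :
  open U -> (forall i, smooth_on U (f i)) ->
  smooth_on U (fun x => \prod_(i <- s) f i x).
Proof.
move=> oU hf; elim: s => [|i s IH].
  by under eq_fun do rewrite big_nil; exact: smooth_on_cst.
under eq_fun do rewrite big_cons.
exact: smooth_on_mul.
Qed.

(** The derivative of [e t \o f] involves [e (d t) \o f], so the induction on the order
    has to run over a whole family closed under differentiation. *)
Lemma smooth_on_comp U f (T : Type) (d : T -> T) (e : T -> R -> R) (t : T) :
  (forall s (x : R), is_derive x (1 : R) (e s) (e (d s) x)) ->
  open U -> smooth_on U f -> smooth_on U (fun x => e t (f x)).
Proof.
move=> de oU hf k; elim: k t => [|k IH] t /=.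
  move=> x Ux; apply: continuous_comp; first exact: smooth_on_continuous hf Ux.
  apply: differentiable_continuous; apply/derivable1_diffP.
  exact: (@ex_derive _ _ _ _ _ _ _ (de t _)).
have det x : differentiable (e t) x.
  by apply/derivable1_diffP; exact: (@ex_derive _ _ _ _ _ _ _ (de t _)).
split=> [x Ux|v].
  by apply: differentiable_comp => //; exact: smooth_on_diff hf Ux.
have [_ /(_ v) Df] := hf k.+1.
apply: (Ck_on_ext oU); last exact: Ck_on_mul oU Df (IH (d t)).
move=> x Ux; have dfx := smooth_on_diff hf Ux.
rewrite [RHS]deriveE; last exact: differentiable_comp.
rewrite diff_comp//= deriveE//= .
rewrite deriv1E; last exact/derivable1_diffP.
by rewrite derive1E (@derive_val _ _ _ _ _ _ _ (de t _)).
Qed.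

End CkScalar.

Section CkMatrix.
Variables (R : realType) (V : normedModType R) (m n : nat).
Implicit Types (U : set V) (f : V -> 'M[R]_(m, n)).

Lemma differentiable_entries f x :
  (forall i j, differentiable (fun y => f y i j : R) x) -> differentiable f x.
Proof.
move=> h.
have H (s : seq ('I_m * 'I_n)) :
    differentiable (fun y => \sum_(p <- s) f y p.1 p.2 *: delta_mx p.1 p.2) x.
  elim: s => [|p s IH].
    by under eq_fun do rewrite big_nil; exact: differentiable_cst.
  under eq_fun do rewrite big_cons.
  by apply: differentiableD => //; exact: differentiableZl.
rewrite (_ : f = fun y => \sum_p f y p.1 p.2 *: delta_mx p.1 p.2); first exact: H.
by apply/funext => y; rewrite -(pair_bigA _ (fun i j => f y i j *: delta_mx i j)) -matrix_sum_delta.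
Qed.

Lemma differentiable_entry f x i j :
  differentiable f x -> differentiable (fun y => f y i j : R) x.
Proof.
move=> df; apply: (@differentiable_comp _ _ _ _ f (fun A : 'M[R]_(m, n) => A i j : R)) => //.
exact: differentiable_coord.
Qed.

Lemma derive_entry f x v i j : differentiable f x ->
  'D_v (fun y => f y i j : R) x = 'D_v f x i j.
Proof.
by move=> df; rewrite derive_mx; [rewrite mxE|exact: diff_derivable].
Qed.

Lemma Ck_on_entry k U f i j :
  open U -> Ck_on k U f -> Ck_on k U (fun x => f x i j : R).
Proof.
move=> oU; elim: k f => [|k IH] f.
  move=> /= cf x Ux.
  apply: (@continuous_comp _ _ _ f (fun A : 'M[R]_(m, n) => A i j : R)); first exact: cf.
  exact: coord_continuous.
move=> [df Df]; split=> [x Ux|v]; first exact/differentiable_entry/df.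
apply: (Ck_on_ext oU) (IH _ (Df v)) => x Ux.
by rewrite derive_entry//; exact: df.
Qed.

Lemma smooth_on_entry U f i j :
  open U -> smooth_on U f -> smooth_on U (fun x => f x i j : R).
Proof. by move=> oU h k; exact: Ck_on_entry. Qed.

Lemma smooth_on_entries U f :
  open U -> (forall i j, smooth_on U (fun x => f x i j : R)) -> smooth_on U f.
Proof.
move=> oU h k; elim: k f h => [|k IH] f h.
  move=> x Ux; apply: differentiable_continuous; apply: differentiable_entries => i j.
  exact: smooth_on_diff (h i j) Ux.
have df x : U x -> differentiable f x.
  by move=> Ux; apply: differentiable_entries => i j; exact: smooth_on_diff (h i j) Ux.
split=> // v; apply: IH => i j.
apply: (smooth_on_ext oU) (smooth_on_derive v (h i j)) => x Ux.
by rewrite derive_entry//; exact: df.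
Qed.

End CkMatrix.

Section FlatExp.
Variable R : realType.
Implicit Types (p : {poly R}) (x : R).

(** With arbitrary polynomial factors allowed, these functions form a family closed
    under differentiation; they are smooth at 0, where they are flat. *)
Definition flat_exp p x : R := if 0 < x then p.[x^-1] * expR (- x^-1) else 0.
Definition flat_next p : {poly R} := 'X^2 * (p - p^`()).

Lemma exprn_expRN_le (k : nat) (y : R) : 0 <= y -> y ^+ k * expR (- y) <= k`!%:R.
Proof.
move=> y0; rewrite expRN ler_pdivrMr ?expR_gt0//.
case: k => [|k]; first by rewrite expr0 fact0 mul1r -expR0 ler_expR.
have := expR_ge1Dxn k y0.
rewrite -(ler_pM2l (_ : 0 < (k.+1)`!%:R :> R)) ?ltr0n ?fact_gt0// => /(le_trans _); apply.
rewrite mulrDr mulr1 mulrCA divff ?mulr1 ?pnatr_eq0 -?lt0n ?fact_gt0//.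
by rewrite ler_wpDl// ler0n.
Qed.

Lemma poly_expRN_bounded p :
  exists C : R, forall y, 0 <= y -> `|p.[y]| * expR (- y) <= C.
Proof.
exists (\sum_(k < size p) `|p`_k| * k`!%:R) => y y0.
rewrite horner_coef; apply: (@le_trans _ _ ((\sum_(k < size p) `|p`_k * y ^+ k|) * expR (- y))).
  by rewrite ler_wpM2r ?expR_ge0//; exact: ler_norm_sum.
rewrite mulr_suml; apply: ler_sum => k _.
rewrite normrM -mulrA ler_wpM2l// (ger0_norm (exprn_ge0 _ y0)).
exact: exprn_expRN_le.
Qed.

(** A bound by a multiple of [x ^+ 2] makes the difference quotient at 0 vanish in
    the limit. *)
Lemma flat_exp_quadratic p : exists C : R, forall x, `|flat_exp p x| <= C * x ^+ 2.
Proof.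
have [C HC] := poly_expRN_bounded ('X^2 * p).
have C0 : 0 <= C by apply: le_trans (HC 0 _) => //; rewrite mulr_ge0 ?expR_ge0.
exists C => x; rewrite /flat_exp; case: ifPn => x0; last by rewrite normr0 mulr_ge0 ?sqr_ge0.
have := HC x^-1; rewrite invr_ge0 (ltW x0) => /(_ isT).
rewrite hornerM hornerXn.
set u := p.[_]; set v := expR _ => H.
rewrite normrM [`|v|]ger0_norm ?expR_ge0//.
have x2 : 0 < x ^+ 2 by rewrite exprn_gt0.
rewrite -ler_pdivrMr//; apply: le_trans H.
rewrite normrM (@ger0_norm _ (_ ^+ 2)); last by rewrite exprn_ge0 ?invr_ge0 ?ltW.
by rewrite exprVn [leLHS]mulrC mulrA.
Qed.

Lemma is_derive_flat_exp p x : is_derive x (1 : R) (flat_exp p) (flat_exp (flat_next p) x).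
Proof.
have [x0|x0|->] := ltgtP x 0.
- have H : \near x, cst 0 x = flat_exp p x.
    near=> y; rewrite /flat_exp ltNge (_ : y <= 0)//; near: y.
    by apply: filterS (lt_nbhsl x0) => y /ltW.
  apply: (near_eq_is_derive H); rewrite /flat_exp ltNge (ltW x0)/=.
  exact: is_derive_cst.
- have H : \near x, p.[x^-1] * expR (- x^-1) = flat_exp p x.
    near=> y; rewrite /flat_exp (_ : 0 < y)//; near: y.
    exact: lt_nbhsr x0.
  apply: (near_eq_is_derive H).
  have xn0 : x != 0 by rewrite gt_eqF.
  have D1 : is_derive x (1:R) (fun y : R => y^-1) (- x^-2).
    have := @is_deriveV R id x 1 1 xn0 (is_derive_id _ _).
    by rewrite scaler1.
  have D2 := @is_derive1_comp R (horner p) _ _ _ _ (is_derive_poly p _) D1.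
  have D3 := @is_derive1_comp R expR _ _ _ _ (is_derive_expR _) (is_deriveN D1).
  apply: (is_derive_eq (is_deriveM D2 D3)).
  rewrite /flat_exp x0 /flat_next hornerM hornerXn hornerD hornerN /GRing.scale/=.
  by rewrite exprVn; set a := p.[_]; set b := _.[_]; set c := expR _; ring.
- have [C HC] := flat_exp_quadratic p.
  have F0 q : flat_exp q 0 = 0 by rewrite /flat_exp ltxx.
  rewrite F0.
  have N0 : C * `|h| @[h --> (0 : R)^'] --> (0 : R).
    rewrite -[X in _ --> X](mulr0 C); apply: cvgMr; apply: cvg_within_filter.
    exact/norm_cvg0P/cvg_id.
  have L : (fun h => h^-1 *: ((flat_exp p \o shift (0:R)) (h *: (1:R)) - flat_exp p 0))
      @ 0^' --> (0 : R).
    apply: (@squeeze_cvgr _ _ _ _ (fun h => - (C * `|h|)) (fun h => C * `|h|)).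
    + near=> h; rewrite -ler_norml /= F0 subr0 addr0 /GRing.scale/= mulr1 normrM normfV.
      have h0 : h != 0 by near: h; exact: nbhs_dnbhs_neq.
      rewrite ler_pdivrMl ?normr_gt0//; apply: le_trans (HC h) _.
      by rewrite [leRHS]mulrCA -normrM -expr2 (ger0_norm (sqr_ge0 _)).
    + by have := cvgN N0; rewrite oppr0; apply.
    + exact: N0.
  apply: DeriveDef; first by apply/cvg_ex; exists 0.
  by apply/cvg_lim.
Unshelve. all: by end_near. Qed.

Lemma flat_exp_gt0 x : 0 < x -> 0 < flat_exp 1 x.
Proof. by move=> x0; rewrite /flat_exp x0 hornerC mul1r expR_gt0. Qed.

Lemma flat_exp_le0 p x : x <= 0 -> flat_exp p x = 0.
Proof. by move=> x0; rewrite /flat_exp ltNge x0. Qed.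

Lemma flat_exp_ge0 x : 0 <= flat_exp 1 x.
Proof. by have [/flat_exp_le0 ->//|/flat_exp_gt0/ltW] := leP x 0. Qed.

Lemma flat_exp_le x y : x <= y -> flat_exp 1 x <= flat_exp 1 y.
Proof.
have [/flat_exp_le0 ->//|x0 xy] := leP x 0; first by rewrite flat_exp_ge0.
rewrite /flat_exp x0 (lt_le_trans x0 xy) !hornerC !mul1r ler_expR lerN2.
by rewrite lef_pV2// posrE (lt_le_trans x0 xy).
Qed.

Lemma smooth_on_flat_exp (V : normedModType R) (U : set V) (f : V -> R) :
  open U -> smooth_on U f -> smooth_on U (fun y => flat_exp 1 (f y)).
Proof. by move=> oU hf; exact: (smooth_on_comp _ is_derive_flat_exp oU hf). Qed.

End FlatExp.

(** * Smooth functions and bumps on a manifold *)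

Local Notation dom i := (chart_dom (chart_of i)).
Local Notation phi i := (chart_map (chart_of i)).
Local Notation psi i := (chart_inv (chart_of i)).
Local Notation img i := (chart_map (chart_of i) @` chart_dom (chart_of i)).

Section SmoothFunctions.
Variables (R : realType) (n : nat) (M : smooth_manifold R n).
Implicit Types (i j : atlas M) (x y : M) (F G : M -> R).

Lemma dom_open i : open (dom i). Proof. exact: chart_dom_open. Qed.
Lemma img_open i : open (img i). Proof. exact: chart_img_open. Qed.

Lemma psi_phi i x : dom i x -> psi i (phi i x) = x.
Proof. exact: chart_mapK. Qed.

Lemma img_phi i x : dom i x -> img i (phi i x).
Proof. by move=> ix; exists x. Qed.

Lemma dom_psi i u : img i u -> dom i (psi i u).
Proof. by case=> x ix <-; rewrite psi_phi. Qed.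

Lemma phi_psi i u : img i u -> phi i (psi i u) = u.
Proof. by case=> x ix <-; rewrite psi_phi. Qed.

Lemma phi_continuous i x : dom i x -> {for x, continuous (phi i)}.
Proof. exact: chart_map_continuous. Qed.

Lemma psi_continuous i u : img i u -> {for u, continuous (psi i)}.
Proof. exact: chart_inv_continuous. Qed.

Lemma dom_nbhs i x : dom i x -> nbhs x (dom i).
Proof. by move=> ix; exact: (open_nbhs_nbhs (conj (dom_open i) ix)). Qed.

Lemma img_nbhs i u : img i u -> nbhs u (img i).
Proof. by move=> iu; apply: open_nbhs_nbhs; split=> //; exact: img_open. Qed.

Definition overlap i j : set 'rV[R]_n := phi i @` (dom i `&` dom j).

Lemma overlapE i j : overlap i j = img i `&` psi i @^-1` dom j.
Proof.
apply/seteqP; split=> [_ [x [ix jx] <-]|u [iu ju]].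
  by split; [exists x|rewrite /= psi_phi].
by exists (psi i u); [split=> //; exact: dom_psi|exact: phi_psi].
Qed.

Lemma overlap_open i j : open (overlap i j).
Proof.
rewrite overlapE openE => u [iu ju]; apply: filterI; first exact: img_nbhs.
apply: (psi_continuous iu); exact: dom_nbhs.
Qed.

Lemma overlap_phi i j x : dom i x -> dom j x -> overlap i j (phi i x).
Proof. by exists x. Qed.

Lemma transition_smooth i j : smooth_on (overlap i j) (phi j \o psi i).
Proof. exact: atlas_smooth. Qed.

Lemma transition_diff i j x : dom i x -> dom j x ->
  differentiable (phi j \o psi i) (phi i x).
Proof.
by move=> ix jx; apply: (smooth_on_diff (@transition_smooth i j)); exact: overlap_phi.
Qed.

Lemma transition_near i j x : dom i x -> dom j x ->
  \forall u \near phi i x, psi j (phi j (psi i u)) = psi i u.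
Proof.
move=> ix jx.
apply: filterS (open_nbhs_nbhs (conj (@overlap_open i j) (overlap_phi ix jx))) => u.
by rewrite overlapE => -[_ /= ju]; rewrite psi_phi.
Qed.

Definition msmooth F := forall i, smooth_on (img i) (F \o psi i).

Lemma msmooth_cst c : msmooth (fun=> c).
Proof. by move=> i; exact: smooth_on_cst. Qed.

Lemma msmooth_add F G : msmooth F -> msmooth G -> msmooth (fun x => F x + G x).
Proof. by move=> hF hG i; apply: smooth_on_add; [exact: img_open|exact: hF|exact: hG]. Qed.

Lemma msmooth_mul F G : msmooth F -> msmooth G -> msmooth (fun x => F x * G x).
Proof. by move=> hF hG i; apply: smooth_on_mul; [exact: img_open|exact: hF|exact: hG]. Qed.

Lemma msmooth_flat_exp F : msmooth F -> msmooth (fun x => flat_exp 1 (F x)).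
Proof. by move=> hF i; apply: smooth_on_flat_exp; [exact: img_open|exact: hF]. Qed.

Lemma msmooth_sum (I : Type) (s : seq I) (F : I -> M -> R) :
  (forall k, msmooth (F k)) -> msmooth (fun x => \sum_(k <- s) F k x).
Proof.
by move=> hF i; apply: smooth_on_sum; [exact: img_open|move=> k; exact: hF].
Qed.

Lemma msmooth_prod (I : Type) (s : seq I) (F : I -> M -> R) :
  (forall k, msmooth (F k)) -> msmooth (fun x => \prod_(k <- s) F k x).
Proof.
by move=> hF i; apply: smooth_on_prod; [exact: img_open|move=> k; exact: hF].
Qed.

Lemma msmooth_local F :
  (forall x, exists2 U, open_nbhs x U &
    exists2 G, msmooth G & forall y, U y -> F y = G y) -> msmooth F.
Proof.
move=> h i; apply: smooth_on_local => u iu.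
have [U [oU Ux] [G sG FG]] := h (psi i u).
exists (img i `&` psi i @^-1` U) => //.
have oI : open (img i `&` psi i @^-1` U).
  rewrite openE => v [iv Uv]; apply: filterI; first exact: img_nbhs.
  by apply: (psi_continuous iv); exact: (open_nbhs_nbhs (conj oU Uv)).
apply: (smooth_on_ext oI (f := G \o psi i)); first by move=> v [_ /FG].
by apply: smooth_on_sub (sG i) => v [].
Qed.

Lemma msmooth_diff F i x : msmooth F -> dom i x ->
  differentiable (F \o psi i) (phi i x).
Proof. by move=> hF ix; apply: (smooth_on_diff (hF i)); exact: img_phi. Qed.

Lemma msmooth_continuous F : msmooth F -> continuous F.
Proof.
move=> hF x; have [i ix] := atlas_cover x.
have H : {for x, continuous ((F \o psi i) \o phi i)}.
  apply: continuous_comp; first exact: phi_continuous.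
  exact: (smooth_on_continuous (hF i) (img_phi ix)).
have E : \near x, ((F \o psi i) \o phi i) x = F x.
  by apply: filterS (dom_nbhs ix) => y iy /=; rewrite psi_phi.
have /= := cvg_trans (near_eq_cvg E) H; rewrite psi_phi//; exact.
Qed.

(** The differential of [F] at [x], read in the chart [i]. *)
Definition mderiv F i x (u : 'rV[R]_n) : R := 'D_u (F \o psi i) (phi i x).

Lemma mderiv_change F i j x u : msmooth F -> dom i x -> dom j x ->
  mderiv F j x (change_chart i j x u) = mderiv F i x u.
Proof.
move=> hF ix jx; rewrite /mderiv /change_chart.
have dt := transition_diff ix jx.
have dF := msmooth_diff hF jx.
have E : \forall u \near phi i x, ((F \o psi j) \o (phi j \o psi i)) u = (F \o psi i) u.
  by apply: filterS (transition_near ix jx) => v /= ->.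
rewrite -(near_eq_derive _ E).
have xE : (phi j \o psi i) (phi i x) = phi j x by rewrite /= psi_phi.
rewrite (@derive_comp _ _ _ _ (phi j \o psi i)) ?xE//.
Qed.

(** Off the chart the function vanishes near each point: its support is compact,
    hence closed as [M] is Hausdorff. *)
Lemma msmooth_extend0 F i (K : set M) : compact K -> K `<=` dom i ->
  (forall y, ~ K y -> F y = 0) ->
  (forall j, smooth_on (overlap j i) (F \o psi j)) -> msmooth F.
Proof.
move=> cK Ki F0 sF j; apply: smooth_on_local => u ju.
have [iu|niu] := pselect (dom i (psi j u)).
  by exists (overlap j i); [rewrite overlapE|exact: sF].
have clK : closed K by apply: compact_closed => //; exact: points_hausdorff.
have oI : open (img j `&` psi j @^-1` (~` K)).
  rewrite openE => v [jv Kv]; apply: filterI; first exact: img_nbhs.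
  apply: (psi_continuous jv); apply: open_nbhs_nbhs; split=> //.
  by rewrite openC.
exists (img j `&` psi j @^-1` (~` K)); first by split=> // /Ki.
apply: (smooth_on_ext oI) (smooth_on_cst _ (0 : R)) => v [_ Kv].
by rewrite /= F0.
Qed.

End SmoothFunctions.

Section Bumps.
Variables (R : realType) (n : nat) (M : smooth_manifold R n).
Implicit Types (i j : atlas M) (x y : M).

(** A bump [A] together with cut-off coordinate functions [B a]: on the set where [A]
    does not vanish, [A] and the [B a] determine the point. *)
Record coord_bump (A : M -> R) (B : 'I_n -> M -> R) : Prop := Bump {
  bump_smooth : msmooth A;
  bump_coord_smooth : forall a, msmooth (B a);
  bump_ge0 : forall x, 0 <= A x;
  bump_support : exists2 K, compact K & forall x, ~ K x -> A x = 0;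
  bump_chart : forall x, A x != 0 -> exists2 i, dom i x &
    forall y, A y != 0 -> dom i y /\ forall a, B a y = A y * phi i y 0 a
}.

(** The Euclidean distance takes the place of the norm of row vectors, which is the
    maximum norm and not smooth. *)
Definition sqdist (v u : 'rV[R]_n) : R := \sum_a (u 0 a - v 0 a) ^+ 2.

Lemma sqdist_ge0 v u : 0 <= sqdist v u.
Proof. by apply: sumr_ge0 => a _; exact: sqr_ge0. Qed.

Lemma sqdist_diag v : sqdist v v = 0.
Proof. by rewrite /sqdist big1// => a _; rewrite subrr expr0n. Qed.

Lemma rV_norm_le (u : 'rV[R]_n) (r : R) :
  0 <= r -> (forall a, `|u 0 a| <= r) -> `|u| <= r.
Proof.
move=> r0 h; rewrite /Num.norm/= mx_normrE; apply: bigmax_le => // -[a b] _ /=.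
by rewrite ord1.
Qed.

Lemma rV_entry_le (u : 'rV[R]_n) a : `|u 0 a| <= `|u|.
Proof.
rewrite [leRHS]/Num.norm/= mx_normrE.
exact: (le_bigmax _ (fun p : 'I_1 * 'I_n => `|u p.1 p.2|) (0, a)).
Qed.

Lemma sqdist_norm v u (r : R) : 0 <= r -> sqdist v u <= r ^+ 2 -> `|u - v| <= r.
Proof.
move=> r0 h; apply: rV_norm_le => // a; rewrite !mxE.
rewrite -(@ler_pXn2r _ 2)// ?nnegrE// real_normK ?num_real//.
apply: le_trans h; rewrite /sqdist (bigD1 a)//= lerDl.
by apply: sumr_ge0 => b _; exact: sqr_ge0.
Qed.

Lemma smooth_on_sqdist (V : normedModType R) (U : set V) (f : V -> 'rV[R]_n) v :
  open U -> smooth_on U f -> smooth_on U (fun z => sqdist v (f z)).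
Proof.
move=> oU hf; apply: (smooth_on_sum _ oU) => a; under eq_fun do rewrite expr2.
have H : smooth_on U (fun z => f z 0 a - v 0 a).
  by apply: (smooth_on_add oU (smooth_on_entry _ _ oU hf)); exact: smooth_on_cst.
exact: smooth_on_mul.
Qed.

Lemma sqdist_continuous v : continuous (sqdist v).
Proof.
move=> u.
have H : smooth_on [set: 'rV[R]_n] (sqdist v).
  apply: smooth_on_sqdist; first exact: openT.
  move=> [|k]; first by move=> x _; exact: cvg_id.
  split=> [x _|w]; first exact: ex_diff.
  rewrite (_ : (fun z => 'D_w id z) = (fun=> w)); first exact: Ck_on_cst.
  by apply/funext => x; rewrite derive_id.
exact: (smooth_on_continuous H).
Qed.

Lemma sqdist_compact v (r : R) : 0 <= r -> compact [set u | sqdist v u <= r ^+ 2].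
Proof.
move=> r0; apply: bounded_closed_compact; last first.
  apply: (@preimage_closed _ _ (sqdist v) [set y | y <= r ^+ 2]).
    by move=> u _; exact: sqdist_continuous.
  exact: closed_le.
exists (`|v| + r); split=> [|s]; first exact: num_real.
move=> hs u /(sqdist_norm r0) h; apply: ltW; apply: le_lt_trans hs.
by rewrite -[u](subrK v) addrC (le_trans (ler_normD _ _))// lerD2l.
Qed.

Lemma bump_exists x (U : set M) : nbhs x U -> exists A B,
  [/\ coord_bump A B, 0 < A x, forall y, A y <= A x & forall y, A y != 0 -> U y].
Proof.
move=> Ux; have [i ix] := atlas_cover x; pose v := phi i x.
have iv : img i v by exact: img_phi.
have H : nbhs v (img i `&` psi i @^-1` U).
  by apply: filterI; [exact: img_nbhs|apply: (psi_continuous iv); rewrite psi_phi].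
have [r r0 Hr] : exists2 r : R, 0 < r & forall u, `|u - v| <= r -> (img i `&` psi i @^-1` U) u.
  have /nbhs_ballP[e e0 He] := H.
  exists (e / 2); first by rewrite divr_gt0.
  move=> u hu; apply: He; rewrite -ball_normE /ball_/= distrC.
  by apply: le_lt_trans hu _; rewrite ltr_pdivrMr// ltr_pMr// ltr1n.
pose A y := if asbool (dom i y) then flat_exp 1 (r ^+ 2 - sqdist v (phi i y)) else 0.
have AE y : dom i y -> A y = flat_exp 1 (r ^+ 2 - sqdist v (phi i y)).
  by rewrite /A => /asboolT ->.
have A_dom y : A y != 0 -> dom i y.
  by rewrite /A; case: ifPn => [/asboolP//|_]; rewrite eqxx.
have A_sq y : A y != 0 -> sqdist v (phi i y) <= r ^+ 2.
  move=> /[dup] Ay /A_dom /AE E; rewrite leNgt; apply/negP => h.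
  by move: Ay; rewrite E flat_exp_le0 ?eqxx// subr_le0 ltW.
pose K := psi i @` [set u | sqdist v u <= r ^+ 2].
have KI u : sqdist v u <= r ^+ 2 -> (img i `&` psi i @^-1` U) u.
  by move=> /(sqdist_norm (ltW r0)) /Hr.
have cK : compact K.
  apply: continuous_compact; last exact: sqdist_compact (ltW r0).
  by apply: continuous_in_subspaceT => u /[!inE] /KI[iu _]; exact: psi_continuous.
have AK y : ~ K y -> A y = 0.
  move=> nK; apply/eqP/negP => /negP Ay; apply: nK.
  by exists (phi i y); [exact: A_sq|exact/psi_phi/A_dom].
have Ki : K `<=` dom i by move=> _ [u /KI[iu _] <-]; exact: dom_psi.
have sA j : smooth_on (overlap j i) (A \o psi j).
  apply: (@smooth_on_ext _ _ _ _
      (fun u => flat_exp 1 (r ^+ 2 - sqdist v ((phi i \o psi j) u)))).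
  - exact: overlap_open.
  - by move=> u; rewrite overlapE => -[_ /= iu]; rewrite AE.
  - apply: smooth_on_flat_exp; first exact: overlap_open.
    apply: smooth_on_add; [exact: overlap_open|exact: smooth_on_cst|].
    under eq_fun do rewrite -mulN1r.
    apply: smooth_on_mul; [exact: overlap_open|exact: smooth_on_cst|].
    apply: smooth_on_sqdist; [exact: overlap_open|exact: transition_smooth].
pose B a y := A y * phi i y 0 a.
exists A, B; split.
- split.
  + exact: msmooth_extend0 cK Ki AK sA.
  + move=> a; apply: (msmooth_extend0 cK Ki) => [y /AK|j]; first by rewrite /B => ->; rewrite mul0r.
    apply: smooth_on_mul; [exact: overlap_open|exact: sA|].
    apply: (smooth_on_entry 0 a); [exact: overlap_open|exact: transition_smooth].
  + by move=> y; rewrite /A; case: ifPn => // _; exact: flat_exp_ge0.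
  + by exists K.
  + by move=> y Ay; exists i; [exact: A_dom|move=> z /A_dom].
- by rewrite AE// flat_exp_gt0// sqdist_diag subr0 exprn_gt0.
- move=> y; have [->|Ay] := eqVneq (A y) 0.
    by rewrite AE// flat_exp_ge0.
  rewrite !AE//; last exact: A_dom.
  by apply: flat_exp_le; rewrite sqdist_diag lerD2l lerN2 sqdist_ge0.
- by move=> y Ay; have [_] := KI _ (A_sq _ Ay); rewrite /= psi_phi//; exact: A_dom.
Qed.

End Bumps.

(** * A locally finite family of smooth functions *)

Section Family.
Variables (R : realType) (n : nat) (M : smooth_manifold R n).
Implicit Types (x y : M).

Lemma bump0 : coord_bump (fun _ : M => 0 : R) (fun (_ : 'I_n) (_ : M) => 0 : R).
Proof.
split=> //; first exact: msmooth_cst.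
- by move=> _; exact: msmooth_cst.
- by exists set0 => //; exact: compact0.
- by move=> x; rewrite eqxx.
Qed.

(** Lindelof: among the members of a countable base, those on which some bump exceeds
    its threshold already cover [M]; select one such bump for each. *)
Lemma bump_sequence : exists (A : nat -> M -> R) (B : nat -> 'I_n -> M -> R) (c : nat -> R),
  [/\ forall k, coord_bump (A k) (B k), forall k, 0 < c k & forall x, exists k, c k < A k x].
Proof.
have [Bs /countable_injP[f finj] [Bo Bb]] := @points_second_countable _ _ M.
pose good (d : (M -> R) * ('I_n -> M -> R) * R) := coord_bump d.1.1 d.1.2 /\ 0 < d.2.
pose dset (d : (M -> R) * ('I_n -> M -> R) * R) := [set x | d.2 < d.1.1 x].
have H k : exists d, good d /\
    forall U, Bs U -> f U = k -> (exists2 d', good d' & U `<=` dset d') -> U `<=` dset d.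
  have [[U [BU fU [d gd Ud]]]|no] := pselect (exists U, [/\ Bs U, f U = k &
      exists2 d', good d' & U `<=` dset d']).
    exists d; split=> // U' BU' fU' _; rewrite (_ : U' = U)//.
    by apply: finj; rewrite ?inE// fU fU'.
  exists (fun=> 0, fun _ => fun=> 0, 1); split; first by split=> //; exact: bump0.
  by move=> U BU fU hU; exfalso; apply: no; exists U.
have [D HD] := boolp.choice H.
exists (fun k => (D k).1.1), (fun k => (D k).1.2), (fun k => (D k).2); split.
- by move=> k; case: (HD k) => -[].
- by move=> k; case: (HD k) => -[].
move=> x; have [A [B [bA Ax _ _]]] := bump_exists (@filterT _ (nbhs x) _).
pose d := (A, B, A x / 2).
have gd : good d by split=> //=; rewrite divr_gt0.
have xd : nbhs x (dset d).
  have /(_ x) cA := msmooth_continuous (bump_smooth bA).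
  apply: (cA [set y | A x / 2 < y]); apply: lt_nbhsr.
  by rewrite ltr_pdivrMr// ltr_pMr// ltr1n.
have [U [BU Ux] Ud] := Bb x _ xd.
exists (f U); have [_ /(_ U BU erefl)] := HD (f U).
by apply => //; exists d.
Qed.

Lemma sum_stable (g : nat -> R) m m' :
  (forall k, (m <= k)%N -> g k = 0) -> (forall k, (m' <= k)%N -> g k = 0) ->
  \sum_(k < m) g k = \sum_(k < m') g k.
Proof.
wlog mm : m m' / (m <= m')%N.
  by move=> h; case: (leqP m m') => [|/ltnW] mm h1 h2; [|apply/esym]; apply: h.
move=> h _; rewrite -!(big_mkord xpredT g) (@big_cat_nat _ _ _ m 0 m')//=.
by rewrite [X in _ + X]big_nat_cond [X in _ + X]big1 ?addr0// => k /andP[/andP[/h]].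
Qed.

(** The squares of the differentials of the family will be summed to a Riemannian
    metric; each clause is one thing that metric must do: make sense, be definite,
    generate the topology, and have relatively compact balls. *)
Record good_family (F : nat -> option 'I_n -> M -> R) : Prop := GoodFamily {
  gf_smooth : forall k c, msmooth (F k c);
  gf_locally_finite : forall x, exists m, exists2 U, open_nbhs x U &
    forall k c y, (m <= k)%N -> U y -> F k c y = 0;
  gf_immersion : forall i x u, dom i x ->
    (forall k c, mderiv (F k c) i x u = 0) -> u = 0;
  gf_separates : forall x U, nbhs x U -> exists k, exists2 e, 0 < e &
    forall y, (forall c, `|F k c y - F k c x| < e) -> U y;
  gf_proper : forall r : R, exists2 K, compact K & forall y, F 0%N None y < r -> K y
}.

Section Construction.
Variables (A : nat -> M -> R) (B : nat -> 'I_n -> M -> R) (c : nat -> R).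
Hypothesis bA : forall k, coord_bump (A k) (B k).
Hypothesis c_gt0 : forall k, 0 < c k.
Hypothesis cA : forall x, exists k, c k < A k x.

(* [T k] vanishes where [A k] exceeds its threshold and is 1 off the support of [A k];
   hence [P k] vanishes near a point as soon as [k] exceeds some [j] with
   [c j < A j], which makes the family below locally finite. *)
Let T k x : R := flat_exp 1 (c k - A k x) / flat_exp 1 (c k).
Let P k x : R := \prod_(j < k) T j x.

Let e_gt0 k : 0 < flat_exp 1 (c k). Proof. exact: flat_exp_gt0. Qed.

Let T_ge0 k x : 0 <= T k x.
Proof. by rewrite divr_ge0 ?flat_exp_ge0. Qed.

Let T_smooth k : msmooth (T k).
Proof.
apply: msmooth_mul; last exact: msmooth_cst.
apply: msmooth_flat_exp; apply: msmooth_add; first exact: msmooth_cst.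
rewrite (_ : (fun x => - A k x) = (fun x => -1 * A k x)); last first.
  by apply/funext => x; rewrite mulN1r.
by apply: msmooth_mul; [exact: msmooth_cst|exact: bump_smooth (bA k)].
Qed.

Let P_smooth k : msmooth (P k).
Proof. by apply: msmooth_prod => j; exact: T_smooth. Qed.

Let P_ge0 k x : 0 <= P k x.
Proof. by apply: prodr_ge0 => j _; exact: T_ge0. Qed.

Let P_eq0 j k x : c j <= A j x -> (j < k)%N -> P k x = 0.
Proof.
move=> h jk; rewrite /P (bigD1 (Ordinal jk))//= {1}/T flat_exp_le0 ?subr_le0//.
by rewrite !mul0r.
Qed.

Let P_eq1 k x : (forall j, (j < k)%N -> A j x = 0) -> P k x = 1.
Proof.
move=> h; rewrite /P big1// => j _; rewrite /T h// subr0 divff// gt_eqF//.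
Qed.

Let N x := sval (cid (cA x)).
Let N_ok x : c (N x) < A (N x) x. Proof. exact: svalP (cid (cA x)). Qed.

Let U j := [set x | c j < A j x].
Let U_open j : open (U j).
Proof.
apply: (@open_comp _ _ (A j) [set r | c j < r]) => [x _|]; last exact: open_gt.
by apply: msmooth_continuous; exact: bump_smooth (bA j).
Qed.

(* Outside the supports of the first [m] bumps the sum is at least [m], whence its
   properness. *)
Let f x : R := \sum_(k < N x) P k.+1 x.

Let f_stable j x : U j x -> f x = \sum_(k < j) P k.+1 x.
Proof.
move=> Ux; apply: (@sum_stable (fun k => P k.+1 x)) => k hk.
  by apply: (@P_eq0 (N x)) => //; exact/ltW/N_ok.
by apply: (@P_eq0 j) => //; exact: ltW Ux.
Qed.

Let F k (o : option 'I_n) x : R :=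
  if k is k'.+1 then (if o is Some a then B k' a x else A k' x) * P k' x else f x.

Let f_smooth : msmooth f.
Proof.
apply: msmooth_local => x; exists (U (N x)); first by split; [exact: U_open|exact: N_ok].
exists (fun y => \sum_(k < N x) P k.+1 y); first by apply: msmooth_sum => k; exact: P_smooth.
by move=> y; exact: f_stable.
Qed.

Let F_smooth k o : msmooth (F k o).
Proof.
case: k => [|k] /=; first exact: f_smooth.
apply: msmooth_mul; last exact: P_smooth.
by case: o => [a|]; [exact: bump_coord_smooth (bA k) a|exact: bump_smooth (bA k)].
Qed.

Let F_locally_finite x : exists m, exists2 V, open_nbhs x V &
  forall k o y, (m <= k)%N -> V y -> F k o y = 0.
Proof.
exists (N x).+2, (U (N x)); first by split; [exact: U_open|exact: N_ok].
move=> [//|k] o y hk Uy /=; rewrite (@P_eq0 (N x)) ?mulr0//.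
exact: ltW Uy.
Qed.

(* The least [k] with [c k <= A k x] works. *)
Let active x : exists2 k, A k x != 0 & P k x != 0.
Proof.
have ex : exists k, c k <= A k x by exists (N x); exact/ltW/N_ok.
exists (ex_minn ex); case: ex_minnP => k hk kmin.
  by rewrite gt_eqF// (lt_le_trans (c_gt0 k)).
apply/prodf_neq0 => j _.
rewrite mulf_neq0 ?invr_neq0// gt_eqF//; apply: flat_exp_gt0.
rewrite subr_gt0 ltNge; apply/negP => /kmin; by rewrite leqNgt ltn_ord.
Qed.

Let F_chart x : exists k, exists2 i, dom i x & F k None x != 0 /\
  forall y, F k None y != 0 -> dom i y /\ forall a, F k (Some a) y = F k None y * phi i y 0 a.
Proof.
have [k Ak Pk] := active x; have [i ix h] := bump_chart (bA k) Ak.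
exists k.+1, i => //; split=> /=; first by rewrite mulf_neq0.
move=> y; rewrite mulf_eq0 negb_or => /andP[/h[iy hy] _]; split=> // a.
by rewrite hy mulrAC.
Qed.

Let F_immersion i x u : dom i x ->
  (forall k o, mderiv (F k o) i x u = 0) -> u = 0.
Proof.
move=> ix; have [k [j jx [Fx hF]]] := F_chart x.
wlog ij : i u ix / i = j => [wl Fu|Fu].
  have cu : change_chart i j x u = 0.
    move: wl => /(_ j (change_chart i j x u) jx erefl). apply => k' o.
    by rewrite (mderiv_change u (F_smooth k' o) ix jx); exact: Fu.
  have E : \forall v \near phi i x, ((phi i \o psi j) \o (phi j \o psi i)) v = v.
    near=> v; rewrite /= (near (transition_near ix jx))// phi_psi//.
    by near: v; apply: img_nbhs; exact: img_phi.
  have := near_eq_derive u E; rewrite derive_id => <-.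
  have xE : (phi j \o psi i) (phi i x) = phi j x by rewrite /= psi_phi.
  have D1 := transition_diff ix jx.
  have D2 : differentiable (phi i \o psi j) ((phi j \o psi i) (phi i x)).
    by rewrite xE; exact: transition_diff.
  by rewrite (derive_comp u D1 D2) -/(change_chart i j x u) cu derive0.
subst i; apply/rowP => a; rewrite mxE.
have dF := msmooth_diff (F_smooth k None) jx.
have E : \forall v \near phi j x,
    ((F k None \o psi j) * (fun w : 'rV[R]_n => w 0 a : R)) v = (F k (Some a) \o psi j) v.
  have /= H := hF x Fx.
  have : \forall v \near phi j x, F k None (psi j v) != 0.
    have cF : {for phi j x, continuous (F k None \o psi j)}.
      exact: differentiable_continuous.
    apply: (cF [set r | r != 0]); rewrite /= psi_phi//.
    apply: open_nbhs_nbhs; split => //; exact: open_neq.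
  move=> H'; near=> v.
  have jv : img j v.
    by near: v; apply: img_nbhs; exact: img_phi.
  have Fv : F k None (psi j v) != 0 by near: v.
  have [_ Ev] := hF _ Fv.
  by rewrite /= fctE [RHS]Ev phi_psi.
have dc : differentiable (fun w : 'rV[R]_n => w 0 a : R) (phi j x).
  exact: differentiable_coord.
have := Fu k (Some a); rewrite /mderiv -(near_eq_derive _ E).
have D1 := diff_derivable (v := u) dF; have D2 := diff_derivable (v := u) dc.
rewrite (deriveM D1 D2).
have -> : 'D_u (F k None \o psi j) (phi j x) = 0 by exact: Fu.
have /matrixP/(_ 0 a) := derive_mx (@derivable_id R _ (phi j x) u).
rewrite derive_id mxE => <-; rewrite scaler0 addr0 /=.
rewrite psi_phi// => /eqP; rewrite /GRing.scale/= mulf_eq0 (negbTE Fx)/= => /eqP.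
by [].
Unshelve. all: by end_near. Qed.

Let F_separates x V : nbhs x V -> exists k, exists2 e, 0 < e &
  forall y, (forall o, `|F k o y - F k o x| < e) -> V y.
Proof.
move=> xV; have [k [i ix [Fx hF]]] := F_chart x.
have iv : img i (phi i x) by exact: img_phi.
have : nbhs (phi i x) (img i `&` psi i @^-1` V).
  by apply: filterI; [exact: img_nbhs|apply: (psi_continuous iv); rewrite psi_phi].
move=> /nbhs_ballP[r r0 Hr].
have Fx0 : 0 < `|F k None x| by rewrite normr_gt0.
pose C := 1 + `|phi i x|.
have C0 : 0 < C by rewrite ltr_pwDl.
pose e := Num.min (`|F k None x| / 2) (r / 4 * `|F k None x| / C).
have e0 : 0 < e by rewrite lt_min !divr_gt0// mulr_gt0// divr_gt0.
exists k, e => // y hy.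
have Fy : `|F k None x| / 2 <= `|F k None y|.
  have := hy None; rewrite lt_min => /andP[+ _].
  rewrite distrC => h; rewrite -[X in X / 2](subrK (`|F k None x| / 2)).
  have := lerB_dist (F k None x) (F k None y); lra.
have Fy0 : F k None y != 0 by rewrite -normr_gt0 (lt_le_trans _ Fy)// divr_gt0.
have [iy Ey] := hF _ Fy0; have [_ Ex] := hF _ Fx.
suff : ball (phi i x) r (phi i y) by move=> /Hr[_]; rewrite /= psi_phi.
rewrite -ball_normE /ball_/= distrC.
apply: (@le_lt_trans _ _ (r / 2)); last by rewrite ltr_pdivrMr// ltr_pMr// ltr1n.
apply: rV_norm_le => [|a]; first by rewrite divr_ge0// ltW.
rewrite !mxE -(ler_pM2l (_ : 0 < `|F k None y|)) ?normr_gt0// -normrM.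
have -> : F k None y * (phi i y 0 a - phi i x 0 a) =
    (F k (Some a) y - F k (Some a) x) - (F k None y - F k None x) * phi i x 0 a.
  by rewrite Ey Ex; ring.
apply: (le_trans (ler_normB _ _)); rewrite normrM.
apply: (@le_trans _ _ (e * C)).
  rewrite mulrDr mulr1 lerD//; first exact/ltW/hy.
  by apply: ler_pM => //; [exact/ltW/hy|exact: rV_entry_le].
apply: (@le_trans _ _ (r / 4 * `|F k None x|)).
  by rewrite -ler_pdivlMr// ge_min lexx orbT.
have := ltW r0; move: Fy; nra.
Qed.

Let F_proper (r : R) : exists2 K, compact K & forall y, F 0%N None y < r -> K y.
Proof.
have S k : exists K, compact K /\ forall x, ~ K x -> A k x = 0.
  by have [K cK h] := bump_support (bA k); exists K.
have [K HK] := boolp.choice S.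
have [m hm] : exists m : nat, r <= m%:R.
  by exists (Num.truncn `|r|).+1; apply: le_trans (ler_norm r) (ltW (truncnS_gt _)).
exists (\big[setU/set0]_(j < m) K j).
  by apply: bigsetU_compact => j _; have [] := HK j.
move=> y; apply: contraPP => nK; apply/negP; rewrite -leNgt /= (le_trans hm)//.
have A0 j : (j < m)%N -> A j y = 0.
  move=> jm; have [_] := HK j; apply=> Kj; apply: nK.
  by rewrite -bigcup_mkord; exists j.
have mN : (m <= N y)%N.
  rewrite leqNgt; apply/negP => /A0 h; have := N_ok y.
  by rewrite h ltNge ltW.
rewrite /f -(big_mkord xpredT (fun k => P k.+1 y)) (@big_cat_nat _ _ _ m 0 (N y))//=.
apply: ler_wpDr; first by apply: sumr_ge0 => k _; exact: P_ge0.
rewrite big_nat (eq_bigr (fun=> 1)).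
  by rewrite -big_nat sumr_const_nat subn0.
move=> k /andP[_ km]; apply: P_eq1 => j jk; apply: A0.
exact: leq_trans jk km.
Qed.

Lemma good_family_of_bumps : exists F, good_family F.
Proof.
exists F; split; [exact: F_smooth|exact: F_locally_finite|exact: F_immersion|
  exact: F_separates|exact: F_proper].
Qed.

End Construction.

Lemma good_family_exists : exists F, good_family F.
Proof.
have [A [B [c [bA c0 cA]]]] := bump_sequence.
exact: good_family_of_bumps bA c0 cA.
Qed.

End Family.

(** * The Riemannian metric of a family *)

Section Bilin.
Variables (R : realType) (n : nat).
Implicit Types (G : 'M[R]_n) (u v : 'rV[R]_n).

Lemma bilinE G u v : bilin G u v = \sum_a \sum_b u 0 a * G a b * v 0 b.
Proof.
rewrite /bilin mxE exchange_big /=; apply: eq_bigr => b _.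
by rewrite !mxE mulr_suml.
Qed.

End Bilin.

Section Metric.
Variables (R : realType) (n : nat) (M : smooth_manifold R n).
Implicit Types (x y : M).

Lemma mderivE (F : M -> R) i x u : msmooth F -> dom i x ->
  mderiv F i x u = \sum_a u 0 a * mderiv F i x (delta_mx 0 a).
Proof.
move=> hF ix; rewrite {1}(row_sum_delta u) /mderiv.
rewrite derive_sum_dir; last exact: msmooth_diff.
by apply: eq_bigr => a _; rewrite derive_scale//; exact: msmooth_diff.
Qed.

Lemma mderiv_near0 (F : M -> R) i x u (U : set M) : dom i x -> open_nbhs x U ->
  (forall y, U y -> F y = 0) -> mderiv F i x u = 0.
Proof.
move=> ix [oU Ux] F0; rewrite /mderiv.
rewrite (near_eq_derive (g := fun=> 0)) ?derive_cst//.
have : \forall v \near phi i x, U (psi i v).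
  apply: (psi_continuous (img_phi ix)); rewrite psi_phi//.
  exact: (open_nbhs_nbhs (conj oU Ux)).
by apply: filterS => v /F0.
Qed.

Section Gram.
Variable F : nat -> option 'I_n -> M -> R.
Hypothesis hF : good_family F.

Let lf x := gf_locally_finite hF x.
Let N x := sval (cid (lf x)).
Let N_ok x : exists2 U, open_nbhs x U &
    forall k c y, (N x <= k)%N -> U y -> F k c y = 0.
Proof. by rewrite /N; case: cid. Qed.

(* Members of index at least [N x] vanish near [x], so truncating the sum at [N x], or
   later, does not change it; this gives smoothness although [N] jumps. *)
Let gram m i x : 'M[R]_n := \matrix_(a, b) \sum_(k < m) \sum_c
  mderiv (F k c) i x (delta_mx 0 a) * mderiv (F k c) i x (delta_mx 0 b).

Let gram_field i x := gram (N x) i x.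

Let gram_bilin m i x u v : dom i x ->
  bilin (gram m i x) u v = \sum_(k < m) \sum_c mderiv (F k c) i x u * mderiv (F k c) i x v.
Proof.
move=> ix; rewrite bilinE.
under eq_bigr => a _ do under eq_bigr => b _ do
  (rewrite mxE mulr_sumr mulr_suml; under eq_bigr => k _ do rewrite mulr_sumr mulr_suml).
under eq_bigr => a _ do rewrite exchange_big /=.
rewrite exchange_big /=; apply: eq_bigr => k _.
under eq_bigr => a _ do rewrite exchange_big /=.
rewrite exchange_big /=; apply: eq_bigr => c _.
rewrite (mderivE u (gf_smooth hF k c) ix) (mderivE v (gf_smooth hF k c) ix).
rewrite mulr_suml; apply: eq_bigr => a _; rewrite mulr_sumr; apply: eq_bigr => b _.
by ring.
Qed.

Let mderiv_F0 i x u k c : dom i x -> (N x <= k)%N -> mderiv (F k c) i x u = 0.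
Proof.
move=> ix hk; have [U xU HU] := N_ok x.
by apply: (mderiv_near0 u ix xU) => y; exact: HU.
Qed.

Let gram_inner : inner_product_field gram_field.
Proof.
split.
- move=> i x ix; apply/matrixP => a b; rewrite !mxE; apply: eq_bigr => k _.
  by apply: eq_bigr => c _; rewrite mulrC.
- move=> i x u ix un0; rewrite gram_bilin//.
  have [k [c kc]] : exists k c, mderiv (F k c) i x u != 0.
    apply: contrapT => H; move/eqP: un0; apply; apply: (gf_immersion hF ix) => k c.
    by apply/eqP; rewrite -[_ == _]negbK; apply/negP => kc; apply: H; exists k, c.
  have kN : (k < N x)%N.
    by rewrite ltnNge; apply/negP => /(mderiv_F0 u c ix) E; rewrite E eqxx in kc.
  rewrite (bigD1 (Ordinal kN))//= (bigD1 c)//= -addrA ltr_pwDl//.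
    by rewrite -expr2 lt_neqAle sqr_ge0 andbT eq_sym expf_neq0.
  apply: addr_ge0; apply: sumr_ge0 => ? _; rewrite -?expr2 ?sqr_ge0//.
  by apply: sumr_ge0 => ? _; rewrite -expr2 sqr_ge0.
- move=> i j x u v ix jx; rewrite !gram_bilin//.
  apply: eq_bigr => k _; apply: eq_bigr => c _.
  by rewrite !(mderiv_change _ (gf_smooth hF k c) ix jx).
Qed.

Let gram_smooth i : smooth_on (img i) (fun u => gram_field i (psi i u)).
Proof.
apply: smooth_on_local => u iu.
have [U [oU Uu] HU] := N_ok (psi i u).
exists (img i `&` psi i @^-1` U) => //.
have oI : open (img i `&` psi i @^-1` U).
  rewrite openE => v [iv Uv]; apply: filterI; first exact: img_nbhs.
  by apply: (psi_continuous iv); exact: (open_nbhs_nbhs (conj oU Uv)).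
have S k c a : smooth_on (img i `&` psi i @^-1` U)
    (fun v => mderiv (F k c) i (psi i v) (delta_mx 0 a)).
  apply: (@smooth_on_ext _ _ _ _ (fun v => 'D_(delta_mx 0 a) (F k c \o psi i) v)) => //.
    by move=> v [iv _]; rewrite /mderiv phi_psi.
  apply: smooth_on_derive; apply: smooth_on_sub (gf_smooth hF k c i).
  by move=> v [].
apply: (@smooth_on_ext _ _ _ _ (fun v => gram (N (psi i u)) i (psi i v))) => //.
  move=> v [iv Uv]; apply/matrixP => a b; rewrite !mxE.
  pose g k := \sum_c mderiv (F k c) i (psi i v) (delta_mx 0 a) *
                     mderiv (F k c) i (psi i v) (delta_mx 0 b).
  have iv' := dom_psi iv.
  apply: (@sum_stable R g) => k hk; rewrite /g big1// => c _.
    by rewrite (@mderiv_near0 (F k c) _ _ _ U)// ?mul0r// => y Uy; exact: HU.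
  by rewrite mderiv_F0// mul0r.
apply: smooth_on_entries => // a b.
under eq_fun do rewrite mxE.
apply: smooth_on_sum => // k; apply: smooth_on_sum => // c.
by apply: smooth_on_mul.
Qed.

(** The quadratic form of the metric is a sum of squares, one of which is the square
    of the given differential. *)
Lemma metric_of_family : exists h : riemannian_metric M,
  forall k c i x u, dom i x -> (mderiv (F k c) i x u) ^+ 2 <= bilin (h i x) u u.
Proof.
exists (RiemannianMetric gram_inner gram_smooth) => k c i x u ix /=.
rewrite gram_bilin//.
have [kN|Nk] := ltnP k (N x); last first.
  rewrite mderiv_F0// expr0n /=; apply: sumr_ge0 => ? _; apply: sumr_ge0 => ? _.
  by rewrite -expr2 sqr_ge0.
rewrite (bigD1 (Ordinal kN))//= (bigD1 c)//= -expr2 -addrA lerDl.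
apply: addr_ge0; apply: sumr_ge0 => ? _; rewrite -?expr2 ?sqr_ge0//.
by apply: sumr_ge0 => ? _; rewrite -expr2 sqr_ge0.
Qed.

End Gram.
End Metric.

(** * Curves, velocities and lower bounds on length *)

Section C1Curves.
Variables (R : realType) (W : normedModType R).
Implicit Types (s r : R).

Lemma cvg_sum_seq (T I : Type) (G : set_system T) (FG : Filter G) (q : seq I)
    (f : I -> T -> W) (a : I -> W) :
  (forall i, f i x @[x --> G] --> a i) ->
  \sum_(i <- q) f i x @[x --> G] --> \sum_(i <- q) a i.
Proof.
move=> h; elim: q => [|i q IH].
  by rewrite big_nil; under eq_fun do rewrite big_nil; exact: cvg_cst.
rewrite big_cons; under eq_fun do rewrite big_cons.
by apply: cvgD.
Qed.

Lemma C1_at_near (f : R -> W) s : C1_at f s -> \near s, C1_at f s.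
Proof. exact: near_join. Qed.

Lemma C1_at_derivable (f : R -> W) s : C1_at f s -> derivable f s 1.
Proof. by move=> /nbhs_singleton[]. Qed.

Lemma C1_at_derive_continuous (f : R -> W) s :
  C1_at f s -> {for s, continuous (derive1 f)}.
Proof. by move=> /nbhs_singleton[]. Qed.

Lemma derivable_continuous (f : R -> W) s : derivable f s 1 -> {for s, continuous f}.
Proof. by move=> /derivable1_diffP; exact: differentiable_continuous. Qed.

Lemma C1_at_continuous (f : R -> W) s : C1_at f s -> {for s, continuous f}.
Proof. by move/C1_at_derivable; exact: derivable_continuous. Qed.

End C1Curves.

Section C1Compose.
Variables (R : realType) (n : nat) (W : normedModType R).
Implicit Types (s r : R).

Lemma deriveE_basis (f : 'rV[R]_n -> W) x u : differentiable f x ->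
  'D_u f x = \sum_a u 0 a *: 'D_(delta_mx 0 a) f x.
Proof.
move=> df; rewrite {1}(row_sum_delta u) derive_sum_dir//.
by apply: eq_bigr => a _; rewrite derive_scale.
Qed.

Lemma derive1_comp_rV (f : 'rV[R]_n -> W) (w : R -> 'rV[R]_n) s :
  derivable w s 1 -> differentiable f (w s) ->
  derivable (f \o w) s 1 /\ derive1 (f \o w) s = 'D_(derive1 w s) f (w s).
Proof.
move=> /derivable1_diffP dw df; split.
  by apply/derivable1_diffP; exact: differentiable_comp.
by rewrite !derive1E; exact: derive_comp.
Qed.

(** Near [s] the velocity of the image curve is a finite sum of products of
    coordinates of the velocity with partial derivatives, hence continuous. *)
Lemma C1_at_compose (U : set 'rV[R]_n) (f : 'rV[R]_n -> W) (w : R -> 'rV[R]_n) s :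
  open U -> Ck_on 1 U f -> U (w s) -> C1_at w s -> C1_at (f \o w) s.
Proof.
move=> oU [df cf] Uw /[dup] Cw hw.
have Uwr : \near s, U (w s).
  by apply: (C1_at_continuous Cw); exact: (open_nbhs_nbhs (conj oU Uw)).
move/near_join: (Uwr) => Uwr2; move/C1_at_near: Cw => Cw2.
near=> r.
have Ur : U (w r) by near: r.
have Ur2 : \near r, U (w r) by near: r.
have Cr : C1_at w r by near: r.
have dr := C1_at_derivable Cr.
split; first by have [] := derive1_comp_rV dr (df _ Ur).
pose G t := \sum_a derive1 w t 0 a *: 'D_(delta_mx 0 a) f (w t).
have E : \near r, G r = derive1 (f \o w) r.
  near=> t; have Ut : U (w t) by near: t.
  have dt : derivable w t 1.
    by near: t; apply: filterS Cr => t' [].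
  have [_ ->] := derive1_comp_rV dt (df _ Ut).
  by rewrite /G deriveE_basis//; exact: df.
rewrite /prop_for /continuous_at -(nbhs_singleton E).
apply: cvg_trans (near_eq_cvg E) _; rewrite /G; apply: cvg_sum_seq => a.
apply: cvgZ.
  apply: (@continuous_comp _ _ _ (derive1 w) (fun u : 'rV[R]_n => u 0 a : R)).
    exact: C1_at_derive_continuous.
  exact: coord_continuous.
apply: (@continuous_comp _ _ _ w (fun u => 'D_(delta_mx 0 a) f u)); first exact: C1_at_continuous.
exact: cf.
Unshelve. all: by end_near. Qed.

End C1Compose.

Section CurvesInM.
Variables (R : realType) (n : nat) (M : smooth_manifold R n).
Implicit Types (x y : M) (s r : R) (c : R -> M).

Lemma curve_near_dom c i s : {for s, continuous c} -> dom i (c s) -> \near s, dom i (c s).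
Proof. by move=> cc ic; apply: cc; exact: dom_nbhs. Qed.

Lemma curve_is_derive (F : M -> R) c i s : msmooth F -> {for s, continuous c} ->
  dom i (c s) -> derivable (phi i \o c) s 1 ->
  derivable (F \o c) s 1 /\
  derive1 (F \o c) s = mderiv F i (c s) (derive1 (phi i \o c) s).
Proof.
move=> hF cc ic dc.
have [D1 D2] := derive1_comp_rV dc (msmooth_diff hF ic).
have E : \near s, ((F \o psi i) \o (phi i \o c)) s = (F \o c) s.
  by apply: filterS (curve_near_dom cc ic) => r ir /=; rewrite psi_phi.
split; first exact: near_eq_derivable E D1.
by rewrite derive1E -(near_eq_derive _ E) -derive1E D2.
Qed.

Lemma curve_change_chart c i j s : {for s, continuous c} ->
  dom i (c s) -> dom j (c s) -> derivable (phi i \o c) s 1 ->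
  derive1 (phi j \o c) s = change_chart i j (c s) (derive1 (phi i \o c) s).
Proof.
move=> cc ic jc dc.
have [D1 D2] := derive1_comp_rV dc (transition_diff ic jc).
have E : \near s, ((phi j \o psi i) \o (phi i \o c)) s = (phi j \o c) s.
  by apply: filterS (curve_near_dom cc ic) => r ir /=; rewrite psi_phi.
rewrite derive1E -(near_eq_derive _ E) -derive1E D2 /change_chart.
by [].
Qed.

Lemma mderiv_continuous (F : M -> R) i x u : msmooth F -> dom i x ->
  {for x, continuous (fun y => mderiv F i y u)}.
Proof.
move=> hF ix; have /(_ 0%N) /= h := smooth_on_derive u (hF i).
exact: continuous_comp (phi_continuous ix) (h _ (img_phi ix)).
Qed.

Lemma chart_curve_C1 (i : atlas M) (w : R -> 'rV[R]_n) s : C1_at w s -> img i (w s) ->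
  C1_curve_at (psi i \o w) s.
Proof.
move=> Cw iw; split.
  exact: continuous_comp (C1_at_continuous Cw) (psi_continuous iw).
move=> j jw; rewrite compA.
apply: (C1_at_compose (@overlap_open _ _ _ i j)) => //.
  exact: (@transition_smooth _ _ M i j 1).
by rewrite overlapE.
Qed.

Lemma chart_curve_derive (i j : atlas M) (w : R -> 'rV[R]_n) s : derivable w s 1 -> img i (w s) ->
  dom j (psi i (w s)) ->
  derive1 (phi j \o (psi i \o w)) s = change_chart i j (psi i (w s)) (derive1 w s).
Proof.
move=> dw iw jw; have iw' := dom_psi iw.
have E : \near s, w s = (phi i \o (psi i \o w)) s.
  have : \near s, img i (w s).
    by apply: (derivable_continuous dw); exact: img_nbhs.
  by apply: filterS => r ir /=; rewrite phi_psi.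
have cc : {for s, continuous (psi i \o w)}.
  exact: continuous_comp (derivable_continuous dw) (psi_continuous iw).
have H := curve_change_chart cc iw' jw (near_eq_derivable E dw).
have E' : derive1 (phi i \o (psi i \o w)) s = derive1 w s.
  by rewrite !derive1E -(near_eq_derive _ E).
by rewrite -E'; exact: H.
Qed.

End CurvesInM.

Section Distance.
Variables (R : realType) (n : nat) (M : smooth_manifold R n) (h : riemannian_metric M).
Implicit Types (x y : M) (s r : R) (c : R -> M).

Lemma riem_entry_continuous i x a b : dom i x ->
  {for x, continuous (fun y => h i y a b : R)}.
Proof.
move=> ix.
have /(smooth_on_entry a b (@img_open _ _ _ i)) H := riem_smooth h i.
have H0 : {for x, continuous ((fun u => h i (psi i u) a b : R) \o phi i)}.
  apply: continuous_comp (phi_continuous ix) _.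
  exact: smooth_on_continuous H (img_phi ix).
have E : \near x, ((fun u => h i (psi i u) a b : R) \o phi i) x = h i x a b.
  by apply: filterS (dom_nbhs ix) => y iy /=; rewrite psi_phi.
rewrite /prop_for /continuous_at -(nbhs_singleton E).
exact: cvg_trans (near_eq_cvg E) H0.
Qed.

Lemma bilin_cvg (T : Type) (G : set_system T) (FG : Filter G) (A : T -> 'M[R]_n)
    (w : T -> 'rV[R]_n) (A0 : 'M[R]_n) (w0 : 'rV[R]_n) :
  (forall a b, A t a b @[t --> G] --> A0 a b) ->
  (forall a, w t 0 a @[t --> G] --> w0 0 a) ->
  bilin (A t) (w t) (w t) @[t --> G] --> bilin A0 w0 w0.
Proof.
move=> hA hw; rewrite bilinE; under eq_fun do rewrite bilinE.
apply: cvg_sum_seq => a; apply: cvg_sum_seq => b.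
by apply: cvgM; [apply: cvgM|].
Qed.

Lemma curve_velocity_entry_cvg i c s a : C1_at (phi i \o c) s ->
  derive1 (phi i \o c) r 0 a @[r --> s] --> derive1 (phi i \o c) s 0 a.
Proof.
move=> hc.
apply: (@continuous_comp _ _ _ _ (fun u : 'rV[R]_n => u 0 a : R)).
  exact: C1_at_derive_continuous.
exact: coord_continuous.
Qed.

(** The values of [v] are tied to the curve only between [a] and [b], so continuity is
    that of the restriction. *)
Lemma speed_continuous c v a b :
  (forall s, a <= s <= b -> C1_curve_at c s) ->
  (forall s, a <= s <= b -> is_speed h c s (v s)) ->
  {within `[a, b], continuous v}.
Proof.
move=> hc hv; apply/subspace_continuousP => s /=; rewrite in_itv/= => sab.
have [cs Cs] := hc s sab; have [i is_] := atlas_cover (c s).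
suff : v r @[r --> within `[a, b]%classic (nbhs s)] -->
    Num.sqrt (bilin (h i (c s)) (derive1 (phi i \o c) s) (derive1 (phi i \o c) s)).
  by have := hv s sab i is_ => /= <-.
pose V r := Num.sqrt (bilin (h i (c r)) (derive1 (phi i \o c) r) (derive1 (phi i \o c) r)).
have E : \forall r \near within `[a, b]%classic (nbhs s), V r = v r.
  rewrite near_withinE; near=> r => rab; rewrite /V.
  by rewrite -(hv r _ i)//; near: r; exact: curve_near_dom.
apply: cvg_trans (near_eq_cvg E) _; apply: cvg_within_filter.
have B : bilin (h i (c r)) (derive1 (phi i \o c) r) (derive1 (phi i \o c) r) @[r --> s]
    --> bilin (h i (c s)) (derive1 (phi i \o c) s) (derive1 (phi i \o c) s).
  apply: bilin_cvg.
    move=> a' b'; apply: (@continuous_comp _ _ _ c (fun y => h i y a' b' : R) s cs).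
    exact: riem_entry_continuous.
  by move=> a'; exact: curve_velocity_entry_cvg (Cs i is_).
exact: (continuous_cvg _ (@sqrt_continuous R _) B).
Unshelve. all: by end_near. Qed.

Lemma mderiv_curve_continuous (F : M -> R) c s : msmooth F -> C1_curve_at c s ->
  {for s, continuous (derive1 (F \o c))}.
Proof.
move=> hF [cs Cs]; have [i is_] := atlas_cover (c s).
pose V r := \sum_a derive1 (phi i \o c) r 0 a * mderiv F i (c r) (delta_mx 0 a).
have E : \near s, V s = derive1 (F \o c) s.
  have Cn := C1_at_near (Cs i is_).
  have Dn := curve_near_dom cs is_; have Dn2 := near_join Dn.
  near=> r.
  have ir : dom i (c r) by near: r.
  have ir2 : \near r, dom i (c r) by near: r.
  have Cr : C1_at (phi i \o c) r by near: r.
  have cr : {for r, continuous c}.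
    have H : {for r, continuous (psi i \o (phi i \o c))}.
      apply: continuous_comp (C1_at_continuous Cr) _.
      exact/psi_continuous/img_phi.
    have E : \near r, (psi i \o (phi i \o c)) r = c r.
      by apply: filterS ir2 => t it /=; rewrite psi_phi.
    rewrite /prop_for /continuous_at -(nbhs_singleton E).
    exact: cvg_trans (near_eq_cvg E) H.
  have [_ ->] := curve_is_derive hF cr ir (C1_at_derivable Cr).
  by rewrite mderivE.
rewrite /prop_for /continuous_at -(nbhs_singleton E).
apply: cvg_trans (near_eq_cvg E) _; rewrite /V; apply: cvg_sum_seq => a; apply: cvgM.
  exact: curve_velocity_entry_cvg (Cs i is_).
apply: (@continuous_comp _ _ _ c (fun y => mderiv F i y (delta_mx 0 a)) s cs).
exact: mderiv_continuous.
Unshelve. all: by end_near. Qed.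

(** By the fundamental theorem of calculus the increment of [F] along a segment is the
    integral of a derivative that the speed dominates. *)
Lemma dist_lower (F : M -> R) x y l : msmooth F ->
  (forall i z u, dom i z -> (mderiv F i z u) ^+ 2 <= bilin (h i z) u u) ->
  curve_length h x y l -> `|F y - F x| <= l.
Proof.
move=> hF Fh; elim=> {x y l} [c v a b ab Cc hv|x y z l l' _ IH1 _ IH2]; last first.
  rewrite -(subrKA (F y)) (le_trans (ler_normD _ _))// addrC.
  exact: lerD.
have sub s : `]a, b[%classic s -> a <= s <= b.
  by rewrite /= in_itv/= => /andP[/ltW -> /ltW ->].
pose D := derive1 (F \o c).
have cD : {within `[a, b], continuous D}.
  apply: continuous_in_subspaceT => s; rewrite inE /= in_itv/= => sab.
  exact: mderiv_curve_continuous hF (Cc s sab).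
have cv := speed_continuous Cc hv.
have iD := continuous_compact_integrable (@segment_compact _ a b) cD.
have iv := continuous_compact_integrable (@segment_compact _ a b) cv.
have dF s : a <= s <= b -> derivable (F \o c) s 1.
  move=> sab; have [cs Cs] := Cc s sab; have [i is_] := atlas_cover (c s).
  by have [] := curve_is_derive hF cs is_ (C1_at_derivable (Cs i is_)).
have := @continuous_FTC2 R D (F \o c) a b ab cD.
move=> FTC.
have -> : F (c b) - F (c a) = Rintegral lebesgue_measure `[a, b] D.
  rewrite /Rintegral FTC//; split.
  - by move=> s; rewrite in_itv/= => /andP[/ltW ? /ltW ?]; apply: dF; apply/andP.
  - apply: cvg_at_right_filter; apply: derivable_continuous; apply: dF.
    by rewrite lexx ltW.
  - apply: cvg_at_left_filter; apply: derivable_continuous; apply: dF.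
    by rewrite lexx ltW.
apply: (le_trans (le_normr_Rintegral _ iD)) => //.
apply: le_Rintegral => //.
  by have := integrable_norm iD.
move=> s; rewrite /= in_itv/= => sab.
have [cs Cs] := Cc s sab; have [i is_] := atlas_cover (c s).
rewrite (hv s sab i is_) /D.
have [_ ->] := curve_is_derive hF cs is_ (C1_at_derivable (Cs i is_)).
by rewrite -sqrtr_sqr ler_wsqrtr// Fh.
Qed.

End Distance.

(** * Short curves and the balls of the metric *)

Section Segments.
Variables (R : realType) (W : normedModType R).

Lemma line_is_derive (u d : W) (s : R) : is_derive s (1 : R) (fun r : R => u + r *: d) d.
Proof.
have H : is_derive s (1 : R) (fun r : R => r *: d) d.
  have D : differentiable (fun r : R => r *: d) s by exact: ex_diff.
  apply: DeriveDef; first exact: diff_derivable.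
  by rewrite deriveE//; case: (is_diff_scalel s d) => _ ->; rewrite scale1r.
apply: (@is_derive_eq _ _ _ _ _ _ _ _ (is_deriveD (is_derive_cst u s 1) H)).
by rewrite add0r.
Qed.

Lemma line_derive1 (u d : W) (s : R) : derive1 (fun r : R => u + r *: d) s = d.
Proof. by rewrite derive1E (@derive_val _ _ _ _ _ _ _ (line_is_derive u d s)). Qed.

Lemma line_C1 (u d : W) (s : R) : C1_at (fun r : R => u + r *: d) s.
Proof.
near=> r; split; first exact: (@ex_derive _ _ _ _ _ _ _ (line_is_derive u d r)).
rewrite (_ : derive1 _ = fun=> d); first exact: cvg_cst.
by apply/funext => t; exact: line_derive1.
Unshelve. all: by end_near. Qed.

Lemma ball_segment (v u1 u2 : W) (r s : R) : 0 <= s <= 1 ->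
  ball v r u1 -> ball v r u2 -> ball v r (u1 + s *: (u2 - u1)).
Proof.
move=> /andP[s0 s1]; rewrite -ball_normE /ball_/= => h1 h2.
have -> : v - (u1 + s *: (u2 - u1)) = (1 - s) *: (v - u1) + s *: (v - u2).
  rewrite scalerBl scale1r -addrA -scalerN -scalerDr opprD addrA; congr (_ + _).
  by rewrite -scalerN; congr (_ *: _); rewrite !opprB addrA subrK.
rewrite (le_lt_trans (ler_normD _ _))// !normrZ (ger0_norm s0) ger0_norm ?subr_ge0//.
have [->|s1'] := eqVneq s 1; first by rewrite subrr mul0r add0r mul1r.
have s1'' : 0 < 1 - s by rewrite subr_gt0 lt_neqAle s1' s1.
nra.
Qed.

End Segments.

Section ShortCurves.
Variables (R : realType) (n : nat) (M : smooth_manifold R n) (h : riemannian_metric M).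
Implicit Types (x y : M).

Lemma riem_bound i x : dom i x -> exists2 C : R, 0 < C &
  \forall y \near x, forall w, bilin (h i y) w w <= C * `|w| ^+ 2.
Proof.
move=> ix; exists (1 + \sum_a \sum_b (`|h i x a b| + 1)).
  by rewrite ltr_pwDl//; apply: sumr_ge0 => a _; apply: sumr_ge0 => b _; rewrite addr_ge0.
have H : \forall y \near x, forall a b, `|h i y a b| <= `|h i x a b| + 1.
  apply: filter_forall => a; apply: filter_forall => b.
  have /cvgrPdist_lt/(_ 1 ltr01) := @riem_entry_continuous _ _ _ h i x a b ix.
  apply: filterS => y; rewrite distrC => hy.
  rewrite -[h i y a b](subrK (h i x a b)) (le_trans (ler_normD _ _))// addrC lerD2l.
  exact: ltW.
apply: filterS H => y hy w; rewrite bilinE mulrDl mul1r ler_wpDl ?sqr_ge0//.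
rewrite mulr_suml; apply: ler_sum => a _; rewrite mulr_suml; apply: ler_sum => b _.
apply: le_trans (ler_norm _) _; rewrite !normrM.
rewrite (_ : _ * `|w| ^+ 2 = `|w| * (`|h i x a b| + 1) * `|w|); last by ring.
apply: ler_pM; [by rewrite mulr_ge0|by []| |exact: rV_entry_le].
by apply: ler_pM; rewrite ?rV_entry_le.
Qed.

(** Straight segments in a chart; near [x] the metric is bounded by a multiple of the
    coordinate norm. *)
Lemma short_curves x (e : R) : 0 < e -> exists2 U, open_nbhs x U &
  forall y1 y2, U y1 -> U y2 -> exists2 l, l < e & curve_length h y1 y2 l.
Proof.
move=> e0; have [i ix] := atlas_cover x; pose v0 := phi i x.
have iv0 : img i v0 by exact: img_phi.
have [C C0 HC] := riem_bound ix.
have : nbhs v0 (img i `&` psi i @^-1` [set y | forall w, bilin (h i y) w w <= C * `|w| ^+ 2]).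
  by apply: filterI; [exact: img_nbhs|apply: (psi_continuous iv0); rewrite psi_phi].
move=> /nbhs_ballP[r0 /= r00 Hr0].
have sC : 0 < Num.sqrt C by rewrite sqrtr_gt0.
pose r := Num.min r0 (e / (4 * Num.sqrt C)).
have r_gt0 : 0 < r by rewrite lt_min r00 divr_gt0// mulr_gt0.
have rE : r * (2 * Num.sqrt C) <= e / 2.
  rewrite -ler_pdivlMr ?mulr_gt0// (_ : e / 2 / (2 * Num.sqrt C) = e / (4 * Num.sqrt C)).
    by rewrite ge_min lexx orbT.
  by field; rewrite gt_eqF.
have Hr u : ball v0 r u -> img i u /\ forall w, bilin (h i (psi i u)) w w <= C * `|w| ^+ 2.
  by move=> hu; apply: Hr0; apply: le_ball hu; rewrite ge_min lexx.
exists (dom i `&` phi i @^-1` ball v0 r).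
  split; last by split=> //; exact: ballxx.
  rewrite openE => y [iy hy]; apply: filterI; first exact: dom_nbhs.
  apply: (phi_continuous iy); apply: open_nbhs_nbhs; split => //.
  exact: ball_open.
move=> y1 y2 [iy1 hy1] [iy2 hy2]; pose d := phi i y2 - phi i y1.
pose w (s : R) := phi i y1 + s *: d.
have w_ball s : 0 <= s <= 1 -> ball v0 r (w s) by move=> s01; exact: ball_segment.
have y1E : y1 = (psi i \o w) 0 by rewrite /= /w scale0r addr0 psi_phi.
have y2E : y2 = (psi i \o w) 1 by rewrite /= /w scale1r addrC subrK psi_phi.
pose v s := Num.sqrt (bilin (h i (psi i (w s))) d d).
have Cc s : 0 <= s <= 1 -> C1_curve_at (psi i \o w) s.
  by move=> /w_ball/Hr[iw _]; apply: chart_curve_C1 => //; exact: line_C1.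
have vs s : 0 <= s <= 1 -> is_speed h (psi i \o w) s (v s).
  move=> /w_ball/Hr[iw _] j jw /=.
  have dw : derivable w s 1 by exact: C1_at_derivable (line_C1 _ _ _).
  rewrite (chart_curve_derive dw iw jw) line_derive1 /v.
  by have [_ _ ->//] := riem_inner h; exact: dom_psi.
have d_le : `|d| <= 2 * r.
  rewrite (_ : d = (phi i y2 - v0) - (phi i y1 - v0)); last by rewrite opprB addrA subrK.
  apply: le_trans (ler_normB _ _) _.
  move: hy1 hy2; rewrite /= -!ball_normE /ball_/= => h1 h2.
  rewrite mulr_natl mulr2n lerD//; apply: ltW; by rewrite distrC.
have v_le s : 0 <= s <= 1 -> v s <= e / 2.
  move=> /w_ball/Hr[_ /(_ d) hs]; apply: le_trans rE.
  apply: (@le_trans _ _ (Num.sqrt C * `|d|)).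
    rewrite -[`|d|]ger0_norm// -sqrtr_sqr -sqrtrM; last exact: ltW.
    exact: ler_wsqrtr.
  by rewrite mulrC mulrCA mulrA ler_wpM2r// ltW.
exists (Rintegral lebesgue_measure `[0, 1] v); last first.
  by rewrite y1E y2E; exact: curve_length_segment.
apply: (@le_lt_trans _ _ (e / 2)); last by rewrite ltr_pdivrMr// ltr_pMr// ltr1n.
apply: (@le_trans _ _ (Rintegral lebesgue_measure `[0, 1] (cst (e / 2)))).
  apply: le_Rintegral => //.
  - apply: continuous_compact_integrable; first exact: segment_compact.
    exact: speed_continuous Cc vs.
  - apply: continuous_compact_integrable; first exact: segment_compact.
    by apply: continuous_subspaceT => z; exact: cvg_cst.
rewrite Rintegral_cst//= lebesgue_measure_itv/= lte_fin ltr01.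
by rewrite -EFinB subr0 mulr1.
Qed.

Lemma riem_ballP x e y : riem_ball h x e y <-> exists2 l, l < e & curve_length h x y l.
Proof.
split=> [/ereal_inf_lt[_ [l xyl <-]]|[l le xyl]].
  by rewrite lte_fin => le; exists l.
apply: (@le_lt_trans _ _ l%:E); last by rewrite lte_fin.
by apply: ereal_inf_lbound; exists l.
Qed.

Lemma riem_ball_open x e : open (riem_ball h x e).
Proof.
rewrite openE => y /riem_ballP[l le xyl].
have el : 0 < e - l by rewrite subr_gt0.
have [U [oU Uy] HU] := short_curves y el.
apply: filterS (open_nbhs_nbhs (conj oU Uy)) => z Uz.
have [l' le' yzl'] := HU y z Uy Uz.
apply/riem_ballP; exists (l + l'); first by lra.
exact: curve_length_join yzl'.
Qed.

Lemma riem_ball_center x e : 0 < e -> riem_ball h x e x.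
Proof.
move=> e0; have [U [oU Ux] HU] := short_curves x e0.
by apply/riem_ballP; exact: HU.
Qed.

Definition reachable x : set M := [set y | exists l, curve_length h x y l].

(** A point near [y] could be joined to [y] by a short curve. *)
Lemma unreachable_open x : open (~` reachable x).
Proof.
rewrite openE => y ny; have [U [oU Uy] HU] := short_curves y ltr01.
apply: filterS (open_nbhs_nbhs (conj oU Uy)) => z Uz [l xzl]; apply: ny.
have [l' _ zyl'] := HU z y Uz Uy.
by exists (l + l'); exact: curve_length_join zyl'.
Qed.

(** The increasing balls about [x] and the unreachable set form an open cover of [K]. *)
Lemma reachable_in_ball x (K D : set M) : compact K -> D `<=` K -> D `<=` reachable x ->
  exists2 e, 0 < e & D `<=` riem_ball h x e.
Proof.
move=> cK DK Dx.
have : \forall e \near (+oo : set_system R), K `<=` (riem_ball h x e `|` ~` reachable x).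
  have /compact_near_coveringP := cK; apply => y _.
  have [[l xyl]|ny] := pselect (reachable x y).
    exists (riem_ball h x (l + 1), [set e | l + 1 < e]).
      split; last by exists (l + 1); split=> //; exact: num_real.
      apply: open_nbhs_nbhs; split; first exact: riem_ball_open.
      by apply/riem_ballP; exists l => //; rewrite ltrDl.
    move=> [z e] [/riem_ballP[l' l'l xz] /= le]; left.
    by apply/riem_ballP; exists l' => //; exact: lt_trans le.
  exists (~` reachable x, setT).
    split; last exact: filterT.
    by apply: open_nbhs_nbhs; split=> //; exact: unreachable_open.
  by move=> [z e] [/= nz _]; right.
move=> H; have [e [e0 He]] : exists e : R, 0 < e /\ K `<=` (riem_ball h x e `|` ~` reachable x).
  by apply: (@filter_ex _ (+oo : set_system R)); apply: filterI H; apply: nbhs_pinfty_gt; exact: num_real.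
by exists e => // y Dy; case: (He y (DK y Dy)) => // /(_ (Dx y Dy)).
Qed.

End ShortCurves.

Section GoodMetric.
Variables (R : realType) (n : nat) (M : smooth_manifold R n).

(** The balls of the metric are controlled by the values of the family alone: the
    members that separate [x] make small balls small, the proper member makes every
    ball relatively compact. *)
Theorem proper_metric_exists : exists h : riemannian_metric M, appropriate h /\
  forall x e, exists2 K, compact K & riem_ball h x e `<=` K.
Proof.
have [F gF] := @good_family_exists _ _ M.
have [h Fh] := metric_of_family gF.
have low x y l k o : curve_length h x y l -> `|F k o y - F k o x| <= l.
  by apply: dist_lower (gf_smooth gF k o) _ => i z u; exact: Fh.
exists h; split; last first.
  move=> x e; have [K cK HK] := gf_proper gF (F 0%N None x + e).
  exists K => // y /riem_ballP[l le xyl]; apply: HK.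
  have := low x y l 0%N None xyl; have := ler_norm (F 0%N None y - F 0%N None x); lra.
split=> [_ [x [e [e0 ->]]]|x U xU]; first exact: riem_ball_open.
have [k [e e0 He]] := gf_separates gF xU.
exists (riem_ball h x e); first by split; [exists x, e|exact: riem_ball_center].
by move=> y /riem_ballP[l le xyl]; apply: He => o; exact: le_lt_trans (low _ _ _ _ _ xyl) le.
Qed.

End GoodMetric.

(** * Timelike curves *)

Section PairDerivatives.
Variables (R : realType) (V W : normedModType R).
Implicit Types (w : R -> V * W).

Lemma derive1_fst w s : derivable w s 1 ->
  derivable (fst \o w) s 1 /\ derive1 (fst \o w) s = (derive1 w s).1.
Proof.
move=> dw; pose q h := h^-1 *: ((w \o shift s) (h *: (1 : R)) - w s).
have H : (fun h => h^-1 *: (((fst \o w) \o shift s) (h *: (1 : R)) - (fst \o w) s)) @ 0^'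
    --> (derive1 w s).1.
  rewrite derive1E.
  have : q @ 0^' --> 'D_1 w s by exact: dw.
  by move=> H; apply: (cvg_comp q fst H); exact: cvg_fst.
by split; [apply/cvg_ex; exists (derive1 w s).1|rewrite derive1E; exact/cvg_lim].
Qed.

Lemma derive1_snd w s : derivable w s 1 ->
  derivable (snd \o w) s 1 /\ derive1 (snd \o w) s = (derive1 w s).2.
Proof.
move=> dw; pose q h := h^-1 *: ((w \o shift s) (h *: (1 : R)) - w s).
have H : (fun h => h^-1 *: (((snd \o w) \o shift s) (h *: (1 : R)) - (snd \o w) s)) @ 0^'
    --> (derive1 w s).2.
  rewrite derive1E.
  have : q @ 0^' --> 'D_1 w s by exact: dw.
  by move=> H; apply: (cvg_comp q snd H); exact: cvg_snd.
by split; [apply/cvg_ex; exists (derive1 w s).2|rewrite derive1E; exact/cvg_lim].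
Qed.

Lemma derive1_pair (f : R -> V) (k : R -> W) s : derivable f s 1 -> derivable k s 1 ->
  derivable (fun r => (f r, k r)) s 1 /\
  derive1 (fun r => (f r, k r)) s = (derive1 f s, derive1 k s).
Proof.
move=> df dk.
have H : (fun h => h^-1 *: (((fun r => (f r, k r)) \o shift s) (h *: (1 : R)) - (f s, k s))) @ 0^'
    --> (derive1 f s, derive1 k s).
  rewrite !derive1E.
  exact: (cvg_pair (df : _ --> 'D_1 f s) (dk : _ --> 'D_1 k s)).
by split; [apply/cvg_ex; exists (derive1 f s, derive1 k s)|rewrite derive1E; exact/cvg_lim].
Qed.

Lemma C1_at_fst w s : C1_at w s -> C1_at (fst \o w) s.
Proof.
move=> hw; have hw2 := C1_at_near hw; near=> r.
have hr : C1_at w r by near: r.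
split; first by have [] := derive1_fst (C1_at_derivable hr).
have E : \near r, (derive1 w r).1 = derive1 (fst \o w) r.
  by apply: filterS hr => t [dt _]; have [_ ->] := derive1_fst dt.
rewrite /prop_for /continuous_at -(nbhs_singleton E).
apply: cvg_trans (near_eq_cvg E) _.
by apply: (cvg_comp _ _ (C1_at_derive_continuous hr)); exact: cvg_fst.
Unshelve. all: by end_near. Qed.

Lemma C1_at_snd w s : C1_at w s -> C1_at (snd \o w) s.
Proof.
move=> hw; have hw2 := C1_at_near hw; near=> r.
have hr : C1_at w r by near: r.
split; first by have [] := derive1_snd (C1_at_derivable hr).
have E : \near r, (derive1 w r).2 = derive1 (snd \o w) r.
  by apply: filterS hr => t [dt _]; have [_ ->] := derive1_snd dt.
rewrite /prop_for /continuous_at -(nbhs_singleton E).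
apply: cvg_trans (near_eq_cvg E) _.
by apply: (cvg_comp _ _ (C1_at_derive_continuous hr)); exact: cvg_snd.
Unshelve. all: by end_near. Qed.

Lemma C1_at_pair (f : R -> V) (k : R -> W) s : C1_at f s -> C1_at k s ->
  C1_at (fun r => (f r, k r)) s.
Proof.
move=> hf hk; have hf2 := C1_at_near hf; have hk2 := C1_at_near hk; near=> r.
have fr : C1_at f r by near: r.
have kr : C1_at k r by near: r.
split; first by have [] := derive1_pair (C1_at_derivable fr) (C1_at_derivable kr).
have E : \near r, (derive1 f r, derive1 k r) = derive1 (fun r => (f r, k r)) r.
  near=> t.
  have [dt _] : derivable f t 1 /\ {for t, continuous (derive1 f)} by near: t.
  have [kt _] : derivable k t 1 /\ {for t, continuous (derive1 k)} by near: t.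
  by have [_ ->] := derive1_pair dt kt.
rewrite /prop_for /continuous_at -(nbhs_singleton E).
apply: cvg_trans (near_eq_cvg E) _.
exact: cvg_pair (C1_at_derive_continuous fr) (C1_at_derive_continuous kr).
Unshelve. all: by end_near. Qed.

End PairDerivatives.

Section Spacetime.
Variables (R : realType) (n : nat) (M : smooth_manifold R n) (g : sliced_metric M).
Implicit Types (p q x y z : spacetime M) (c : R -> spacetime M) (X Y : 'rV[R]_n * R).

Lemma change_chartD i j (x : M) u v : dom i x -> dom j x ->
  change_chart i j x (u + v) = change_chart i j x u + change_chart i j x v.
Proof. by move=> ix jx; apply: derive_add; exact: transition_diff. Qed.

Lemma change_chartZ i j (x : M) a u : dom i x -> dom j x ->
  change_chart i j x (a *: u) = a *: change_chart i j x u.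
Proof. by move=> ix jx; apply: derive_scale; exact: transition_diff. Qed.

Lemma lorentz_change_chart i j p X Y : dom i p.1 -> dom j p.1 ->
  lorentz g j p (change_chart i j p.1 X.1, X.2) (change_chart i j p.1 Y.1, Y.2) =
  lorentz g i p X Y.
Proof.
move=> ip jp; rewrite /lorentz /= (shift_compat g ip jp).
rewrite -!change_chartZ// -!change_chartD//.
by have [_ _ ->] := spatial_inner g p.2.
Qed.

Lemma lorentzZ i p a X : lorentz g i p (a *: X) (a *: X) = a ^+ 2 * lorentz g i p X X.
Proof.
rewrite /lorentz /= !bilinE !mulrDr; congr (_ + _).
  by rewrite /GRing.scale/=; ring.
rewrite mulr_sumr; apply: eq_bigr => a' _; rewrite mulr_sumr; apply: eq_bigr => b' _.
by rewrite !mxE /GRing.scale/=; ring.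
Qed.

(** Inverse of [st_coord i]. *)
Definition unst (i : atlas M) (q : 'rV[R]_n * R) : spacetime M := (psi i q.1, q.2).

Lemma st_coordK i p : dom i p.1 -> unst i (st_coord i p) = p.
Proof. by case: p => x t /= ix; rewrite /unst /st_coord /= psi_phi. Qed.

Lemma unst_continuous (i : atlas M) (q : 'rV[R]_n * R) : img i q.1 -> {for q, continuous (unst i)}.
Proof.
move=> iq.
have H : {for q, continuous (psi i \o fst)}.
  by apply: continuous_comp; [exact: cvg_fst|exact: psi_continuous].
exact: (cvg_pair H cvg_snd).
Qed.

Lemma st_coord_continuous i p : dom i p.1 -> {for p, continuous (st_coord i)}.
Proof.
move=> ip.
have H : {for p, continuous (phi i \o fst)}.
  by apply: continuous_comp; [exact: cvg_fst|exact: phi_continuous].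
exact: (cvg_pair H cvg_snd).
Qed.

Lemma st_dom_nbhs i p : dom i p.1 -> \forall q \near p, dom i q.1.
Proof. by move=> /dom_nbhs; exact: cvg_fst. Qed.

Lemma st_img_nbhs (i : atlas M) (q : 'rV[R]_n * R) : img i q.1 -> \forall q' \near q, img i q'.1.
Proof. by move=> /img_nbhs; exact: cvg_fst. Qed.

(** Velocities change by the differential of the transition map, under which
    [lorentz] is invariant, so that one chart decides for all. *)
Lemma chart_curve_timelike i (w : R -> 'rV[R]_n * R) s : C1_at w s -> img i (w s).1 ->
  lorentz g i (unst i (w s)) (derive1 w s) (derive1 w s) < 0 -> 0 < (derive1 w s).2 ->
  future_timelike_at g (unst i \o w) s.
Proof.
move=> Cw iw L0 T0; split.
  exact: continuous_comp (C1_at_continuous Cw) (unst_continuous iw).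
move=> j jw X.
have dw := C1_at_derivable Cw.
have [d1 E1] := derive1_fst dw; have [d2 E2] := derive1_snd dw.
have Cj : C1_at ((phi j \o psi i) \o (fst \o w)) s.
  apply: (C1_at_compose (@overlap_open _ _ _ i j)) => //.
  - exact: (@transition_smooth _ _ M i j 1).
  - by rewrite overlapE.
  - exact: C1_at_fst.
have C2 := C1_at_snd Cw.
have [_ EX] := derive1_pair (C1_at_derivable Cj) (C1_at_derivable C2).
have Ej := chart_curve_derive d1 iw jw.
have Ej' : derive1 ((phi j \o psi i) \o (fst \o w)) s =
   change_chart i j (unst i (w s)).1 (derive1 w s).1 by rewrite -E1; exact: Ej.
have EX' : derive1 (st_coord j \o (unst i \o w)) s =
    (change_chart i j (unst i (w s)).1 (derive1 w s).1, (derive1 w s).2).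
  exact: etrans EX (congr2 pair Ej' E2).
have L := @lorentz_change_chart i j (unst i (w s)) (derive1 w s) (derive1 w s) (dom_psi iw) jw.
have CC : C1_at (st_coord j \o (unst i \o w)) s := C1_at_pair Cj C2.
have XE : X = (change_chart i j (unst i (w s)).1 (derive1 w s).1, (derive1 w s).2) := EX'.
clearbody X.
split; [exact: CC| |by rewrite XE].
by rewrite XE; move: L0; rewrite -L.
Qed.

Lemma timelike_fst_continuous c s : future_timelike_at g c s -> {for s, continuous (fst \o c)}.
Proof. by move=> [cc _]; apply: (cvg_comp _ _ cc); exact: cvg_fst. Qed.

Lemma timelike_coord c s i : future_timelike_at g c s -> dom i (c s).1 ->
  derivable (phi i \o (fst \o c)) s 1 /\
  derive1 (phi i \o (fst \o c)) s = (derive1 (st_coord i \o c) s).1.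
Proof.
move=> [cc /(_ i)] H ic; have [C1 _ _] := H ic.
exact: (derive1_fst (C1_at_derivable C1)).
Qed.

Lemma timelike_time c s : future_timelike_at g c s ->
  derivable (snd \o c) s 1 /\ 0 < derive1 (snd \o c) s.
Proof.
move=> [cc H]; have [i ic] := atlas_cover (c s).1; have [C1 _ T0] := H i ic.
by have [D E] := derive1_snd (C1_at_derivable C1); split=> //; rewrite [derive1 _ _]E.
Qed.

Lemma timelike_time_chart c s i : future_timelike_at g c s -> dom i (c s).1 ->
  derive1 (snd \o c) s = (derive1 (st_coord i \o c) s).2.
Proof.
move=> [cc H] ic; have [C1 _ T0] := H i ic.
by have [D E] := derive1_snd (C1_at_derivable C1).
Qed.

Lemma timelike_segment_time c a b : a < b ->
  (forall s, a <= s <= b -> future_timelike_at g c s) -> (c a).2 < (c b).2.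
Proof.
move=> ab h.
have hab s : s \in `]a, b[%R -> a <= s <= b.
  by rewrite in_itv/= => /andP[/ltW -> /ltW ->].
apply: (@gtr0_derive1_lt_cc R (snd \o c) a b) => //.
- by move=> s /hab/h/timelike_time[].
- by move=> s /hab/h/timelike_time[].
- apply: continuous_in_subspaceT => s; rewrite inE /= in_itv/= => sab.
  by apply: derivable_continuous; have [] := timelike_time (h s sab).
- by rewrite in_itv/= lexx ltW.
- by rewrite in_itv/= lexx ltW.
Qed.

Lemma timelike_time_lt x y C : timelike_curve g x y C -> x.2 < y.2.
Proof.
elim=> {x y C} [c a b ab h|x y z C C' _ xy _ yz]; last exact: lt_trans xy yz.
exact: timelike_segment_time.
Qed.

Lemma timelike_ends x y C : timelike_curve g x y C -> C x /\ C y.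
Proof.
elim=> {x y C} [c a b ab h|x y z C C' _ [Cx _] _ [_ Cz]]; last by split; [left|right].
by split; [exists a|exists b] => //; rewrite /= in_itv/= lexx ltW.
Qed.

Lemma timelike_subsegment c a b s1 s2 : (forall s, a <= s <= b -> future_timelike_at g c s) ->
  a <= s1 -> s1 < s2 -> s2 <= b ->
  timelike_curve g (c s1) (c s2) (c @` `[s1, s2]) /\ c @` `[s1, s2] `<=` c @` `[a, b].
Proof.
move=> h as1 s12 s2b; split.
  apply: timelike_segment => // s /andP[s1s ss2]; apply: h.
  by rewrite (le_trans as1 s1s) (le_trans ss2 s2b).
move=> _ [s /= /[!in_itv]/= /andP[s1s ss2] <-]; exists s => //=.
by rewrite in_itv/= (le_trans as1 s1s) (le_trans ss2 s2b).
Qed.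

Lemma timelike_mem_time x y C z : timelike_curve g x y C -> C z -> x.2 <= z.2 <= y.2.
Proof.
move=> H; elim: H z => {x y C} [c a b ab h|x y z C C' xy IH1 yz IH2] p.
  move=> [s /= /[!in_itv]/= /andP[as_ sb] <-]; apply/andP; split.
    move: as_; rewrite le_eqVlt => /predU1P[<-//|as_].
    by have [H _] := timelike_subsegment h (lexx a) as_ sb; exact/ltW/(timelike_time_lt H).
  move: sb; rewrite le_eqVlt => /predU1P[->//|sb].
  by have [H _] := timelike_subsegment h as_ sb (lexx b); exact/ltW/(timelike_time_lt H).
have := ltW (timelike_time_lt xy); have := ltW (timelike_time_lt yz) => h1 h2.
case=> [/IH1|/IH2] /andP[h3 h4]; apply/andP; split=> //.
  exact: le_trans h4 h1.
exact: le_trans h2 h3.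
Qed.

(** This is what allows cutting piecewise curves without reparametrising them. *)
Lemma timelike_between x y C z1 z2 : timelike_curve g x y C -> C z1 -> C z2 ->
  [\/ z1 = z2, exists2 C', C' `<=` C & timelike_curve g z1 z2 C' |
      exists2 C', C' `<=` C & timelike_curve g z2 z1 C'].
Proof.
move=> H; elim: H z1 z2 => {x y C} [c a b ab h|x y z C C' xy IH1 yz IH2] z1 z2.
  move=> [s1 /= /[!in_itv]/= /andP[as1 s1b] <-] [s2 /= /[!in_itv]/= /andP[as2 s2b] <-].
  have [s12|s21|->] := ltgtP s1 s2; last by constructor 1.
    have [? ?] := timelike_subsegment h as1 s12 s2b.
    by constructor 2; exists (c @` `[s1, s2]).
  have [? ?] := timelike_subsegment h as2 s21 s1b.
  by constructor 3; exists (c @` `[s2, s1]).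
have mixed u v : C u -> C' v -> u = v \/ exists2 D, D `<=` C `|` C' & timelike_curve g u v D.
  move=> Cu Cv; have [_ Cy] := timelike_ends xy; have [C'y _] := timelike_ends yz.
  have Hu : u = y \/ exists2 D, D `<=` C & timelike_curve g u y D.
    case: (IH1 _ _ Cu Cy) => [->|//|[D DC yu]]; [by left|by right|].
    have := timelike_time_lt yu; have /andP[_] := timelike_mem_time xy Cu.
    by move=> /le_lt_trans h /h; rewrite ltxx.
  have Hv : y = v \/ exists2 D, D `<=` C' & timelike_curve g y v D.
    case: (IH2 _ _ C'y Cv) => [->|//|[D DC vy]]; [by left|by right|].
    have := timelike_time_lt vy; have /andP[] := timelike_mem_time yz Cv.
    by move=> /le_lt_trans h _ /h; rewrite ltxx.
  case: Hu Hv => [->|[D DC uy]] [<-|[D' DC' yv]].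
  - by left.
  - by right; exists D' => // t /DC'; right.
  - by right; exists D => // t /DC; left.
  right; exists (D `|` D'); last exact: timelike_join uy yv.
  by move=> t [/DC|/DC']; [left|right].
case=> [Cz1|C'z1] [Cz2|C'z2].
- case: (IH1 _ _ Cz1 Cz2) => [->|[D DC h]|[D DC h]]; first by constructor 1.
    by constructor 2; exists D => // t /DC; left.
  by constructor 3; exists D => // t /DC; left.
- by case: (mixed _ _ Cz1 C'z2) => [->|h]; [constructor 1|constructor 2].
- by case: (mixed _ _ Cz2 C'z1) => [->|h]; [constructor 1|constructor 3].
- case: (IH2 _ _ C'z1 C'z2) => [->|[D DC h]|[D DC h]]; first by constructor 1.
    by constructor 2; exists D => // t /DC; right.
  by constructor 3; exists D => // t /DC; right.
Qed.

Lemma timelike_connected x y C : timelike_curve g x y C -> connected C.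
Proof.
elim=> {x y C} [c a b ab h|x y z C C' xy IH1 yz IH2].
  apply: connected_continuous_connected; first exact: segment_connected.
  apply: continuous_in_subspaceT => s; rewrite inE /= in_itv/= => sab.
  by case: (h s sab).
apply: connectedU => //; exists y.
by split; [have [] := timelike_ends xy|have [] := timelike_ends yz].
Qed.

Lemma timelike_at_time x y C t : timelike_curve g x y C -> x.2 <= t <= y.2 ->
  exists2 z, C z & z.2 = t.
Proof.
elim=> {x y C} [c a b ab h|x y z C C' xy IH1 yz IH2] /andP[h1 h2].
  have [| |s sab st] := @IVT R (snd \o c) a b t (ltW ab).
  - apply: continuous_in_subspaceT => s; rewrite inE /= in_itv/= => sab.
    by apply: derivable_continuous; have [] := timelike_time (h s sab).
  - by rewrite ge_min /= h1 le_max /= h2 orbT.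
  - by exists (c s) => //; exists s.
have [ty|yt] := leP t y.2.
  by have [|w Cw wt] := IH1; [rewrite h1|exists w => //; left].
by have [|w Cw wt] := IH2; [rewrite (ltW yt)|exists w => //; right].
Qed.

End Spacetime.

(** * Uniformly Lipschitz families *)

Section LocallyLipschitz.
Variables (R : realType) (V : normedModType R).
Implicit Types (p q : V).

(** Uniformity over [Xi] allows treating [lorentz] as a function of the event alone
    while the tangent vectors range over a bounded set. *)
Definition unif_lipschitz (T : Type) (Xi : set T) p (f : T -> V -> R) : Prop :=
  exists L r, [/\ 0 <= L, 0 < r & forall xi q q', Xi xi -> ball p r q -> ball p r q' ->
    `|f xi q| <= L /\ `|f xi q - f xi q'| <= L * `|q - q'|].

Lemma ball_minl p r r' q : ball p (Num.min r r') q -> ball p r q.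
Proof. by apply: le_ball; rewrite ge_min lexx. Qed.

Lemma ball_minr p r r' q : ball p (Num.min r r') q -> ball p r' q.
Proof. by apply: le_ball; rewrite ge_min lexx orbT. Qed.

Variables (T : Type) (Xi : set T) (p : V).
Implicit Types (f k : T -> V -> R).

Lemma unif_lipschitz_cst (c : T -> R) L : (forall xi, Xi xi -> `|c xi| <= L) ->
  unif_lipschitz Xi p (fun xi _ => c xi).
Proof.
move=> h; exists `|L|, 1; split=> // xi q q' hxi _ _.
rewrite subrr normr0 mulr_ge0//; split=> //.
by rewrite (le_trans (h _ hxi))// ler_norm.
Qed.

Lemma unif_lipschitz_add f k : unif_lipschitz Xi p f -> unif_lipschitz Xi p k ->
  unif_lipschitz Xi p (fun xi q => f xi q + k xi q).
Proof.
move=> [L [r [L0 r0 hf]]] [L' [r' [L'0 r'0 hk]]].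
exists (L + L'), (Num.min r r'); split; [exact: addr_ge0|by rewrite lt_min r0|].
move=> xi q q' hxi hq hq'.
have [f1 f2] := hf xi q q' hxi (ball_minl hq) (ball_minl hq').
have [k1 k2] := hk xi q q' hxi (ball_minr hq) (ball_minr hq').
split; first by rewrite (le_trans (ler_normD _ _))// lerD.
by rewrite opprD addrACA mulrDl (le_trans (ler_normD _ _))// lerD.
Qed.

Lemma unif_lipschitz_mul f k : unif_lipschitz Xi p f -> unif_lipschitz Xi p k ->
  unif_lipschitz Xi p (fun xi q => f xi q * k xi q).
Proof.
move=> [L [r [L0 r0 hf]]] [L' [r' [L'0 r'0 hk]]].
exists (2 * (L * L')), (Num.min r r'); split; [by rewrite !mulr_ge0|by rewrite lt_min r0|].
move=> xi q q' hxi hq hq'.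
have [f1 f2] := hf xi q q' hxi (ball_minl hq) (ball_minl hq').
have [k1 k2] := hk xi q q' hxi (ball_minr hq) (ball_minr hq').
have [k1' _] := hk xi q' q hxi (ball_minr hq') (ball_minr hq).
split.
  rewrite normrM (le_trans (ler_pM _ _ f1 k1))// mulr_natl mulr2n lerDl.
  by rewrite mulr_ge0.
have -> : f xi q * k xi q - f xi q' * k xi q' =
    f xi q * (k xi q - k xi q') + (f xi q - f xi q') * k xi q' by ring.
rewrite (le_trans (ler_normD _ _))// !normrM.
have -> : 2 * (L * L') * `|q - q'| = L * (L' * `|q - q'|) + (L * `|q - q'|) * L' by ring.
by rewrite lerD// ler_pM.
Qed.

Lemma unif_lipschitz_sum (I : Type) (s : seq I) (f : I -> T -> V -> R) :
  (forall i, unif_lipschitz Xi p (f i)) ->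
  unif_lipschitz Xi p (fun xi q => \sum_(i <- s) f i xi q).
Proof.
move=> h; elim: s => [|i s IH].
  rewrite (_ : (fun _ _ => _) = (fun _ _ => 0)); last first.
    by apply/funext => xi; apply/funext => q; rewrite big_nil.
  by apply: (@unif_lipschitz_cst (fun=> 0) 0) => xi _; rewrite normr0.
rewrite (_ : (fun _ _ => _) = (fun xi q => f i xi q + \sum_(j <- s) f j xi q)); last first.
  by apply/funext => xi; apply/funext => q; rewrite big_cons.
exact: unif_lipschitz_add.
Qed.

(** The mean value theorem along the segment from [q] to [q']. *)
Lemma mean_value_bound (U : set V) (F : V -> R) q q' (L : R) :
  (forall s : R, 0 <= s <= 1 -> U (q + s *: (q' - q))) ->
  (forall z, U z -> differentiable F z) ->
  (forall z, U z -> `|'D_(q' - q) F z| <= L) ->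
  `|F q' - F q| <= L.
Proof.
move=> hU dF hL; pose w (s : R) := q + s *: (q' - q).
have D (s : R) : 0 <= s <= 1 -> is_derive s (1 : R) (F \o w) ('D_(q' - q) F (w s)).
  move=> s01; have dw : differentiable w s.
    by apply/derivable1_diffP; exact: (@ex_derive _ _ _ _ _ _ _ (line_is_derive _ _ _)).
  have dFw := dF _ (hU s s01).
  apply: DeriveDef.
    by apply/derivable1_diffP; exact: differentiable_comp.
  rewrite derive_comp//; congr ('D_ _ _ _).
  exact: (@derive_val _ _ _ _ _ _ _ (line_is_derive q (q' - q) s)).
have [c c01 E] : exists2 c, c \in `]0, 1[%R &
    (F \o w) 1 - (F \o w) 0 = 'D_(q' - q) F (w c) * (1 - 0).
  apply: (@MVT R (F \o w) (fun s => 'D_(q' - q) F (w s))) => //.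
    by move=> s; rewrite in_itv/= => /andP[/ltW ? /ltW ?]; apply: D; apply/andP.
  apply: continuous_in_subspaceT => s; rewrite inE /= in_itv/= => s01.
  apply: differentiable_continuous; apply/derivable1_diffP.
  exact: (@ex_derive _ _ _ _ _ _ _ (D s s01)).
have w0 : w 0 = q by rewrite /w scale0r addr0.
have w1 : w 1 = q' by rewrite /w scale1r addrC subrK.
move: E; rewrite /= w0 w1 subr0 mulr1 => ->.
apply: hL; apply: hU; move: c01; rewrite in_itv/= => /andP[/ltW -> /ltW ->] //.
Qed.

End LocallyLipschitz.

Section ChartLipschitz.
Variables (R : realType) (n : nat).
Local Notation E := ('rV[R]_n * R)%type.
Implicit Types (p q X Y : E).

Lemma pair_norm_le (W1 W2 : normedModType R) (x : W1 * W2) (r : R) :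
  `|x.1| <= r -> `|x.2| <= r -> `|x| <= r.
Proof. by move=> h1 h2; rewrite /Num.norm/= ge_max h1. Qed.

Lemma pair_norm_fst (W1 W2 : normedModType R) (x : W1 * W2) : `|x.1| <= `|x|.
Proof. by rewrite [leRHS]/Num.norm/= le_max lexx. Qed.

Lemma pair_norm_snd (W1 W2 : normedModType R) (x : W1 * W2) : `|x.2| <= `|x|.
Proof. by rewrite [leRHS]/Num.norm/= le_max lexx orbT. Qed.

(** Near [p] the finitely many partial derivatives are bounded, and they bound every
    directional derivative. *)
Lemma C1_unif_lipschitz (T : Type) (Xi : set T) (U : set E) (f : E -> R) p :
  open U -> Ck_on 1 U f -> U p -> unif_lipschitz Xi p (fun _ => f).
Proof.
move=> oU [df cf] Up.
pose e a : E := (delta_mx 0 a, 0).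
pose e0 : E := (0, 1).
pose L0 := \sum_a (`|'D_(e a) f p| + 1) + (`|'D_e0 f p| + 1).
have L0_ge : 0 <= L0 by rewrite !addr_ge0// sumr_ge0// => a _; rewrite addr_ge0.
have H : \forall q \near p, [/\ U q, (forall a, `|'D_(e a) f q| <= `|'D_(e a) f p| + 1),
    `|'D_e0 f q| <= `|'D_e0 f p| + 1 & `|f q| <= `|f p| + 1].
  have H1 : \forall q \near p, U q by exact: (open_nbhs_nbhs (conj oU Up)).
  have B (k : E -> R) : {for p, continuous k} -> \forall q \near p, `|k q| <= `|k p| + 1.
    move=> /cvgrPdist_lt/(_ 1 ltr01); apply: filterS => q; rewrite distrC => hq.
    rewrite -[k q](subrK (k p)) (le_trans (ler_normD _ _))// addrC lerD2l; exact: ltW.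
  have H2 : \forall q \near p, forall a, `|'D_(e a) f q| <= `|'D_(e a) f p| + 1.
    by apply: (@filter_forall _ _ (fun a => [set q | `|'D_(e a) f q| <= `|'D_(e a) f p| + 1]) (nbhs p)) => a; exact: (B (fun q => 'D_(e a) f q) (cf (e a) p Up)).
  have H3 := B (fun q => 'D_e0 f q) (cf e0 p Up).
  have H4 := B f (differentiable_continuous (df p Up)).
  by near=> q; split; near: q.
have [r r0 Hr] := (nbhs_ballP _ _).1 H.
exists (L0 + (`|f p| + 1)), r; split=> //; first by apply: addr_ge0 => //; apply: addr_ge0.
move=> _ q q' _ hq hq'; split.
  by have [_ _ _ h] := Hr _ hq; rewrite (le_trans h)// ler_wpDl.
rewrite mulrDl ler_wpDr ?mulr_ge0 ?addr_ge0//.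
apply: (@mean_value_bound _ _ (ball p r)).
- by move=> s s01; exact: ball_segment.
- by move=> z /Hr[Uz _ _ _]; exact: df.
move=> z /Hr[Uz hz hz0 _].
have dE (d : E) : d = \sum_a d.1 0 a *: e a + d.2 *: e0.
  case: d => u t /=.
  have -> : \sum_a u 0 a *: e a = (u, 0) :> E.
    have S (s : seq 'I_n) : \sum_(a <- s) u 0 a *: e a = (\sum_(a <- s) u 0 a *: delta_mx 0 a, 0) :> E.
      elim: s => [|a s IH]; first by rewrite !big_nil.
      rewrite !big_cons IH; congr pair => /=; by rewrite scaler0 addr0.
    by rewrite S -row_sum_delta.
  congr pair => /=; first by rewrite scaler0 addr0.
  by rewrite add0r /GRing.scale/= mulr1.
have dfz := df z Uz.
rewrite {1}(dE (q - q')) derive_add// derive_scale// derive_sum_dir//.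
rewrite (le_trans (ler_normD _ _))// mulrDl lerD//; last first.
  by rewrite normrZ mulrC ler_pM// (pair_norm_snd (q - q')).
rewrite (le_trans (ler_norm_sum _ _ _))// mulr_suml; apply: ler_sum => a _.
rewrite derive_scale// normrZ mulrC ler_pM//.
exact: le_trans (rV_entry_le _ _) (pair_norm_fst (q - q')).
Unshelve. all: by end_near. Qed.

End ChartLipschitz.

(** * Light cones in a chart *)

Section LorentzEstimates.
Variables (R : realType) (n : nat) (M : smooth_manifold R n) (g : sliced_metric M).
Local Notation E := ('rV[R]_n * R)%type.
Implicit Types (p q X Y T : E).

Section Bilinear.
Variable (i : atlas M).
Implicit Types (z : spacetime M).

Lemma lorentzDl z X X' Y : lorentz g i z (X + X') Y = lorentz g i z X Y + lorentz g i z X' Y.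
Proof.
rewrite /lorentz /= !bilinE addrACA; congr (_ + _); first by ring.
rewrite -big_split; apply: eq_bigr => a _; rewrite -big_split; apply: eq_bigr => b _ /=.
by rewrite !mxE; ring.
Qed.

Lemma lorentzZl z a X Y : lorentz g i z (a *: X) Y = a * lorentz g i z X Y.
Proof.
rewrite /lorentz /= !bilinE mulrDr; congr (_ + _).
  by rewrite /GRing.scale/=; ring.
rewrite mulr_sumr; apply: eq_bigr => a' _; rewrite mulr_sumr; apply: eq_bigr => b' _.
by rewrite !mxE /GRing.scale/=; ring.
Qed.

Lemma lorentzC z X Y : dom i z.1 -> lorentz g i z X Y = lorentz g i z Y X.
Proof.
move=> iz; rewrite /lorentz !bilinE; congr (_ + _); first by ring.
rewrite exchange_big /=; apply: eq_bigr => a _; apply: eq_bigr => b _.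
have [/(_ i z.1 iz)/matrixP/(_ a b) H _ _] := spatial_inner g z.2.
by rewrite -H [_^T a b]mxE; ring.
Qed.

Lemma lorentz_square z X Y : dom i z.1 ->
  lorentz g i z (X + Y) (X + Y) =
  lorentz g i z X X + 2 * lorentz g i z X Y + lorentz g i z Y Y.
Proof.
move=> iz; rewrite !lorentzDl !(lorentzC _ (X + Y))// !lorentzDl.
by rewrite (lorentzC Y X)//; ring.
Qed.

End Bilinear.

Variable (i : atlas M).
Local Notation D := (img i `*` [set: R]).

Let Q q X Y : R := lorentz g i (unst i q) X Y.

Lemma chart_cylinder_open : open D.
Proof.
rewrite openE => q [iq _].
have := st_img_nbhs iq; by apply: filterS => q' iq'.
Qed.

(** The components of the metric are C^1 and [lorentz] is a polynomial in them and in
    the coordinates of the vectors. *)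
Lemma lorentz_unif_lipschitz p (K : R) : img i p.1 ->
  unif_lipschitz [set xi : E * E | `|xi.1| <= K /\ `|xi.2| <= K] p
    (fun xi q => Q q xi.1 xi.2).
Proof.
move=> ip; have Dp : D p by [].
have oD := chart_cylinder_open.
set Xi := [set xi | _].
have UN : unif_lipschitz Xi p (fun _ q => lapse g (unst i q)).
  exact: (C1_unif_lipschitz Xi oD (lapse_smooth g i 1%N) Dp).
have Ub a : unif_lipschitz Xi p (fun _ q => Defs.shift g i (unst i q) 0 a).
  by apply: (C1_unif_lipschitz Xi oD _ Dp); exact: (Ck_on_entry 0 a oD (shift_smooth g i 1%N)).
have Ug a b : unif_lipschitz Xi p (fun _ q => spatial g q.2 i (psi i q.1) a b).
  by apply: (C1_unif_lipschitz Xi oD _ Dp); exact: (Ck_on_entry a b oD (spatial_smooth g i 1%N)).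
have U1 (k : E * E -> R) : (forall xi, Xi xi -> `|k xi| <= K) ->
   unif_lipschitz Xi p (fun xi _ => k xi) by exact: unif_lipschitz_cst.
have U11 a : unif_lipschitz Xi p (fun xi _ => xi.1.1 0 a).
  by apply: U1 => xi [h _]; rewrite (le_trans (rV_entry_le _ _))// (le_trans (pair_norm_fst _)).
have U12 : unif_lipschitz Xi p (fun xi _ => xi.1.2).
  by apply: U1 => xi [h _]; rewrite (le_trans (pair_norm_snd _)).
have U21 a : unif_lipschitz Xi p (fun xi _ => xi.2.1 0 a).
  by apply: U1 => xi [_ h]; rewrite (le_trans (rV_entry_le _ _))// (le_trans (pair_norm_fst _)).
have U22 : unif_lipschitz Xi p (fun xi _ => xi.2.2).
  by apply: U1 => xi [_ h]; rewrite (le_trans (pair_norm_snd _)).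
have Um1 : unif_lipschitz Xi p (fun _ _ => -1 : R).
  by apply: (@unif_lipschitz_cst _ _ _ _ _ (fun=> -1) 1) => xi _; rewrite normrN1.
have H : unif_lipschitz Xi p (fun xi q =>
   ((-1) * (lapse g (unst i q) * lapse g (unst i q))) * (xi.1.2 * xi.2.2) +
   \sum_a \sum_b (xi.1.1 0 a + xi.1.2 * Defs.shift g i (unst i q) 0 a) *
     spatial g q.2 i (psi i q.1) a b * (xi.2.1 0 b + xi.2.2 * Defs.shift g i (unst i q) 0 b)).
  apply: unif_lipschitz_add.
    apply: unif_lipschitz_mul; last exact: unif_lipschitz_mul.
    by apply: unif_lipschitz_mul => //; exact: unif_lipschitz_mul.
  apply: unif_lipschitz_sum => a; apply: unif_lipschitz_sum => b.
  apply: unif_lipschitz_mul; first (apply: unif_lipschitz_mul => //).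
    by apply: unif_lipschitz_add => //; exact: unif_lipschitz_mul.
  by apply: unif_lipschitz_add => //; exact: unif_lipschitz_mul.
have [L [r [L0 r0 h]]] := H; exists L, r; split=> // xi q q' hxi hq hq'.
have E0 q0 : Q q0 xi.1 xi.2 = ((-1) * (lapse g (unst i q0) * lapse g (unst i q0))) * (xi.1.2 * xi.2.2) +
   \sum_a \sum_b (xi.1.1 0 a + xi.1.2 * Defs.shift g i (unst i q0) 0 a) *
     spatial g q0.2 i (psi i q0.1) a b * (xi.2.1 0 b + xi.2.2 * Defs.shift g i (unst i q0) 0 b).
  rewrite /Q /lorentz bilinE; congr (_ + _); first by ring.
  by apply: eq_bigr => a _; apply: eq_bigr => b _; rewrite !mxE.
by rewrite !E0; exact: h.
Qed.

Lemma lorentz_cvg p X0 : img i p.1 ->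
  {for (p, X0), continuous (fun z : E * E => Q z.1 z.2 z.2)}.
Proof.
move=> ip; have Dp : D p by [].
have cN : lapse g (unst i z.1) @[z --> (p, X0)] --> lapse g (unst i p).
  by apply: (cvg_comp fst (fun q => lapse g (unst i q))); [exact: cvg_fst|exact: (lapse_smooth g i 0%N p Dp)].
have cb a : Defs.shift g i (unst i z.1) 0 a @[z --> (p, X0)] --> Defs.shift g i (unst i p) 0 a.
  apply: (cvg_comp fst (fun q => Defs.shift g i (unst i q) 0 a)); first exact: cvg_fst.
  apply: (@continuous_comp _ _ _ (fun q => Defs.shift g i (unst i q)) (fun u : 'rV[R]_n => u 0 a : R)).
    exact: (shift_smooth g i 0%N p Dp).
  exact: coord_continuous.
have cg a b : spatial g z.1.2 i (psi i z.1.1) a b @[z --> (p, X0)] -->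
    spatial g p.2 i (psi i p.1) a b.
  apply: (cvg_comp fst (fun q => spatial g q.2 i (psi i q.1) a b)); first exact: cvg_fst.
  apply: (@continuous_comp _ _ _ (fun q : E => spatial g q.2 i (psi i q.1)) (fun u : 'M[R]_n => u a b : R)).
    exact: (spatial_smooth g i 0%N p Dp).
  exact: coord_continuous.
have c2 : z.2.2 @[z --> (p, X0)] --> X0.2.
  by apply: (cvg_comp snd snd); [exact: cvg_snd|exact: cvg_snd].
have c1 a : (z.2 : E).1 0 a @[z --> (p, X0)] --> X0.1 0 a.
  apply: (cvg_comp snd (fun X : E => X.1 0 a)); first exact: cvg_snd.
  apply: (@continuous_comp _ _ _ fst (fun u : 'rV[R]_n => u 0 a : R)); first exact: cvg_fst.
  exact: coord_continuous.
rewrite /prop_for /continuous_at /Q /lorentz.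
apply: cvgD; first apply: cvgM.
- by apply: cvgN; under eq_fun do rewrite expr2; rewrite expr2; exact: cvgM.
- exact: cvgM.
apply: bilin_cvg => [a b|a]; first exact: cg.
under eq_fun do rewrite !mxE.
rewrite !mxE; apply: cvgD; first exact: c1.
by apply: cvgM; [exact: c2|exact: cb].
Qed.

Lemma open_cone p X0 : img i p.1 -> Q p X0 X0 < 0 -> 0 < X0.2 ->
  exists2 r, 0 < r & forall q X, ball p r q -> ball X0 r X ->
    [/\ img i q.1, Q q X X < 0 & 0 < X.2].
Proof.
move=> ip Q0 T0.
have H : \forall z \near (p, X0), [/\ img i z.1.1, Q z.1 z.2 z.2 < 0 & 0 < z.2.2].
  have H1 : \forall z \near (p, X0), img i z.1.1.
    have := st_img_nbhs ip; exact: (cvg_fst (F := nbhs p) (G := nbhs X0)).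
  have H2 : \forall z \near (p, X0), Q z.1 z.2 z.2 < 0.
    move: (@lorentz_cvg p X0 ip) => /(_ [set y | y < 0]); apply.
    by apply: open_nbhs_nbhs; split; [exact: open_lt|].
  have H3 : \forall z \near (p, X0), 0 < z.2.2.
    have : \forall X \near X0, 0 < X.2.
      have : {for X0, continuous (@snd 'rV[R]_n R)} by exact: cvg_snd.
      move=> /(_ [set y | 0 < y]); apply.
      by apply: open_nbhs_nbhs; split; [exact: open_gt|].
    exact: (cvg_snd (F := nbhs p) (G := nbhs X0)).
  by near=> z; split; near: z.
have [r r0 Hr] := (nbhs_ballP _ _).1 H.
by exists r => // q X hq hX; apply: (Hr (q, X)).
Unshelve. all: by end_near. Qed.

(** The unit normal of the slice, up to a factor: theta vanishes on it, so that its
    product with a vector sees only the time component of the vector. *)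
Definition normal_dir p : E := (- Defs.shift g i (unst i p), 1).

Lemma lorentz_normal p X : Q p X (normal_dir p) = - lapse g (unst i p) ^+ 2 * X.2.
Proof.
rewrite /Q /lorentz /= mulr1 scale1r addNr bilinE big1 ?addr0// => a _.
by rewrite big1// => b _; rewrite [X in _ * X]mxE mulr0.
Qed.

Lemma normal_timelike p : Q p (normal_dir p) (normal_dir p) < 0.
Proof. by rewrite lorentz_normal /= mulr1 oppr_lt0 exprn_gt0// lapse_gt0. Qed.

(** If the time component of a vector is small compared with a spatial part of length
    1, then the positive definite spatial metric dominates and the vector is
    spacelike. *)
Lemma cone_bound p : img i p.1 -> exists C r, [/\ 1 <= C, 0 < r &
  forall q, ball p r q -> img i q.1 /\
    forall X, Q q X X < 0 -> 0 < X.2 -> `|X| <= C * X.2].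
Proof.
move=> ip.
have [lam lam0 Hlam] : exists2 lam : R, 0 < lam &
    forall w : 'rV[R]_n, `|w| = 1 -> lam <= Q p (w, 0) (w, 0).
  pose S : set 'rV[R]_n := [set w | `|w| = 1].
  have QE w : Q p (w, 0) (w, 0) = bilin (spatial g p.2 i (psi i p.1)) w w.
    by rewrite /Q /lorentz /= mulr0 mulr0 add0r scale0r addr0.
  have [[w0 Sw0]|S0] := pselect (S !=set0); last first.
    by exists 1 => // w w1; exfalso; apply: S0; exists w.
  have cS : compact S.
    apply: bounded_closed_compact.
      exists 1; split; first exact: num_real.
      by move=> x x1 w /= ->; exact: ltW.
    apply: (@preimage_closed _ _ (fun w : 'rV[R]_n => `|w|) [set 1]).
      by move=> w _; exact: norm_continuous.
    exact: closed_eq.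
  have cQ : {within S, continuous (fun w => Q p (w, 0) (w, 0))}.
    rewrite (_ : (fun w => _) = (fun w => bilin (spatial g p.2 i (psi i p.1)) w w)); last first.
      by apply/funext => w; exact: QE.
    apply: continuous_subspaceT => w.
    apply: (@bilin_cvg R n _ (nbhs w) (nbhs_filter w) (fun=> spatial g p.2 i (psi i p.1)) id) => [a b|a].
      exact: cvg_cst.
    exact: coord_continuous.
  have [c Sc Hc] := compact_EVT_min (ex_intro _ w0 Sw0) cS cQ.
  exists (Q p (c, 0) (c, 0)).
    rewrite QE; have [_ h _] := spatial_inner g p.2; apply: h; first exact: dom_psi.
    apply/eqP => c0; move: (set_mem Sc); rewrite /S /= c0 normr0 => /eqP.
    by rewrite eq_sym oner_eq0.
  by move=> w Sw; apply: Hc; rewrite inE.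
have [L [r [L0 r0 HL]]] := lorentz_unif_lipschitz 1 ip.
have [r1 r10 Hr1] := (nbhs_ballP _ _).1 (st_img_nbhs ip).
(* below the slope [d] the mixed and the temporal terms cannot outweigh [lam] *)
pose d := Num.min 1 (lam / (8 * (L + 1))).
have L1 : 0 < L + 1 by rewrite ltr_wpDl.
have d0 : 0 < d by rewrite lt_min ltr01 divr_gt0// mulr_gt0.
have d1 : d <= 1 by rewrite ge_min lexx.
have dL : d * (L + 1) <= lam / 8.
  have : d <= lam / (8 * (L + 1)) by rewrite ge_min lexx orbT.
  rewrite ler_pdivlMr ?mulr_gt0//; lra.
pose r' := Num.min r (Num.min r1 (lam / (4 * (L + 1)))).
have r'0 : 0 < r' by rewrite !lt_min r0 r10 divr_gt0// mulr_gt0.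
exists d^-1, r'; split; [by rewrite invf_ge1|by []|].
move=> q hq; have hqr := ball_minl hq; have hq1 := ball_minl (ball_minr hq).
have iq : img i q.1 by exact: Hr1.
split=> // X QX X2.
have X1 : X.2 <= d^-1 * X.2 by apply: ler_peMl; rewrite ?invf_ge1//; exact: ltW.
apply: pair_norm_le; last by rewrite gtr0_norm.
rewrite ler_pdivlMl// leNgt; apply/negP => hX.
have m0 : 0 < `|X.1| by rewrite normr_gt0; apply/eqP => X10; move: hX; rewrite X10 normr0 mulr0 ltNge ltW.
pose w := `|X.1|^-1 *: X.1; pose s := `|X.1|^-1 * X.2.
have w1 : `|w| = 1 by rewrite normrZ gtr0_norm ?invr_gt0// mulVf// gt_eqF.
have s0 : 0 < s by rewrite mulr_gt0// invr_gt0.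
have sd : s <= d.
  by rewrite /s ler_pdivrMl// mulrC ltW.
pose W : E := (w, 0); pose T0 : E := (0, 1).
have XE : `|X.1|^-1 *: X = W + s *: T0.
  by congr pair => /=; [rewrite scaler0 addr0|rewrite add0r /GRing.scale/= mulr1].
have nW : `|W| <= 1 by apply: pair_norm_le; rewrite /= ?w1// normr0.
have nT : `|T0| <= 1 by apply: pair_norm_le; rewrite /= ?normr0// normr1.
have : lorentz g i (unst i q) (W + s *: T0) (W + s *: T0) < 0.
  by rewrite -XE lorentzZ pmulr_rlt0// exprn_gt0// invr_gt0.
have iq' : dom i (unst i q).1 by exact: dom_psi.
rewrite (lorentz_square W (s *: T0) iq') lorentzZ (lorentzC W (s *: T0) iq') lorentzZl.
have := Hlam w w1; rewrite -/W.
have [_ h1] := HL (W, W) p q (conj nW nW) (ballxx _ r0) hqr.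
have [h2 _] := HL (T0, W) q q (conj nT nW) hqr hqr.
have [h3 _] := HL (T0, T0) q q (conj nT nT) hqr hqr.
have hpq : `|p - q| <= lam / (4 * (L + 1)).
  by have := ball_minr (ball_minr hq); rewrite -ball_normE => /ltW.
move: h1 h2 h3; rewrite /= /Q !ler_norml.
set u := lorentz g i (unst i q) W W; set v := lorentz g i (unst i q) T0 W.
set t := lorentz g i (unst i q) T0 T0; set up := lorentz g i (unst i p) W W.
move=> /andP[_ h1] /andP[h2 _] /andP[h3 _] lp.
have Lpq : L * `|p - q| <= lam / 4.
  apply: (@le_trans _ _ ((L + 1) * (lam / (4 * (L + 1))))).
    by apply: ler_pM => //; rewrite lerDl.
  by rewrite le_eqVlt; apply/orP; left; apply/eqP; field; rewrite gt_eqF.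
have hu : 3 / 4 * lam <= u by lra.
have sL : s * L <= lam / 8.
  apply: le_trans dL; apply: ler_pM => //; [exact: ltW|by rewrite lerDl].
have sv : - (lam / 8) <= s * v.
  rewrite lerNl -mulrN; apply: le_trans sL; apply: ler_wpM2l; [exact: ltW|by rewrite lerNl].
have st : - (lam / 8) <= s ^+ 2 * t.
  rewrite expr2 -mulrA; apply: (@le_trans _ _ (s * (- (lam / 8)))).
    have : s * (lam / 8) <= lam / 8 by apply: ler_piMl; [rewrite divr_ge0// ltW|exact: le_trans sd d1].
    by rewrite mulrN lerN2.
  apply: ler_wpM2l; first exact: ltW.
  by rewrite lerNl -mulrN; apply: le_trans sL; apply: ler_wpM2l; [exact: ltW|by rewrite lerNl].
by rewrite ltNge => /negP; apply; lra.
Qed.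

End LorentzEstimates.

(** * Pushing cones and the chronological future *)

Section Pushing.
Variables (R : realType) (n : nat) (M : smooth_manifold R n) (g : sliced_metric M).
Local Notation E := ('rV[R]_n * R)%type.
Implicit Types (p q X Y T : E).
Variable (i : atlas M).
Let Q q X Y : R := lorentz g i (unst i q) X Y.

(** The quadratic forms at [q - eta T] and at [q] differ by O(eta), while adding
    [eta0 T] gains a term of order [eta0]; hence the gain wins as soon as
    [eta / eta0] is small. The Lipschitz dependence of the metric is essential
    here. *)
Lemma push_cone p : img i p.1 -> exists s0 r, [/\ 0 < s0, 0 < r &
  forall q eta eta0 X, ball p r q -> ball p r (q - eta *: normal_dir g i p) ->
    0 < eta0 -> 0 <= eta <= eta0 * s0 -> Q q X X < 0 -> 0 < X.2 ->
    Q (q - eta *: normal_dir g i p) (X + (eta0 * X.2) *: normal_dir g i p)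
      (X + (eta0 * X.2) *: normal_dir g i p) < 0].
Proof.
move=> ip; set T := normal_dir g i p.
have [C [rC [C1 rC0 HC]]] := cone_bound g ip.
pose K := Num.max C `|T|.
have [L [r [L0 r0 HL]]] := lorentz_unif_lipschitz g K ip.
pose m := lapse g (unst i p) ^+ 2.
have m0 : 0 < m by rewrite exprn_gt0// lapse_gt0.
have L1 : 0 < L + 1 by rewrite ltr_wpDl.
have LT : 0 < L * `|T| + 1 by rewrite ltr_wpDl// mulr_ge0.
pose r' := Num.min rC (Num.min r (m / (2 * (L + 1)))).
exists (m / (L * `|T| + 1)), r'; split; first by rewrite divr_gt0.
  by rewrite !lt_min rC0 r0 divr_gt0// mulr_gt0.
move=> q eta eta0 X; set q' := q - _ => hq hq' e0 /andP[eta_ge0 eta_le] QX X2.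
have [iq HX] := HC q (ball_minl hq); have {}HX := HX X QX X2.
have [iq' _] := HC q' (ball_minl hq').
pose Y := X.2^-1 *: X.
have XE : X = X.2 *: Y by rewrite /Y scalerA divff ?scale1r// gt_eqF.
have Y2 : Y.2 = 1 by rewrite /Y /= /GRing.scale/= mulVf// gt_eqF.
have nY : `|Y| <= K.
  rewrite /Y normrZ gtr0_norm ?invr_gt0// ler_pdivrMl// (le_trans HX)// mulrC.
  by rewrite ler_pM2l// le_max lexx.
have nT : `|T| <= K by rewrite le_max lexx orbT.
have QY : Q q Y Y < 0 by rewrite /Q /Y lorentzZ pmulr_rlt0// exprn_gt0// invr_gt0.
have -> : X + (eta0 * X.2) *: T = X.2 *: (Y + eta0 *: T).
  by rewrite scalerDr -XE scalerA mulrC.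
clearbody Y.
rewrite /Q lorentzZ pmulr_rlt0 ?exprn_gt0//.
have iq1 : dom i (unst i q').1 by exact: dom_psi.
have br := ball_minl (ball_minr hq); have br' := ball_minl (ball_minr hq').
rewrite (lorentz_square g _ _ iq1) lorentzZ (lorentzC g _ _ iq1) lorentzZl.
rewrite (lorentzC g _ _ iq1).
have [_ h1] := HL (Y, Y) q' q (conj nY nY) br' br.
have [_ h2] := HL (Y, T) p q' (conj nY nT) (ballxx _ r0) br'.
have [_ h3] := HL (T, T) p q' (conj nT nT) (ballxx _ r0) br'.
have dq : `|q' - q| = eta * `|T|.
  by rewrite /q' addrC addrA addNr add0r normrN normrZ ger0_norm.
have dp : L * `|p - q'| <= m / 2.
  apply: (@le_trans _ _ ((L + 1) * (m / (2 * (L + 1))))).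
    apply: ler_pM => //; first by rewrite lerDl.
    by have := ball_minr (ball_minr hq'); rewrite -ball_normE => /ltW.
  by rewrite le_eqVlt; apply/orP; left; apply/eqP; field; rewrite gt_eqF.
have pT := lorentz_normal g i p Y; have TT := lorentz_normal g i p T.
move: h1 h2 h3 pT TT QY; rewrite /= dq !ler_norml Y2 !mulr1 /= -/T -/m /Q.
set a := lorentz g i (unst i q') Y Y; set b := lorentz g i (unst i q') Y T.
set c := lorentz g i (unst i q') T T.
move=> /andP[_ h1] /andP[h2 _] /andP[h3 _] pT TT QY.
have hb : b <= - (m / 2) by move: h2; rewrite pT; lra.
have hc : c <= 0 by move: h3; rewrite TT; lra.
have e2c : eta0 ^+ 2 * c <= 0 by rewrite pmulr_rle0// exprn_gt0.
have eb : eta0 * b <= - (eta0 * m / 2).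
  by have := ler_wpM2l (ltW e0) hb; lra.
have eT : L * (eta * `|T|) <= eta0 * m.
  apply: (@le_trans _ _ (eta * (L * `|T| + 1))).
    by rewrite mulrCA ler_wpM2l// lerDl.
  apply: (le_trans (ler_wpM2r (ltW LT) eta_le)).
  by rewrite le_eqVlt; apply/orP; left; apply/eqP; field; rewrite gt_eqF.
lra.
Qed.

End Pushing.

Section Chronology.
Variables (R : realType) (n : nat) (M : smooth_manifold R n) (g : sliced_metric M).
Local Notation E := ('rV[R]_n * R)%type.
Implicit Types (x y z : spacetime M) (p q X : E).

Lemma chronological_trans x y z : chronological g x y -> chronological g y z ->
  chronological g x z.
Proof. by move=> [C xy] [C' yz]; exists (C `|` C'); exact: timelike_join xy yz. Qed.

(** The timelike directions form an open set, so that a straight segment whose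
    direction is close to a timelike one is timelike throughout. *)
Lemma straight_chronological i p X0 : img i p.1 ->
  lorentz g i (unst i p) X0 X0 < 0 -> 0 < X0.2 ->
  exists2 r, 0 < r & forall q1 q2 (e : R), ball p r q1 -> ball p r q2 -> 0 < e ->
    ball X0 r (e^-1 *: (q2 - q1)) -> chronological g (unst i q1) (unst i q2).
Proof.
move=> ip Q0 T0; have [r r0 Hr] := open_cone ip Q0 T0.
exists r => // q1 q2 e h1 h2 e0 hX.
pose w (s : R) := q1 + s *: (q2 - q1).
have E1 : unst i q1 = (unst i \o w) 0 by rewrite /= /w scale0r addr0.
have E2 : unst i q2 = (unst i \o w) 1 by rewrite /= /w scale1r addrC subrK.
exists ((unst i \o w) @` `[0, 1]); rewrite E1 E2; apply: timelike_segment => // s s01.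
have hw : ball p r (w s) by exact: ball_segment.
have [iw Qw Tw] := Hr _ _ hw hX.
have XE : q2 - q1 = e *: (e^-1 *: (q2 - q1)) by rewrite scalerA divff ?scale1r// gt_eqF.
apply: chart_curve_timelike => //; rewrite ?line_derive1.
- exact: line_C1.
- by rewrite XE lorentzZ pmulr_rlt0// exprn_gt0.
- by rewrite XE /= /GRing.scale/= pmulr_rgt0.
Qed.

Lemma chart_nbhs i z (B : set E) : dom i z.1 -> nbhs (st_coord i z) B ->
  \forall z' \near z, [/\ dom i z'.1, B (st_coord i z') & unst i (st_coord i z') = z'].
Proof.
move=> iz hB; have H1 := st_dom_nbhs iz.
have H2 : \forall z' \near z, B (st_coord i z') by exact: (st_coord_continuous iz hB).
by near=> z'; have iz' : dom i z'.1 by [near: z']; split=> //; [near: z'|exact: st_coordK].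
Unshelve. all: by end_near. Qed.

Lemma event_near_normal z : exists i X0, [/\ dom i z.1, lorentz g i z X0 X0 < 0 & 0 < X0.2].
Proof.
have [i iz] := atlas_cover z.1; exists i, (normal_dir g i (st_coord i z)).
by have := normal_timelike g i (st_coord i z); rewrite st_coordK.
Qed.

Lemma later_event z : exists w, \forall z' \near z, chronological g z' w.
Proof.
have [i [X0 [iz Q0 T0]]] := event_near_normal z.
pose p := st_coord i z; have ip : img i p.1 by exact: img_phi.
have Q0' : lorentz g i (unst i p) X0 X0 < 0 by rewrite st_coordK.
have [r r0 Hr] := straight_chronological ip Q0' T0.
have [e e0 he] : exists2 e : R, 0 < e & e * `|X0| < r.
  exists (r / (`|X0| + 1)); first by rewrite divr_gt0// ltr_wpDl.
  by rewrite -mulrA gtr_pMr// ltr_pdivrMl ?mulr1 ?ltrDl// ltr_wpDl.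
exists (unst i (p + e *: X0)).
have : nbhs p (ball p (Num.min r (e * r))).
  by apply: nbhsx_ballx; rewrite lt_min r0 mulr_gt0.
move=> /(chart_nbhs iz); apply: filterS => z' [iz' hB <-].
apply: (Hr _ _ e) => //; first exact: ball_minl hB.
  by rewrite -ball_normE /ball_/= opprD addrA subrr sub0r normrN normrZ gtr0_norm.
have := ball_minr hB; rewrite -!ball_normE /ball_/= => hB'.
have -> : X0 - e^-1 *: (p + e *: X0 - st_coord i z') = - (e^-1 *: (p - st_coord i z')).
  by rewrite addrAC scalerDr scalerA mulVf ?gt_eqF// scale1r opprD addrCA subrr addr0.
by rewrite normrN normrZ gtr0_norm ?invr_gt0// ltr_pdivrMl.
Qed.

Lemma earlier_event z : exists w, chronological g w z.
Proof.
have [i [X0 [iz Q0 T0]]] := event_near_normal z.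
pose p := st_coord i z; have ip : img i p.1 by exact: img_phi.
have Q0' : lorentz g i (unst i p) X0 X0 < 0 by rewrite st_coordK.
have [r r0 Hr] := straight_chronological ip Q0' T0.
have [e e0 he] : exists2 e : R, 0 < e & e * `|X0| < r.
  exists (r / (`|X0| + 1)); first by rewrite divr_gt0// ltr_wpDl.
  by rewrite -mulrA gtr_pMr// ltr_pdivrMl ?mulr1 ?ltrDl// ltr_wpDl.
exists (unst i (p - e *: X0)); rewrite -[z in chronological _ _ z](st_coordK iz).
apply: (Hr _ _ e) => //.
- by rewrite -ball_normE /ball_/= opprB addrC subrK normrZ gtr0_norm.
- exact: ballxx.
by rewrite opprB addrC subrK scalerA mulVf ?gt_eqF// scale1r; exact: ballxx.
Qed.

(** Replace the last piece of the curve by a straight segment: its secants approximate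
    the final velocity, and remain timelike when the endpoint moves a little. *)
Lemma chronological_near x z : chronological g x z -> \forall z' \near z, chronological g x z'.
Proof.
case=> C; elim=> {x z C} [c a b ab h|x y z C C' xy _ _ IH]; last first.
  by apply: filterS IH => z'; apply: chronological_trans; exists C.
have abb : a <= b <= b by rewrite lexx ltW.
have [cb Cb] := h b abb; have [i ib] := atlas_cover (c b).1.
have [C1b Q0 T0] := Cb i ib; pose w := st_coord i \o c.
have db := C1_at_derivable C1b.
pose X0 := derive1 w b.
pose p := st_coord i (c b); have ip : img i p.1 by exact: img_phi.
have Q0' : lorentz g i (unst i p) X0 X0 < 0 by rewrite st_coordK.
have [r r0 Hr] := straight_chronological ip Q0' T0.
have : (fun t => t^-1 *: ((w \o shift b) (t *: (1 : R)) - w b)) @ 0^' --> X0.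
  by rewrite /X0 derive1E; exact: db.
have r20 : 0 < r / 2 by rewrite divr_gt0.
move=> /(_ (ball X0 (r / 2))) /(_ (nbhsx_ballx _ _ r20)) /nbhs_ballP[d1 /= d10 Hd1].
have : \forall s \near b, ball p r (w s) /\ dom i (c s).1.
  have H1 : \forall s \near b, ball p r (w s).
    by apply: (derivable_continuous db); exact: nbhsx_ballx.
  have H2 : \forall s \near b, dom i (c s).1 := cb _ (st_dom_nbhs ib).
  by near=> s; split; near: s.
move=> /nbhs_ballP[d2 /= d20 Hd2].
pose e := Num.min (b - a) (Num.min d1 d2) / 2.
have m0 : 0 < Num.min (b - a) (Num.min d1 d2) by rewrite !lt_min subr_gt0 ab d10.
have e0 : 0 < e by rewrite divr_gt0.
have em : e < Num.min (b - a) (Num.min d1 d2) by rewrite /e; lra.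
move: (em); rewrite !lt_min => /and3P[eab ed1 ed2].
have [wbe ibe] : ball p r (w (b - e)) /\ dom i (c (b - e)).1.
  by apply: Hd2; rewrite /ball/= opprB addrC subrK gtr0_norm.
have HX : ball X0 (r / 2) (e^-1 *: (p - w (b - e))).
  have := Hd1 (- e); rewrite /ball/= sub0r opprK gtr0_norm// => /(_ ed1).
  rewrite oppr_eq0 gt_eqF// => /(_ isT).
  have sc : (- e) *: (1 : R) = - e by rewrite /GRing.scale/= mulr1.
  by rewrite /= sc [- e + b]addrC invrN scaleNr -scalerN opprB.
have x1 : chronological g (c a) (c (b - e)).
  exists (c @` `[a, b - e]); have [] // := timelike_subsegment h (lexx a) (_ : a < b - e) _.
    by rewrite ltrBrDr -ltrBrDl.
  by rewrite gerBl ltW.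
have : nbhs p (ball p (Num.min r (e * (r / 2)))).
  by apply: nbhsx_ballx; rewrite lt_min r0 mulr_gt0.
move=> /(chart_nbhs ib); apply: filterS => z' [iz' hB <-].
apply: (chronological_trans x1); rewrite -[c (b - e)](st_coordK ibe).
apply: (Hr _ _ e) => //; first exact: ball_minl hB.
have := ball_minr hB; move: HX; rewrite -!ball_normE /ball_/= => HX hB'.
have -> : X0 - e^-1 *: (st_coord i z' - st_coord i (c (b - e))) =
   (X0 - e^-1 *: (p - w (b - e))) + e^-1 *: (p - st_coord i z').
  rewrite -addrA; congr (_ + _); rewrite -!scalerN -scalerDr; congr (_ *: _).
  by rewrite !opprB addrA subrK.
rewrite (le_lt_trans (ler_normD _ _))// (splitr r) ltrD// normrZ gtr0_norm ?invr_gt0//.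
by rewrite ltr_pdivrMl.
Unshelve. all: by end_near. Qed.

End Chronology.

(** * Speed bounds and strong causality *)

Section SpeedBound.
Variables (R : realType) (n : nat) (M : smooth_manifold R n) (g : sliced_metric M).
Local Notation E := ('rV[R]_n * R)%type.
Implicit Types (x y z : spacetime M) (X : E) (F : M -> R).

Definition speed_bounded F (C : R) z : Prop := forall i X, dom i z.1 ->
  lorentz g i z X X < 0 -> 0 < X.2 -> `|mderiv F i z.1 X.1| <= C * X.2.

Lemma speed_bounded_le F C C' z : C <= C' -> speed_bounded F C z -> speed_bounded F C' z.
Proof.
move=> CC h i X iz QX X2; apply: le_trans (h i X iz QX X2) _.
by rewrite ler_pM2r.
Qed.

Lemma mderiv_bound F i (m : M) : msmooth F -> dom i m -> exists2 B : R, 0 <= B &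
  \forall m' \near m, forall u, `|mderiv F i m' u| <= B * `|u|.
Proof.
move=> hF im; exists (\sum_a (`|mderiv F i m (delta_mx 0 a)| + 1)).
  by apply: sumr_ge0 => a _; rewrite addr_ge0.
have H : \forall m' \near m, forall a,
    `|mderiv F i m' (delta_mx 0 a)| <= `|mderiv F i m (delta_mx 0 a)| + 1.
  apply: filter_forall => a.
  have /cvgrPdist_lt/(_ 1 ltr01) := @mderiv_continuous _ _ _ F i m (delta_mx 0 a) hF im.
  apply: filterS => m'; rewrite distrC => hm.
  rewrite -[mderiv F i m' _](subrK (mderiv F i m (delta_mx 0 a))).
  by rewrite (le_trans (ler_normD _ _))// addrC lerD2l; exact: ltW.
have H2 := dom_nbhs im.
near=> m' => u; have im' : dom i m' by near: m'.
rewrite mderivE// (le_trans (ler_norm_sum _ _ _))// mulr_suml; apply: ler_sum => a _.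
rewrite normrM mulrC ler_pM//; last exact: rV_entry_le.
by move: a; near: m'.
Unshelve. all: by end_near. Qed.

Lemma local_speed_bound F z : msmooth F -> exists C : R, \forall z' \near z, speed_bounded F C z'.
Proof.
move=> hF; have [j jz] := atlas_cover z.1.
pose p := st_coord j z; have jp : img j p.1 by exact: img_phi.
have [C [r [C1 r0 HC]]] := cone_bound g jp.
have [B B0 HB] := mderiv_bound hF jz.
exists (B * C).
have H1 := chart_nbhs jz (nbhsx_ballx p r r0).
have H2 : \forall z' \near z, forall u, `|mderiv F j z'.1 u| <= B * `|u| by exact: (cvg_fst HB).
near=> z' => i X iz QX X2.
have [jz' hb z'E] : [/\ dom j z'.1, ball p r (st_coord j z') & unst j (st_coord j z') = z'].
  by near: z'.
have hB : forall u, `|mderiv F j z'.1 u| <= B * `|u| by near: z'.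
rewrite -(mderiv_change X.1 hF iz jz') -mulrA.
pose X' : E := (change_chart i j z'.1 X.1, X.2).
apply: le_trans (hB _) _; apply: ler_wpM2l => //.
apply: (le_trans (pair_norm_fst X')).
have [_ h] := HC _ hb; apply: (h X') => //.
by rewrite z'E (lorentz_change_chart g X X iz jz').
Unshelve. all: by end_near. Qed.

(** Speed bounds hold near every event, so compactness of support times interval gives
    one bound there; elsewhere the differential vanishes. *)
Lemma global_speed_bound F (a b : R) : msmooth F ->
  (exists2 K, compact K & forall m, ~ K m -> F m = 0) ->
  exists2 C : R, 0 < C & forall z, a <= z.2 <= b -> speed_bounded F C z.
Proof.
move=> hF [K cK F0].
have cKab : compact (K `*` `[a, b]) by exact: compact_setX cK (@segment_compact _ a b).
have : \forall C \near (+oo : set_system R), K `*` `[a, b] `<=` speed_bounded F C.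
  have /compact_near_coveringP := cKab; apply => z _.
  have [C HC] := local_speed_bound z hF.
  exists (speed_bounded F C, [set C' | C < C']).
    by split=> //; exists C; split=> //; exact: num_real.
  by move=> [z' C'] [/= h /ltW CC]; exact: speed_bounded_le h.
move=> H; have [C [C0 HC]] : exists C : R, 0 < C /\ K `*` `[a, b] `<=` speed_bounded F C.
  by apply: (@filter_ex _ (+oo : set_system R)); apply: filterI H; exact: nbhs_pinfty_gt.
exists C => // z zab; have [Kz|nKz] := pselect (K z.1).
  by apply: HC; split=> //=; rewrite in_itv.
have clK : closed K by apply: compact_closed => //; exact: points_hausdorff.
move=> i X iz QX X2.
rewrite (@mderiv_near0 _ _ _ F _ _ _ (~` K))// ?normr0 ?mulr_ge0// ?ltW//.
by split=> //; rewrite openC.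
Qed.

(** The functions [C t + F] and [C t - F] do not decrease along the curve. *)
Lemma timelike_lipschitz F (C a b : R) x y D : msmooth F ->
  (forall z, a <= z.2 <= b -> speed_bounded F C z) ->
  timelike_curve g x y D -> a <= x.2 -> y.2 <= b -> `|F y.1 - F x.1| <= C * (y.2 - x.2).
Proof.
move=> hF HC; elim=> {x y D} [c s1 s2 s12 h|x y z D D' xy IH1 yz IH2] ax yb; last first.
  have h1 := timelike_time_lt xy; have h2 := timelike_time_lt yz.
  have := IH1 ax (le_trans (ltW h2) yb); have := IH2 (le_trans ax (ltW h1)) yb.
  rewrite !ler_norml; lra.
have tb s : s1 <= s <= s2 -> a <= (c s).2 <= b.
  move=> s12s; have Cs : (c @` `[s1, s2]) (c s) by exists s => //=; rewrite in_itv.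
  have /andP[h1 h2] := timelike_mem_time (timelike_segment s12 h) Cs.
  by rewrite (le_trans ax h1) (le_trans h2 yb).
have D s : s1 <= s <= s2 -> exists f' t', [/\ is_derive s (1 : R) (F \o (fst \o c)) f',
    is_derive s (1 : R) (snd \o c) t' & `|f'| <= C * t'].
  move=> hs; have hc := h s hs; have [i ic] := atlas_cover (c s).1.
  have [D1 E1] := timelike_coord hc ic; have [D2 _] := timelike_time hc.
  have E2 := timelike_time_chart hc ic.
  have [D3 E3] := curve_is_derive hF (timelike_fst_continuous hc) ic D1.
  have [_ /(_ i ic)[_ Q0 T0]] := hc.
  exists (derive1 (F \o (fst \o c)) s), (derive1 (snd \o c) s); split.
  - by apply: DeriveDef => //; rewrite derive1E.
  - by apply: DeriveDef => //; rewrite derive1E.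
  by rewrite E3 E1 E2; exact: (HC (c s) (tb s hs)).
have mono (e : R) : `|e| = 1 ->
   C * (c s1).2 + e * F (c s1).1 <= C * (c s2).2 + e * F (c s2).1.
  move=> e1; pose G s := C * (snd \o c) s + e * (F \o (fst \o c)) s.
  have DG s : s1 <= s <= s2 -> exists2 G', is_derive s (1 : R) G G' & 0 <= G'.
    move=> /D[f' [t' [df dt ft]]]; exists (C * t' + e * f').
      by apply: is_deriveD; exact: is_deriveZ.
    have : `|e * f'| <= C * t' by rewrite normrM e1 mul1r.
    by rewrite ler_norml; lra.
  have sub s : s \in `]s1, s2[%R -> s1 <= s <= s2.
    by rewrite in_itv/= => /andP[/ltW -> /ltW ->].
  apply: (@ger0_derive1_le_cc R G s1 s2).
  - by move=> s /sub/DG[G' [dG _] _].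
  - by move=> s /sub/DG[G' [dG GE] G0]; rewrite derive1E GE.
  - apply: continuous_in_subspaceT => s; rewrite inE /= in_itv/= => /DG[G' [dG _] _].
    exact: derivable_continuous.
  - by rewrite in_itv/= lexx ltW.
  - by rewrite in_itv/= lexx ltW.
  - exact: ltW.
have := mono 1 (normr1 _); have := mono (-1) (normrN1 _).
rewrite ler_norml; lra.
Qed.

(** For a bump [F] at [z], with maximum at [z], the neighbourhood is the region
    [F z - F + C `|t - t z| < e]. Along a timelike curve [C t - F] and [C t + F] do
    not decrease, so membership of a later point controls the part of the curve
    after the time of [z], and membership of an earlier point the part before. *)
Lemma convex_nbhs z U : nbhs z U -> exists W, [/\ nbhs z W, W `<=` U &
  forall x y D, timelike_curve g x y D -> W x -> W y -> D `<=` W].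
Proof.
move=> [[A B] [/= hA hB] ABU].
have [F [Fc [bF Fz Fmax FA]]] := bump_exists hA.
have [d d0 Hd] := (nbhs_ballP _ _).1 hB.
have [C C0 HC] := global_speed_bound (z.2 - 1) (z.2 + 1) (bump_smooth bF) (bump_support bF).
pose e := Num.min (F z.1) (C * Num.min d 1).
have e0 : 0 < e by rewrite lt_min Fz mulr_gt0// lt_min d0 ltr01.
pose W : set (spacetime M) := [set y | F z.1 - F y.1 + C * `|y.2 - z.2| < e].
have Wtime y : W y -> `|y.2 - z.2| < Num.min d 1.
  move=> Wy; rewrite -(ltr_pM2l C0); apply: (@lt_le_trans _ _ e); last by rewrite ge_min lexx orbT.
  by apply: le_lt_trans Wy; rewrite lerDr subr_ge0.
exists W; split.
- have cF : F y.1 @[y --> z] --> F z.1.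
    by apply: (cvg_comp fst F cvg_fst); exact: (msmooth_continuous (bump_smooth bF)).
  have c2 : y.2 @[y --> z] --> z.2 by exact: cvg_snd.
  have : F z.1 - F y.1 + C * `|y.2 - z.2| @[y --> z] --> F z.1 - F z.1 + C * `|z.2 - z.2|.
    apply: cvgD; first by apply: cvgB => //; exact: cvg_cst.
    apply: cvgM; first exact: cvg_cst.
    by apply: cvg_norm; apply: cvgB => //; exact: cvg_cst.
  rewrite !subrr normr0 mulr0 addr0 => /(_ [set y | y < e]); apply.
  exact: lt_nbhsl.
- move=> y Wy; apply: ABU; split => /=.
    apply: FA; rewrite gt_eqF//.
    have : F z.1 - F y.1 + C * `|y.2 - z.2| < F z.1.
      by apply: lt_le_trans Wy _; rewrite ge_min lexx.
    have : 0 <= C * `|y.2 - z.2| by rewrite mulr_ge0// ltW.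
    lra.
  apply: Hd; rewrite -ball_normE /ball_/= distrC.
  by have := Wtime y Wy; rewrite lt_min => /andP[].
move=> x y D xy Wx Wy v Dv.
have /andP[tx ty] := timelike_mem_time xy Dv.
have [Dx Dy] := timelike_ends xy.
have t1 u : W u -> `|u.2 - z.2| < 1 by move=> /Wtime; rewrite lt_min => /andP[].
have x1 : z.2 - 1 <= x.2 by have := t1 x Wx; rewrite ltr_norml; lra.
have y1 : y.2 <= z.2 + 1 by have := t1 y Wy; rewrite ltr_norml; lra.
have L u w D' : timelike_curve g u w D' -> z.2 - 1 <= u.2 -> w.2 <= z.2 + 1 ->
    `|F w.1 - F u.1| <= C * (w.2 - u.2).
  by apply: timelike_lipschitz (bump_smooth bF) HC.
have xv : `|F v.1 - F x.1| <= C * (v.2 - x.2).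
  case: (timelike_between xy Dx Dv) => [->|[D' _ xv]|[D' _ /timelike_time_lt]].
  - by rewrite !subrr normr0 mulr0.
  - exact: L xv x1 (le_trans ty y1).
  - by rewrite ltNge tx.
have vy : `|F y.1 - F v.1| <= C * (y.2 - v.2).
  case: (timelike_between xy Dv Dy) => [->|[D' _ vy]|[D' _ /timelike_time_lt]].
  - by rewrite !subrr normr0 mulr0.
  - exact: L vy (le_trans x1 tx) y1.
  - by rewrite ltNge ty.
move: Wx Wy xv vy; rewrite /W /= !ler_norml.
have [zv|vz] := leP z.2 v.2.
  rewrite (@ger0_norm _ (v.2 - z.2)) ?subr_ge0// (@ger0_norm _ (y.2 - z.2)) ?subr_ge0//.
    by move=> _ Wy _ /andP[_ h]; lra.
  exact: le_trans ty.
rewrite (@ltr0_norm _ (v.2 - z.2)) ?subr_lt0// (@ltr0_norm _ (x.2 - z.2)) ?subr_lt0//.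
  by move=> Wx _ /andP[h _] _; lra.
exact: le_lt_trans vz.
Qed.

Lemma connected_from_pairs (T : topologicalType) (A : set T) :
  (forall u v, A u -> A v -> exists2 B, B `<=` A & [/\ connected B, B u & B v]) ->
  connected A.
Proof.
move=> h; have [[a Aa]|A0] := pselect (A !=set0); last first.
  rewrite (_ : A = set0); first exact: connected0.
  by apply/seteqP; split=> // u Au; apply: A0; exists u.
pose Bs := [set B : set T | [/\ B `<=` A, connected B & B a]].
have -> : A = \bigcup_(B in Bs) B.
  apply/seteqP; split=> [u Au|u [B [BA _ _] Bu]]; last exact: BA.
  by have [B BA [cB Ba Bu]] := h a u Aa Au; exists B.
apply: bigcup_connected; first by exists a => B [].
by move=> B [].
Qed.

Lemma sliced_strongly_causal : strongly_causal g.
Proof.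
move=> z U hU; have [W [hW WU convW]] := convex_nbhs hU.
exists W; split=> // x y C xy; apply: connected_from_pairs => u v [Cu Wu] [Cv Wv].
case: (timelike_between xy Cu Cv) => [<-|[D DC uv]|[D DC vu]].
- exists [set u]; first by move=> _ ->.
  by split=> //; exact: connected1.
- have [Du Dv] := timelike_ends uv; exists D; last by split=> //; exact: timelike_connected uv.
  by move=> w Dw; split; [exact: DC|exact: (convW _ _ _ uv)].
- have [Dv Du] := timelike_ends vu; exists D; last by split=> //; exact: timelike_connected vu.
  by move=> w Dw; split; [exact: DC|exact: (convW _ _ _ vu)].
Qed.

End SpeedBound.

(** * Local push-up *)

Section AffineShift.
Variables (R : realType) (n : nat).
Local Notation E := ('rV[R]_n * R)%type.

(** In a chart, events are moved against the direction [T], the less the closer their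
    time is to [t1]. *)
Definition slide (T : E) (eta t1 : R) (v : E) : E := v - (eta * (t1 - v.2)) *: T.

Lemma slide_derive (T : E) (eta t1 : R) (v : R -> E) s : derivable v s 1 ->
  derivable (slide T eta t1 \o v) s 1 /\
  derive1 (slide T eta t1 \o v) s = derive1 v s + (eta * (derive1 v s).2) *: T.
Proof.
move=> dv; have [d2 E2] := derive1_snd dv.
have D0 : is_derive s (1 : R) v (derive1 v s) by rewrite derive1E; exact: derivableP.
have D2 : is_derive s (1 : R) (snd \o v) (derive1 v s).2.
  by rewrite -E2 derive1E; exact: derivableP.
have dT (r : R) : differentiable (fun t : R => 0 + t *: T) r.
  by apply/derivable1_diffP; exact: (@ex_derive _ _ _ _ _ _ _ (line_is_derive _ _ _)).
have D3 : is_derive s (1 : R) (fun r => eta * (snd \o v) r - eta * t1) (eta * (derive1 v s).2).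
  apply: (is_derive_eq (is_deriveB (is_deriveZ eta D2) (is_derive_cst (eta * t1) s 1))).
  by rewrite subr0.
have D4 : is_derive s (1 : R) (fun r => 0 + (eta * (snd \o v) r - eta * t1) *: T)
    ((eta * (derive1 v s).2) *: T).
  have d3 : differentiable (fun r => eta * (snd \o v) r - eta * t1) s.
    by apply/derivable1_diffP; case: D3.
  apply: DeriveDef.
    by apply/derivable1_diffP; exact: differentiable_comp d3 (dT _).
  rewrite (@derive_comp _ _ _ _ (fun r => eta * (snd \o v) r - eta * t1) (fun t : R => 0 + t *: T))//.
  rewrite (@derive_val _ _ _ _ _ _ _ D3).
  rewrite -[X in 'D_X _ _]mulr1 -[_ * 1]/(_ *: 1) derive_scale//.
  by rewrite (@derive_val _ _ _ _ _ _ _ (line_is_derive 0 T _)).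
have D5 := is_deriveD D0 D4.
have E5 : slide T eta t1 \o v = v + (fun r => 0 + (eta * (snd \o v) r - eta * t1) *: T).
  apply/funext => r; rewrite /slide /= fctE add0r; congr (_ + _).
  by rewrite -scaleNr mulrBr opprB.
rewrite E5; split; first by case: D5.
by rewrite derive1E; case: D5.
Qed.

Lemma slide_C1 (T : E) (eta t1 : R) (v : R -> E) s : C1_at v s ->
  C1_at (slide T eta t1 \o v) s.
Proof.
move=> hv; have hv2 := C1_at_near hv; near=> r.
have hr : C1_at v r by near: r.
split; first by have [] := slide_derive T eta t1 (C1_at_derivable hr).
have EE : \near r, derive1 v r + (eta * (derive1 v r).2) *: T = derive1 (slide T eta t1 \o v) r.
  by apply: filterS hr => t [dt _]; have [_ ->] := slide_derive T eta t1 dt.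
rewrite /prop_for /continuous_at -(nbhs_singleton EE).
apply: cvg_trans (near_eq_cvg EE) _.
have cv := C1_at_derive_continuous hr.
apply: cvgD; first exact: cv.
apply: cvgZr_tmp.
apply: cvgM; first exact: cvg_cst.
by apply: (cvg_comp _ _ cv); exact: cvg_snd.
Unshelve. all: by end_near. Qed.

End AffineShift.

Section LocalPush.
Variables (R : realType) (n : nat) (M : smooth_manifold R n) (g : sliced_metric M).
Local Notation E := ('rV[R]_n * R)%type.
Implicit Types (x y z q r : spacetime M) (X T : E).

(** The closure of the causal relation, as a relation on pairs. *)
Definition limit_causal q r : Prop := forall A B, nbhs q A -> nbhs r B ->
  exists q' r', [/\ A q', B r' & q' = r' \/ exists D, timelike_curve g q' r' D].

Lemma timelike_slide i (eta t1 : R) (T : E) (W : set (spacetime M)) q r D :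
  (forall z X, W z -> lorentz g i z X X < 0 -> 0 < X.2 ->
     [/\ dom i z.1, img i (slide T eta t1 (st_coord i z)).1,
      lorentz g i (unst i (slide T eta t1 (st_coord i z)))
        (X + (eta * X.2) *: T) (X + (eta * X.2) *: T) < 0 &
      0 < (X + (eta * X.2) *: T).2]) ->
  (forall z, W z -> dom i z.1) ->
  timelike_curve g q r D -> D `<=` W ->
  chronological g (unst i (slide T eta t1 (st_coord i q)))
                  (unst i (slide T eta t1 (st_coord i r))).
Proof.
move=> hW Wi; elim=> {q r D} [c a b ab h|x y z D D' xy IH1 yz IH2] DW; last first.
  apply: (@chronological_trans _ _ _ g _ (unst i (slide T eta t1 (st_coord i y)))).
    by apply: IH1 => w Dw; apply: DW; left.
  by apply: IH2 => w Dw; apply: DW; right.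
pose w := slide T eta t1 \o (st_coord i \o c).
exists ((unst i \o w) @` `[a, b]); apply: (timelike_segment (c := unst i \o w)) => // s sab.
have Wc : W (c s) by apply: DW; exists s => //=; rewrite in_itv.
have [_ /(_ i (Wi _ Wc))[C1 Q0 T0]] := h s sab.
have [ic iw Qw Tw] := hW _ _ Wc Q0 T0.
have [dw Ew] := slide_derive T eta t1 (C1_at_derivable C1).
apply: chart_curve_timelike.
- exact: slide_C1.
- exact: iw.
- by rewrite [derive1 w s]Ew.
- by rewrite [derive1 w s]Ew.
Qed.

(** Approximating curves from [q'] to [r'] are slid by a small multiple of the normal
    direction. Their new start is near [q], hence still in the future of [x]; they
    stay timelike by [push_cone]; and [r] is reached from their new end by a
    straight segment, as the end was displaced into the past of [r]. *)
Lemma local_push z : exists2 U, nbhs z U & forall x q r, U q -> U r ->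
  limit_causal q r -> chronological g x q -> chronological g x r.
Proof.
have [i iz] := atlas_cover z.1; pose p := st_coord i z.
have ip : img i p.1 by exact: img_phi.
pose T := normal_dir g i p.
have T2 : T.2 = 1 by [].
have [s0 [r1 [s00 r10 H1]]] := push_cone g ip.
have [r2 r20 H2] := straight_chronological (g := g) ip (normal_timelike g i p) (ltr01 : 0 < T.2).
have [r3 r30 H3] := (nbhs_ballP _ _).1 (st_img_nbhs ip).
pose r0 := Num.min r1 (Num.min r2 r3).
have r00 : 0 < r0 by rewrite !lt_min r10 r20.
have r00' : 0 < r0 / 2 by rewrite divr_gt0.
have r0E v : ball p r0 v -> [/\ ball p r1 v, ball p r2 v & img i v.1].
  move=> hv; have hv' := ball_minr hv.
  by split; [exact: ball_minl hv|exact: ball_minl hv'|apply: H3; exact: ball_minr hv'].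
pose U0 : set (spacetime M) := [set y | [/\ dom i y.1, ball p (r0 / 2) (st_coord i y),
   unst i (st_coord i y) = y & `|y.2 - z.2| < s0 / 2]].
have hU0 : nbhs z U0.
  have K1 := chart_nbhs iz (nbhsx_ballx p _ r00').
  have K2 : \forall y \near z, `|y.2 - z.2| < s0 / 2.
    have s02 : 0 < s0 / 2 by rewrite divr_gt0.
    have : \forall t \near z.2, `|t - z.2| < s0 / 2.
      by apply/nbhs_ballP; exists (s0 / 2) => // t; rewrite -ball_normE /ball_/= distrC.
    exact: cvg_snd.
  near=> y; have [iy hy yE] : [/\ dom i y.1, ball p (r0 / 2) (st_coord i y) & unst i (st_coord i y) = y].
    by near: y.
  by split=> //; near: y.
have [W [hW WU Wconv]] := convex_nbhs g hU0.
exists W°; first exact: nbhs_interior.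
move=> x q r Wq' Wr' qr xq.
have Wq := interior_subset Wq'; have Wr := interior_subset Wr'.
pose t1 := z.2 + s0 / 2; pose sg (y : spacetime M) := t1 - y.2.
have sgW y : W y -> 0 < sg y < s0.
  by move=> /WU[_ _ _]; rewrite ltr_norml /sg /t1; lra.
pose m := `|T| + 1; have m0 : 0 < m by rewrite ltr_wpDl.
have [rho rho0 Hrho] : exists2 rho, 0 < rho & forall v, ball (st_coord i q) rho v ->
    chronological g x (unst i v).
  have [iq _ qE _] := WU _ Wq.
  have : nbhs (st_coord i q) (unst i @^-1` Iplus g x).
    apply: (@unst_continuous _ _ M i (st_coord i q)); first exact: img_phi.
    by rewrite qE; exact: chronological_near.
  by move=> /nbhs_ballP[rho rho0 Hrho]; exists rho.
(* small enough for the slide to stay in the chart ball and, from [q], in the future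
   of [x] *)
pose eta := Num.min (r0 / 2) (rho / 2) / (2 * (s0 * m)).
have eta0 : 0 < eta.
  by rewrite divr_gt0 ?lt_min ?r00' ?divr_gt0// mulr_gt0// mulr_gt0.
have etaT y : W y -> `|(eta * sg y) *: T| < r0 / 2 /\ `|(eta * sg y) *: T| < rho / 2.
  move=> /sgW/andP[sy0 sys]; apply/andP; rewrite -lt_min.
  set mm := Num.min _ _; have mm0 : 0 < mm by rewrite lt_min r00' divr_gt0.
  apply: (@le_lt_trans _ _ (mm / 2)); last by rewrite ltr_pdivrMr// ltr_pMr// ltr1n.
  have -> : `|(eta * sg y) *: T| = eta * (sg y * `|T|).
    by rewrite normrZ normrM (gtr0_norm eta0) (gtr0_norm sy0) mulrA.
  apply: (@le_trans _ _ (eta * (s0 * m))).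
    apply: ler_wpM2l; first exact: ltW.
    by apply: ler_pM => //; [exact: ltW|exact: ltW|rewrite lerDl].
  rewrite /eta -/mm le_eqVlt; apply/orP; left; apply/eqP; field.
  by rewrite !gt_eqF.
pose Phi := slide T eta t1.
have PhiE y : Phi (st_coord i y) = st_coord i y - (eta * sg y) *: T by [].
have Phi_ball y : W y -> ball p r0 (Phi (st_coord i y)).
  move=> Wy; have [_ by_ _ _] := WU _ Wy; have [h _] := etaT _ Wy.
  move: by_; rewrite PhiE -!ball_normE /ball_/= opprB addrCA addrC => by_.
  by rewrite (splitr r0) (le_lt_trans (ler_normD _ _))// ltrD.
have slideW y X : W y -> lorentz g i y X X < 0 -> 0 < X.2 ->
     [/\ dom i y.1, img i (slide T eta t1 (st_coord i y)).1,
      lorentz g i (unst i (slide T eta t1 (st_coord i y)))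
        (X + (eta * X.2) *: T) (X + (eta * X.2) *: T) < 0 &
      0 < (X + (eta * X.2) *: T).2].
  move=> Wy QX X2; have [iy by_ yE _] := WU _ Wy; have hP := Phi_ball _ Wy.
  have [b1 _ i1] := r0E _ hP; have /andP[sy0 sys] := sgW _ Wy.
  have b0 : ball p r0 (st_coord i y).
    by apply: le_ball by_; rewrite ler_pdivrMr// ler_pMr// ler1n.
  have [b1' _ _] := r0E _ b0.
  split=> //.
    apply: (H1 (st_coord i y) (eta * sg y) eta X b1' b1 eta0 _ _ X2); last by rewrite yE.
    apply/andP; split; first by apply: mulr_ge0; exact: ltW.
    by rewrite ler_pM2l//; exact: ltW.
  by rewrite /= /GRing.scale/= mulr1 addr_gt0// mulr_gt0.
have [iq bq qE _] := WU _ Wq; have [ir br rE _] := WU _ Wr.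
pose A := W `&` [set y | ball (st_coord i q) (rho / 2) (st_coord i y)].
pose er := eta * sg r / 2.
have er0 : 0 < er by have /andP[? _] := sgW _ Wr; rewrite divr_gt0// mulr_gt0.
pose B := W `&` [set y | ball (st_coord i r) (er * r2) (st_coord i y) /\ sg r / 2 < sg y].
have hA : nbhs q A.
  apply: filterI; first exact: Wq'.
  have rho2 : 0 < rho / 2 by rewrite divr_gt0.
  exact: (st_coord_continuous iq (nbhsx_ballx _ _ rho2)).
have hB : nbhs r B.
  apply: filterI; first exact: Wr'.
  apply: filterI.
    have er2 : 0 < er * r2 by rewrite mulr_gt0.
    exact: (st_coord_continuous ir (nbhsx_ballx _ _ er2)).
  have h : r.2 < t1 - sg r / 2 by have /andP[] := sgW _ Wr; rewrite /sg; lra.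
  have : \forall y \near r, y.2 < t1 - sg r / 2 by exact: cvg_snd (lt_nbhsl h).
  by apply: filterS => y; rewrite /= /sg; lra.
have [q' [r' [[Wq1 hq'] [Wr1 [hr' sr']] q'r']]] := qr A B hA hB.
(* three steps: [x] << slid [q'] << slid [r'] << [r] *)
have xPq : chronological g x (unst i (Phi (st_coord i q'))).
  have [_ h] := etaT _ Wq1; apply: Hrho.
  move: hq'; rewrite PhiE /= -!ball_normE /ball_/= opprB addrCA addrC => hq'.
  by rewrite (splitr rho) (le_lt_trans (ler_normD _ _))// ltrD.
have xPr : chronological g x (unst i (Phi (st_coord i r'))).
  case: q'r' => [<-//|[D q'r']].
  apply: (chronological_trans xPq); apply: (timelike_slide (W := W) _ _ q'r') => //.
    by move=> y /WU[].
  exact: Wconv q'r' Wq1 Wr1.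
apply: (chronological_trans xPr); rewrite -[in X in chronological _ _ X]rE.
have [_ b2 _] := r0E _ (Phi_ball _ Wr1).
have /andP[sr0 _] := sgW _ Wr1; have k0 : 0 < eta * sg r' by rewrite mulr_gt0.
apply: (H2 _ _ (eta * sg r')) => //.
  apply: le_ball br; apply: (@le_trans _ _ r0); first by rewrite ler_pdivrMr// ler_pMr// ler1n.
  by rewrite !ge_min lexx !orbT.
have -> : st_coord i r - Phi (st_coord i r') =
    (eta * sg r') *: T + (st_coord i r - st_coord i r').
  by rewrite PhiE opprB addrCA addrC -addrA.
rewrite scalerDr scalerA mulVf ?gt_eqF// scale1r.
move: hr'; rewrite -!ball_normE /ball_/= opprD addrA subrr sub0r normrN normrZ => hr'.
rewrite gtr0_norm ?invr_gt0// ltr_pdivrMl//; apply: (lt_le_trans hr').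
rewrite ler_pM2r// /er -mulrA ler_pM2l//; exact: ltW.
Unshelve. all: by end_near. Qed.

End LocalPush.

(** * Limit curves and global push-up *)

Section Limits.

(** Every cluster point of an ultrafilter is a limit. *)
Lemma ultra_limit (T : Type) (V : topologicalType) (G : set_system T) (K : set V)
    (f : T -> V) : UltraFilter G -> compact K -> G (f @^-1` K) ->
  exists2 l, K l & f @ G --> l.
Proof.
move=> UG cK GK; have PG : ProperFilter (f @ G) by exact: fmap_proper_filter.
have [l [Kl cl]] := cK (f @ G) PG GK; exists l => // B hB.
have [//|nB] := in_ultra_setVsetC (f @^-1` B) UG.
by have [y [nBy By]] := cl (~` B) B nB hB.
Qed.

Lemma hausdorff_prod (U V : topologicalType) : hausdorff_space U -> hausdorff_space V ->
  hausdorff_space (U * V)%type.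
Proof.
move=> hU hV [a b] [c d] cl; congr pair.
  apply: hU => A B hA hB.
  have hA' : nbhs (a, b) [set p : U * V | A p.1] by exact: cvg_fst.
  have hB' : nbhs (c, d) [set p : U * V | B p.1] by exact: cvg_fst.
  by have [[x y] [/= Ax Bx]] := cl _ _ hA' hB'; exists x.
apply: hV => A B hA hB.
have hA' : nbhs (a, b) [set p : U * V | A p.2] by exact: cvg_snd.
have hB' : nbhs (c, d) [set p : U * V | B p.2] by exact: cvg_snd.
by have [[x y] [/= Ax Bx]] := cl _ _ hA' hB'; exists y.
Qed.

Variable R : realType.

Lemma interval_induction (a b : R) (S : R -> Prop) : a <= b -> S a ->
  (forall t, a <= t <= b -> exists2 d, 0 < d & forall t1 t2, a <= t1 -> t1 <= t2 -> t2 <= b ->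
     `|t1 - t| < d -> `|t2 - t| < d -> S t1 -> S t2) -> S b.
Proof.
move=> ab Sa step; pose A : set R := [set t | a <= t <= b /\ S t].
have Aa : A a by split=> //; rewrite lexx.
have hA : has_sup A by split; [exists a|exists b => t [/andP[]]].
pose s := sup A.
have sa : a <= s by exact: sup_upper_bound.
have sb : s <= b by apply: ge_sup; [exists a|move=> t [/andP[]]].
have [d d0 hd] := step s (introT andP (conj sa sb)).
have [t1 [/andP[at1 t1b] St1] t1s] := sup_adherent d0 hA.
have t1s' : t1 <= s by apply: sup_upper_bound => //; split=> //; rewrite at1.
pose t2 := Num.min b (s + d / 2).
have st2 : s <= t2 by rewrite le_min sb lerDl divr_ge0// ltW.
have t2b : t2 <= b by rewrite ge_min lexx.
have t2s : t2 <= s + d / 2 by rewrite ge_min lexx orbT.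
have St2 : S t2.
  apply: (hd t1 t2) => //; first exact: le_trans st2.
    by rewrite -/s in t1s; rewrite ler0_norm ?subr_le0// opprB ltrBlDr -ltrBlDl.
  by rewrite ger0_norm ?subr_ge0//; lra.
have t2s' : t2 <= s by apply: sup_upper_bound => //; split=> //; rewrite (le_trans sa).
have [tb|tb] := leP b (s + d / 2); first by have -> : b = t2 by rewrite /t2 min_l.
by exfalso; move: t2s'; rewrite /t2 min_r ?(ltW tb)//; lra.
Qed.

End Limits.

Section Reach.
Variables (R : realType) (n : nat) (M : smooth_manifold R n) (g : sliced_metric M).
Implicit Types (x y z w p q : spacetime M).

Lemma spacetime_hausdorff : hausdorff_space (spacetime M).
Proof. by apply: hausdorff_prod; [exact: points_hausdorff|exact: Rhausdorff]. Qed.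

Hypothesis diamonds : forall x w, exists2 K : set (spacetime M), compact K &
  Iplus g x `&` Iminus g w `<=` K.

(** The relative compactness of the diamonds makes each time slice of the curves from
    [x] to events near [z] converge along an ultrafilter. The limit curve is
    continuous, as bump functions vary along it at bounded speed, so
    [interval_induction] carries [local_push] from [x] to [z]. *)
Lemma push_up x' x z : chronological g x' x -> closure (Iplus g x) z -> chronological g x' z.
Proof.
move=> x'x clz; have [w hw] := later_event g z.
have [K0 cK0 HK0] := diamonds x w.
pose D := Iplus g x `&` Iminus g w.
have clD : closure D z.
  move=> B hB; have [y [xy [By yw]]] := clz _ (filterI hB hw).
  by exists y.
have PF : ProperFilter (within D (nbhs z)) by exact: within_nbhs_proper.
have [G [UG sG]] := ultraFilterLemma PF.
have GD : G D by apply: sG; exact: withinT.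
have Gz : nbhs z `<=` G by move=> A hA; apply: sG; exact: cvg_within hA.
have /boolp.choice[Cv HCv] : forall y, exists C, D y -> timelike_curve g x y C.
  move=> y.
  by have [[[C xy] _]|nD] := pselect (D y); [exists C|exists set0].
(* [ga (y, t)] is the event at time [t] on the curve from [x] to [y], or [y] itself
   once [t] is past the time of [y] *)
have /boolp.choice[ga Hga0] : forall yt : spacetime M * R, exists p, D yt.1 -> x.2 <= yt.2 ->
    Cv yt.1 p /\ p.2 = Num.min yt.2 yt.1.2.
  move=> [y t] /=.
  have [[Dy xt]|nh] := pselect (D y /\ x.2 <= t); last by exists y => Dy xt; exfalso; apply: nh.
  have [|p Cp pt] := @timelike_at_time _ _ _ _ _ _ _ (Num.min t y.2) (HCv y Dy).
    rewrite le_min xt ltW ?(timelike_time_lt (HCv y Dy))//= ge_min lexx orbT//.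
  by exists p.
have Hga y t : D y -> x.2 <= t -> Cv y (ga (y, t)) /\ (ga (y, t)).2 = Num.min t y.2.
  exact: (Hga0 (y, t)).
pose K := K0 `|` [set x].
have cK : compact K by apply: compactU => //; exact: compact_set1.
have gaK t y : D y -> x.2 <= t -> K (ga (y, t)).
  move=> Dy xt; have [Cp pt] := Hga y t Dy xt; have xy := HCv y Dy.
  have [Cx Cy] := timelike_ends xy.
  case: (timelike_between xy Cx Cp) => [<-|[D1 _ xp]|[D1 _ /timelike_time_lt]]; first by right.
    left; apply: HK0; split; first by exists D1.
    have [_ yw] := Dy.
    case: (timelike_between xy Cp Cy) => [-> //|[D2 _ py]|[D2 _ /timelike_time_lt]].
      by apply: chronological_trans yw; exists D2.
    by have /andP[_] := timelike_mem_time xy Cp; rewrite ltNge => ->.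
  by have /andP[+ _] := timelike_mem_time xy Cp; rewrite ltNge => ->.
have /boolp.choice[Ga HGa] : forall t, exists p, x.2 <= t -> ga (y, t) @[y --> G] --> p.
  move=> t.
  have [xt|nxt] := pselect (x.2 <= t); last by exists x => /nxt.
  have [|l _ hl] := @ultra_limit _ _ G K (fun y => ga (y, t)) UG cK; last by exists l.
  by apply: filterS GD => y Dy; exact: gaK.
have PG : ProperFilter G by exact: ultra_proper.
have cid_ : y @[y --> G] --> z by exact: Gz.
have c2 : y.2 @[y --> G] --> z.2 by apply: (cvg_comp _ _ cid_); exact: cvg_snd.
have cdist : `|y.2 - z.2| @[y --> G] --> (0 : R).
  have : `|y.2 - z.2| @[y --> G] --> `|z.2 - z.2|.
    by apply: cvg_norm; apply: cvgB => //; exact: cvg_cst.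
  by rewrite subrr normr0.
have xz : x.2 <= z.2.
  apply: (@ler_cvg_to _ G PG _ (fun=> x.2) (fun y => y.2)) => //; first exact: cvg_cst.
  by apply: filterS GD => y [[C /timelike_time_lt/ltW]].
have cGa2 t : x.2 <= t -> (ga (y, t)).2 @[y --> G] --> (Ga t).2.
  by move=> /HGa h; apply: (cvg_comp _ _ h); exact: cvg_snd.
have Gtime t : x.2 <= t -> t <= z.2 -> (Ga t).2 = t.
  move=> xt tz; apply/eqP; rewrite -subr_eq0 -normr_le0.
  apply: (@ler_cvg_to _ G PG _ (fun y => `|(ga (y, t)).2 - t|) (fun y => `|y.2 - z.2|)) => //.
    by apply: cvg_norm; apply: cvgB; [exact: cGa2|exact: cvg_cst].
  apply: filterS GD => y Dy; have [_ ->] := Hga y t Dy xt.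
  have [ty|yt] := leP t y.2; first by rewrite subrr normr0.
  by rewrite !ltr0_norm ?subr_lt0//; [lra|exact: lt_le_trans tz].
have GD1 : G [set y | D y /\ y.2 <= z.2 + 1].
  apply: filterI => //.
  have h : z.2 < z.2 + 1 by rewrite ltrDl.
  have H : G [set y | y.2 < z.2 + 1] := c2 _ (lt_nbhsl h).
  by apply: filterS H => y /ltW.
(* points of one curve are causally related, so the points of the limit curve are
   limits of such pairs *)
have pairs y t1 t2 : D y -> x.2 <= t1 -> t1 <= t2 ->
    ga (y, t1) = ga (y, t2) \/ exists C, timelike_curve g (ga (y, t1)) (ga (y, t2)) C.
  move=> Dy xt1 t12; have [C1 T1] := Hga y t1 Dy xt1.
  have [C2 T2] := Hga y t2 Dy (le_trans xt1 t12).
  case: (timelike_between (HCv y Dy) C1 C2) => [|[C _ h]|[C _ /timelike_time_lt]]; first by left.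
    by right; exists C.
  by rewrite T1 T2 ltNge le_min !ge_min t12 lexx orbT.
have lip F : msmooth F -> (exists2 K, compact K & forall m, ~ K m -> F m = 0) ->
  exists2 C : R, 0 < C & forall t1 t2, x.2 <= t1 -> t1 <= t2 -> t2 <= z.2 ->
    `|F (Ga t2).1 - F (Ga t1).1| <= C * (t2 - t1) /\
    `|F z.1 - F (Ga t1).1| <= C * (z.2 - t1).
  move=> hF sF; have [C C0 HC] := global_speed_bound g x.2 (z.2 + 1) hF sF.
  have cF t : x.2 <= t -> F (ga (y, t)).1 @[y --> G] --> F (Ga t).1.
    move=> /HGa h; apply: (cvg_comp (fun y => (ga (y, t)).1) F).
      by apply: (cvg_comp _ _ h); exact: cvg_fst.
    exact: msmooth_continuous.
  have cFz : F y.1 @[y --> G] --> F z.1.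
    apply: (cvg_comp (fun y : spacetime M => y.1) F).
      by apply: (cvg_comp _ _ cid_); exact: cvg_fst.
    exact: msmooth_continuous.
  have L p q : p = q \/ (exists D, timelike_curve g p q D) -> x.2 <= p.2 -> q.2 <= z.2 + 1 ->
      `|F q.1 - F p.1| <= C * (q.2 - p.2).
    case=> [->|[D' pq]] xp qz; first by rewrite !subrr normr0 mulr0.
    exact: (timelike_lipschitz hF HC pq).
  exists C => // t1 t2 xt1 t12 t2z; have xt2 := le_trans xt1 t12; split.
    apply: (@ler_cvg_to _ G PG _ (fun y => `|F (ga (y, t2)).1 - F (ga (y, t1)).1|)
      (fun=> C * (t2 - t1))); [|exact: cvg_cst|].
      by apply: cvg_norm; apply: cvgB; exact: cF.
    apply: filterS GD1 => y [Dy yz].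
    have [C1 T1] := Hga y t1 Dy xt1; have [C2 T2] := Hga y t2 Dy xt2.
    have /andP[h1 _] := timelike_mem_time (HCv y Dy) C1.
    have /andP[_ h2] := timelike_mem_time (HCv y Dy) C2.
    apply: le_trans (L _ _ (pairs y t1 t2 Dy xt1 t12) h1 (le_trans h2 yz)) _.
    rewrite ler_pM2l// T1 T2; have [h3|h3] := leP t2 y.2; have [h4|h4] := leP t1 y.2 => //.
    - by have := le_trans t12 h3; rewrite leNgt h4.
    - by rewrite lerD2r ltW.
    - by rewrite subrr subr_ge0.
  apply: (@ler_cvg_to _ G PG _ (fun y => `|F y.1 - F (ga (y, t1)).1|)
    (fun y => C * (`|y.2 - z.2| + (z.2 - t1)))).
  - by apply: cvg_norm; apply: cvgB => //; exact: cF.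
  - have : C * (`|y.2 - z.2| + (z.2 - t1)) @[y --> G] --> C * (0 + (z.2 - t1)).
      by apply: cvgM; [exact: cvg_cst|apply: cvgD => //; exact: cvg_cst].
    by rewrite add0r.
  apply: filterS GD1 => y [Dy yz]; have xy := HCv y Dy.
  have [C1 T1] := Hga y t1 Dy xt1; have [_ Cy] := timelike_ends xy.
  have /andP[h1 h1'] := timelike_mem_time xy C1.
  have R1 : ga (y, t1) = y \/ exists C, timelike_curve g (ga (y, t1)) y C.
    case: (timelike_between xy C1 Cy) => [|[C' _ h]|[C' _ /timelike_time_lt]]; first by left.
      by right; exists C'.
    by rewrite ltNge h1'.
  apply: le_trans (L _ _ R1 h1 yz) _; rewrite ler_pM2l// T1.
  have t1z := le_trans t12 t2z.
  have [h3|h3] := leP t1 y.2; first by have := ler_norm (y.2 - z.2); lra.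
  by rewrite subrr addr_ge0// subr_ge0.
have G0 : Ga x.2 = x.
  apply: (@cvg_unique _ spacetime_hausdorff (ga (y, x.2) @[y --> G])); first exact: HGa.
  suff E : \forall y \near G, x = ga (y, x.2).
    exact: cvg_trans (near_eq_cvg E) (cvg_cst x).
  apply: filterS GD => y Dy; have xy := HCv y Dy; have [C1 T1] := Hga y x.2 Dy (lexx _).
  have [Cx _] := timelike_ends xy.
  case: (timelike_between xy Cx C1) => [//|[C' _ /timelike_time_lt]|[C' _ /timelike_time_lt]].
    by rewrite T1 lt_min ltxx.
  by rewrite T1 gt_min ltxx /= ltNge ltW// (timelike_time_lt xy).
have G1 : Ga z.2 = z.
  have G12 := Gtime z.2 xz (lexx _).
  suff G11 : (Ga z.2).1 = z.1 by rewrite [LHS]surjective_pairing G11 G12 -surjective_pairing.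
  apply: contrapT => ne.
  have hne : nbhs z.1 (~` [set (Ga z.2).1]).
    apply: open_nbhs_nbhs; split; last by move=> /= E; apply: ne; rewrite E.
    rewrite openC; apply: compact_closed; last exact: compact_set1.
    exact: points_hausdorff.
  have [F [Fc [bF Fz _ FU]]] := bump_exists hne.
  have [C C0 HC] := lip F (bump_smooth bF) (bump_support bF).
  have [_] := HC z.2 z.2 xz (lexx _) (lexx _).
  rewrite subrr mulr0 normr_le0 subr_eq0 => /eqP E.
  have := FU (Ga z.2).1; rewrite -E gt_eqF// => /(_ isT); exact.
rewrite -G1; apply: (@interval_induction _ x.2 z.2 (fun t => chronological g x' (Ga t))) => //.
  by rewrite G0.
move=> t /andP[xt tz].
have [U hU HU] := local_push g (Ga t).
have [d d0 Hd] : exists2 d : R, 0 < d & forall s, x.2 <= s -> s <= z.2 -> `|s - t| < d -> U (Ga s).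
  move: hU => [[A B] [/= hA hB] ABU].
  have [F [Fc [bF Ft _ FU]]] := bump_exists hA.
  have [C C0 HC] := lip F (bump_smooth bF) (bump_support bF).
  have [dB dB0 HdB] := (nbhs_ballP _ _).1 hB.
  exists (Num.min dB (F (Ga t).1 / C)); first by rewrite lt_min dB0 divr_gt0.
  move=> s xs sz; rewrite lt_min => /andP[sB sF]; apply: ABU; split=> /=.
    apply: FU; apply/eqP => Fs0; move: sF; rewrite ltr_pdivlMr// mulrC ltNge => /negP; apply.
    have [st|ts] := leP s t.
      have [+ _] := HC s t xs st tz; rewrite Fs0 subr0 (@ler0_norm _ (s - t)) ?subr_le0// opprB.
      by apply: le_trans; exact: ler_norm.
    have [+ _] := HC t s xt (ltW ts) sz; rewrite Fs0 sub0r normrN gtr0_norm ?subr_gt0// => h.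
    by rewrite gtr0_norm ?subr_gt0.
  by apply: HdB; rewrite -ball_normE /ball_/= distrC !Gtime.
exists d => // t1 t2 xt1 t12 t2z h1 h2.
have xt2 := le_trans xt1 t12; have t1z := le_trans t12 t2z.
apply: HU; [exact: Hd|exact: Hd|].
move=> A B hA hB.
have [y [Dy Ay By]] : exists y, [/\ D y, A (ga (y, t1)) & B (ga (y, t2))].
  have GA : G [set y | A (ga (y, t1))] := HGa t1 xt1 A hA.
  have GB : G [set y | B (ga (y, t2))] := HGa t2 xt2 B hB.
  by have [y [[Dy Ay] By]] := filter_ex (filterI (filterI GD GA) GB); exists y.
by exists (ga (y, t1)), (ga (y, t2)); split=> //; exact: pairs.
Qed.

End Reach.

(** * Diamonds, cylinders and global hyperbolicity *)

Section ProjectedLength.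
Variables (R : realType) (n : nat) (M : smooth_manifold R n) (g : sliced_metric M).
Variable h : riemannian_metric M.

(** The chart in which the speed is computed varies with the parameter; the speed does
    not depend on it. *)
Lemma timelike_curve_length x y C : timelike_curve g x y C ->
  exists l, curve_length h x.1 y.1 l.
Proof.
elim=> {x y C} [c a b ab hc|x y z C C' _ [l xy] _ [l' yz]]; last first.
  by exists (l + l'); exact: curve_length_join xy yz.
pose j s := sval (cid (atlas_cover (c s).1)).
have jc s : dom (j s) (c s).1 by exact: svalP (cid (atlas_cover (c s).1)).
pose v s := let u := derive1 (phi (j s) \o (fst \o c)) s in
  Num.sqrt (bilin (h (j s) (c s).1) u u).
have Cc s : a <= s <= b -> C1_curve_at (fst \o c) s.
  move=> sab; split; first exact: timelike_fst_continuous (hc s sab).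
  by move=> i ic; have [_ /(_ i ic)[C1 _ _]] := hc s sab; exact: (C1_at_fst C1).
have cv s : a <= s <= b -> is_speed h (fst \o c) s (v s).
  move=> sab i ic u.
  have [dj _] := timelike_coord (hc s sab) (jc s).
  have E := curve_change_chart (timelike_fst_continuous (hc s sab)) (jc s) ic dj.
  have [_ _ inv] := riem_inner h.
  have E' := inv _ _ _ (derive1 (phi (j s) \o (fst \o c)) s) (derive1 (phi (j s) \o (fst \o c)) s) (jc s) ic.
  rewrite /v /u E; exact: congr1 (esym E').
exists (Rintegral lebesgue_measure `[a, b] v).
exact: (curve_length_segment ab Cc cv).
Qed.

End ProjectedLength.

Theorem theorem3p1 (R : realType) (n : nat) (hn : (2 <= n)%N)
    (M : smooth_manifold R n) :
  exists h : riemannian_metric M,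
    appropriate h /\
    forall g : sliced_metric M,
      globally_hyperbolic g <->
      (forall D : set (spacetime M), basic_open_A g D ->
         exists B : set (spacetime M), basic_open_P h B /\ D `<=` B).
Proof.
have [h [happ hK]] := @proper_metric_exists R n M.
exists h; split=> // g; split=> [[_ cJ] _ [x [y ->]]|cyl].
  pose D1 := fst @` (Iplus g x `&` Iminus g y).
  have cK : compact (fst @` (Jplus g x `&` Jminus g y)).
    apply: continuous_compact; last exact: cJ.
    by apply: continuous_subspaceT => z; exact: cvg_fst.
  have D1K : D1 `<=` fst @` (Jplus g x `&` Jminus g y).
    by apply: image_subset => z [xz zy]; split; exact: subset_closure.
  have D1x : D1 `<=` reachable h x.1.
    by move=> _ [z [[C xz] _] <-]; exact: timelike_curve_length xz.
  have [e e0 He] := reachable_in_ball cK D1K D1x.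
  exists (riem_ball h x.1 e `*` [set t | x.2 < t < Num.max y.2 (x.2 + 1)]); split.
    exists x.1, e, x.2, (Num.max y.2 (x.2 + 1)); split=> //.
    by rewrite lt_max ltrDl ltr01 orbT.
  move=> z Dz; split; first by apply: He; exists z.
  have [[C xz] [C' zy]] := Dz.
  by rewrite /= (timelike_time_lt xz) lt_max (timelike_time_lt zy).
have diamonds x w : exists2 K : set (spacetime M), compact K & Iplus g x `&` Iminus g w `<=` K.
  have [|B [[m [e [a [b [_ _ ->]]]]] DB]] := cyl (Iplus g x `&` Iminus g w); first by exists x, w.
  have [K cK mK] := hK m e; exists (K `*` `[a, b]).
    exact: compact_setX cK (@segment_compact _ a b).
  move=> z /DB[/mK Kz /andP[/ltW az /ltW zb]]; split=> //=.
  by rewrite in_itv/= az.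
split; first exact: sliced_strongly_causal.
move=> x y; have [x' x'x] := earlier_event g x.
have [K cK DK] := diamonds x' y.
have clK : closed K by apply: compact_closed => //; exact: spacetime_hausdorff.
apply: (subclosed_compact _ cK); first by apply: closedI; exact: closed_closure.
move=> z [xz zy]; rewrite (iffLR (closure_id K) clK); apply: (closure_subset DK) => B hB.
have x'z := push_up diamonds x'x xz.
have [u [uy [Bu x'u]]] := zy _ (filterI hB (chronological_near x'z)).
by exists u.
Qed.
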